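(* Let $\gamma>0$ and let $f:\mathbb{R}^n\rightarrow\mathbb{R}$ be a $C^{1,1}_{\mathrm{loc}}$ lower bounded function that is definable in an o-minimal structure on the real field. Then the following two statements are equivalent: (i) for every $(x_0,\dot{x}_0)\in\mathbb{R}^n\times\mathbb{R}^n$, the global solutions $x_\epsilon:[0,\infty)\to\mathbb{R}^n$ to $$\epsilon\ddot{x}_\epsilon(t)+\gamma\dot{x}_\epsilon(t)+\nabla f(x_\epsilon(t))=0,\quad \forall t\geqslant 0,\qquad x_\epsilon(0)=x_0,\quad \dot{x}_\epsilon(0)=\dot{x}_0,$$ are uniformly bounded for all sufficiently small $\epsilon>0$, i.e., there exist $\bar{\epsilon}>0$ and $c>0$ such that $\|x_\epsilon(t)\|\leqslant c$ for all $t\geqslant 0$ and all $\epsilon\in(0,\bar{\epsilon}]$; (ii) for every $x_0\in\mathbb{R}^n$, the global solution $x:[0,\infty)\to\mathbb{R}^n$ to $$\gamma\dot{x}(t)+\nabla f(x(t))=0,\quad \forall t\geqslant 0,\qquad x(0)=x_0,$$ is bounded.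
   Context: $\|\cdot\|$ is the norm induced by an inner product $\langle\cdot,\cdot\rangle$ on $\mathbb{R}^n$, and $\nabla f$ denotes the gradient of a $C^1$ function $f:\mathbb{R}^n\to\mathbb{R}$ with respect to $\langle\cdot,\cdot\rangle$. A $C^1$ function $f$ is called $C^{1,1}_{\mathrm{loc}}$ if $\nabla f$ is locally Lipschitz continuous. Lower bounded means $\inf_{\mathbb{R}^n}f>-\infty$. For a $C^{1,1}_{\mathrm{loc}}$ lower bounded function, it is known that both initial value problems above have a unique global solution on $[0,\infty)$ (for every $\epsilon>0$ in the case of the second-order one); this is what ''the global solution'' refers to. *)

(* Defs.v *)
From HB Require Import structures.
From mathcomp Require Import all_boot all_order all_algebra.
From mathcomp Require Import all_classical all_reals all_analysis.

Set Implicit Arguments.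
Unset Strict Implicit.
Unset Printing Implicit Defensive.

Import Order.TTheory GRing.Theory Num.Theory.
Import numFieldNormedType.Exports.

Local Open Scope classical_set_scope.
Local Open Scope ring_scope.

Definition ip_norm (R : realType) (n : nat) (ip : {dot 'rV[R]_n for idfun})
  (u : 'rV[R]_n) : R := Num.sqrt (ip u u).

(* The topology on 'rV[R]_n, hence differentiability and the differential 'd,
   comes from the max norm; in finite dimension this agrees with the topology of
   ip_norm. The gradient does depend on ip: it is the Riesz representative
   of the differential, see gradientP. *)
Definition gradient (R : realType) (n : nat) (ip : {dot 'rV[R]_n for idfun})
  (f : 'rV[R]_n -> R) (x : 'rV[R]_n) : 'rV[R]_n :=
  get [set g : 'rV[R]_n | forall v, 'd f x v = ip g v].

Lemma gradientP (R : realType) (n : nat) (ip : {dot 'rV[R]_n for idfun})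
  (f : 'rV[R]_n -> R) (x v : 'rV[R]_n) : 'd f x v = ip (gradient ip f x) v.
Proof.
have ipE u w : ip u w = \sum_j ip u (delta_mx 0 j) * w 0 j.
  rewrite [in LHS](row_sum_delta w) linear_sum /=.
  by apply: eq_bigr => j _; rewrite linearZ /= mulrC.
pose G : 'M[R]_n := \matrix_(i, j) ip (delta_mx 0 i) (delta_mx 0 j).
have uG u : u *m G = \row_j ip u (delta_mx 0 j).
  apply/rowP => j; rewrite !mxE [in RHS](row_sum_delta u) linear_sumlz.
  by apply: eq_bigr => i _; rewrite mxE linearZl_LR.
have Gunit : G \in unitmx.
  rewrite -row_free_unit -kermx_eq0; apply/rowV0P => u /sub_kermxP uG0.
  apply/eqP/negPn/negP => u0.
  have : 0 < ip u u by exact: neq0_dnorm_gt0.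
  rewrite ipE big1 ?ltxx// => j _.
  by have := uG u; rewrite uG0 => /rowP/(_ j); rewrite !mxE => <-; rewrite mul0r.
suff: exists g, forall v, 'd f x v = ip g v.
  by move=> ex; have := getPex ex; apply.
exists ((\row_j 'd f x (delta_mx 0 j)) *m invmx G) => w.
set g := _ *m _; rewrite ipE {1}(row_sum_delta w) linear_sum /=.
apply: eq_bigr => j _; rewrite linearZ /= mulrC; congr (_ * _).
have := uG g; rewrite /g mulmxKV// => /rowP/(_ j).
by rewrite !mxE.
Qed.

Definition C11loc (R : realType) (n : nat) (ip : {dot 'rV[R]_n for idfun})
  (f : 'rV[R]_n -> R) : Prop :=
  [/\ forall x : 'rV[R]_n, differentiable f x,
      continuous (gradient ip f) &
      forall x : 'rV[R]_n, exists2 U, nbhs x U & exists L : R,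
        forall y z, U y -> U z ->
        ip_norm ip (gradient ip f y - gradient ip f z) <= L * ip_norm ip (y - z)].

(* S k is the collection of definable subsets of R^k. The last axiom says that
   S 1 consists exactly of the finite unions of points and intervals: the type
   interval R includes all bounded and unbounded intervals, `[a, a] being the
   point a. *)
Record o_minimal_structure (R : realType)
    (S : forall k : nat, set (set 'rV[R]_k)) : Prop := {
  omin_setT : forall k, S k setT;
  omin_setC : forall k (A : set 'rV[R]_k), S k A -> S k (~` A);
  omin_setU : forall k (A B : set 'rV[R]_k), S k A -> S k B -> S k (A `|` B);
  omin_cylr : forall k (A : set 'rV[R]_k),
    S k A -> S (k + 1)%N [set v : 'rV[R]_(k + 1) | A (lsubmx v)];
  omin_cyll : forall k (A : set 'rV[R]_k),
    S k A -> S (1 + k)%N [set v : 'rV[R]_(1 + k) | A (rsubmx v)];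
  omin_proj : forall k (A : set 'rV[R]_(k + 1)),
    S (k + 1)%N A -> S k ((fun v : 'rV[R]_(k + 1) => lsubmx v) @` A);
  omin_diag : forall k (i j : 'I_k), S k [set v : 'rV[R]_k | v 0 i = v 0 j];
  omin_add : S 3%N [set v : 'rV[R]_3 | v 0 0 + v 0 1 = v 0 2];
  omin_mul : S 3%N [set v : 'rV[R]_3 | v 0 0 * v 0 1 = v 0 2];
  omin_dim1 : forall A : set 'rV[R]_1, S 1%N A <->
    exists s : seq (interval R), A =
      [set v : 'rV[R]_1 | exists2 I, I \in s & v 0 0 \in I] }.

Definition definable_in (R : realType)
    (S : forall k : nat, set (set 'rV[R]_k)) (n : nat) (f : 'rV[R]_n -> R) :=
  S (n + 1)%N [set v : 'rV[R]_(n + 1) | rsubmx v = (f (lsubmx v))%:M].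

Definition definable_o_minimal (R : realType) (n : nat) (f : 'rV[R]_n -> R) :=
  exists2 S : forall k : nat, set (set 'rV[R]_k),
    o_minimal_structure S & definable_in S f.

(* Derivative at t of a function on [0, +oo[: one-sided at t = 0, and
   insensitive to the values at negative times. *)
Definition has_deriv_ge0 (R : realType) (n : nat) (x : R -> 'rV[R]_n)
  (t : R) (v : 'rV[R]_n) : Prop :=
  h^-1 *: (x (t + h) - x t) @[h --> within [set h | 0 <= t + h] 0^'] --> v.

Definition second_order_solution (R : realType) (n : nat)
    (ip : {dot 'rV[R]_n for idfun}) (f : 'rV[R]_n -> R) (gamma eps : R)
    (x0 v0 : 'rV[R]_n) (x : R -> 'rV[R]_n) : Prop :=
  exists x' x'' : R -> 'rV[R]_n,
    [/\ forall t, 0 <= t -> has_deriv_ge0 x t (x' t),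
        forall t, 0 <= t -> has_deriv_ge0 x' t (x'' t),
        forall t, 0 <= t ->
          eps *: x'' t + gamma *: x' t + gradient ip f (x t) = 0,
        x 0 = x0 & x' 0 = v0].

Definition first_order_solution (R : realType) (n : nat)
    (ip : {dot 'rV[R]_n for idfun}) (f : 'rV[R]_n -> R) (gamma : R)
    (x0 : 'rV[R]_n) (x : R -> 'rV[R]_n) : Prop :=
  exists x' : R -> 'rV[R]_n,
    [/\ forall t, 0 <= t -> has_deriv_ge0 x t (x' t),
        forall t, 0 <= t -> gamma *: x' t + gradient ip f (x t) = 0 &
        x 0 = x0].

(* Main.v *)
(* For (i) => (ii), let eps -> 0: on compact time intervals the solutions x_eps
   started at rest converge to x by Gronwall's lemma.

   For (ii) => (i), call p bad if arbitrarily close to p, and for arbitrarily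
   small eps, there start solutions of arbitrarily small initial kinetic energy
   that run arbitrarily far away. If (i) fails at (x0, v0) then x0 is bad, as
   eps |v0|^2 -> 0. The bad points form a closed set, invariant under the
   gradient flow by the convergence above; if (ii) holds, the
   flow line of a bad point p thus accumulates at a bad critical point q with
   f q <= f p. Conversely, below every bad critical point there is a bad point
   with a strictly smaller value. Indeed, an escaping solution travels a fixed
   distance, whereas the energy f(x) + eps |x'|^2 / 2 satisfies a
   Kurdyka-Lojasiewicz inequality which, summed over time windows of length eps,
   bounds the distance by the variation of a desingularizing function of the
   energy. The energy drop therefore does not tend to 0 with eps, and the limit
   of the exit points is bad. So the values of f at bad critical points have an
   infimum that is not attained, and critical values accumulate at it. By
   o-minimality all values slightly above it are then critical, contradicting the
   Kurdyka-Lojasiewicz inequality (Sard).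

   The inequality comes from a definable curve of points of minimal slope in the
   level sets of a compact region: its coordinates are monotone near any level,
   and the sum of their variations is the desingularizing function. *)
Require Import Defs.
From HB Require Import structures.
From mathcomp Require Import all_boot all_order all_algebra.
From mathcomp Require Import all_classical all_reals all_analysis.
From mathcomp Require Import ring lra.

Set Implicit Arguments.
Unset Strict Implicit.
Unset Printing Implicit Defensive.

Import Order.TTheory GRing.Theory Num.Theory.
Import numFieldNormedType.Exports.
Local Open Scope classical_set_scope.
Local Open Scope ring_scope.

(** The obstacle is the loss of uniformity as eps -> 0: speeds may reach order eps^(-1/2), and only
    eps |v|^2 is controlled. Three choices answer it. The velocity enters the energy through the
    scalar s = sqrt(eps) |v|: f(x) + s^2 / 2 is a definable function on R^(n+1) free of eps, so one
    desingularizing function serves all small eps. Windows have length eps because this is the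
    relaxation time of the velocity. And a trajectory is cut and restarted only at a time where the
    dissipation is at most an average bound: there |v| is bounded independently of eps, so that eps
    |v|^2 tends to 0.

    The desingularizing function psi is only known to be monotone. The inequality is therefore used
    in integrated form: b - a <= mu (psi b - psi a) as soon as every level between a and b contains
    a point of slope at most mu in the compact region. O-minimality enters through right germs of
    definable subsets of the line.

    The inequality holds on bounded regions only, whereas critical points may be unbounded; that
    critical values fill no interval is therefore obtained by countability, ball by ball. *)

(** * Real line *)

(* A Cousin-type induction: a transitive relation that holds between each point
   and its near neighbours holds between the endpoints. *)
Lemma creep (R : realType) (P : R -> R -> Prop) (a b : R) :
  a <= b ->
  (forall r s t, a <= r -> r <= s -> s <= t -> t <= b -> P r s -> P s t -> P r t) ->
  (forall c, a <= c <= b -> exists2 d : R, 0 < d &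
     forall s, a <= s <= b -> (c - d < s <= c -> P s c) /\ (c <= s < c + d -> P c s)) ->
  P a b.
Proof.
move=> ab tr loc.
pose S := [set s | a <= s <= b /\ P a s].
have Pxx c : a <= c <= b -> P c c.
  by move=> cab; have [d d0 /(_ c cab)[+ _]] := loc c cab; apply; lra.
have Sa : S a by split; [rewrite lexx ab|apply: Pxx; rewrite lexx ab].
have ubS : has_ubound S by exists b => s [/andP[]].
have hS : has_sup S by split => //; exists a.
set c := sup S.
have ac : a <= c by exact: ub_le_sup.
have cb : c <= b by apply: ge_sup; [exists a|move=> s [/andP[]]].
have [d d0 locc] := loc c ltac:(lra).
have [s [/andP[as' sb] Ps] cs] := sup_adherent d0 hS.
have sc : s <= c by apply: ub_le_sup => //; split => //; lra.
have [Psc _] := locc s ltac:(lra).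
have Pac : P a c by apply: (tr a s c) => //; apply: Psc; rewrite cs sc.
have [cb'|] := ltP c b; last by move=> bc; have -> : b = c by lra.
pose t := Num.min b (c + d / 2).
have [tb ct td] : [/\ t <= b, c < t & t < c + d].
  by rewrite /t /Num.min; case: ifPn => h; split; lra.
have [_ Pct] := locc t ltac:(lra).
have : S t by split; [lra|apply: (tr a c t) => //; [lra|apply: Pct; lra]].
by move=> /(ub_le_sup ubS); rewrite -/c; lra.
Qed.

Lemma countable_no_itv (R : realType) (A : set R) (a b : R) :
  countable A -> a < b -> ~ (`]a, b[%classic `<=` A).
Proof.
move=> cA ab sub.
have cI : countable `]a, b[%classic by apply: sub_countable cA; exact: subset_card_le.
have := countable_lebesgue_measure0 cI.
rewrite lebesgue_measure_itv /= lte_fin ab => /eqP.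
by rewrite -EFinD eqe subr_eq0; move: ab => /[swap] /eqP ->; rewrite ltxx.
Qed.

Lemma inj_countable (R : realType) (T : countType) (A : set R) (g : R -> T) :
  (forall x y, A x -> A y -> g x = g y -> x = y) -> countable A.
Proof.
move=> gi; apply/countable_injP; exists (pickle \o g) => x y /set_mem Ax /set_mem Ay.
by move=> /(pcan_inj pickleK); exact: gi.
Qed.

(* Two points of A with the same rational neighbourhood would contradict each
   other on [P]. *)
Lemma local_asym_countable (R : realType) (A : set R) (P : R -> R -> Prop) :
  (forall x, A x -> exists a b, a < x < b /\
     forall y, (a < y < x -> P y x) /\ (x < y < b -> ~ P x y)) -> countable A.
Proof.
move=> Amin.
have /choice[q qP] : forall x, exists p : rat * rat, A x ->
    ratr p.1 < x < ratr p.2 /\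
    forall y, (ratr p.1 < y < x -> P y x) /\ (x < y < ratr p.2 -> ~ P x y).
  move=> x; have [Ax|nAx] := pselect (A x); last by exists (0, 0).
  have [a [b [/andP[ax xb] Px]]] := Amin x Ax.
  have [p /itvP pP] := rat_in_itvoo ax; have [q /itvP qP] := rat_in_itvoo xb.
  exists (p, q) => _ /=; rewrite pP qP; split=> // y; split=> /andP[py yq].
    by apply: (Px y).1; rewrite yq (lt_trans _ py) ?pP.
  by apply: (Px y).2; rewrite py (lt_trans yq) ?qP.
have xy x y : A x -> A y -> q x = q y -> ~ x < y.
  move=> Ax Ay qxy xy; have [/andP[xq _] xP] := qP x Ax.
  have [/andP[_ yq] yP] := qP y Ay.
  apply: (xP y).2; first by rewrite xy qxy.
  by apply: (yP x).1; rewrite xy -qxy xq.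
apply: (@inj_countable _ _ A q) => x y Ax Ay qxy.
by have [/xy|/xy|//] := ltgtP x y; [move=> /(_ Ax Ay qxy)|move=> /(_ Ay Ax (esym qxy))].
Qed.

(** A rational chosen in the gap to the right of each point determines the point. *)
Lemma right_isolated_countable (R : realType) (A : set R) :
  (forall x, A x -> exists2 b, x < b & forall y, A y -> x < y -> b <= y) ->
  countable A.
Proof.
move=> Ais.
have /choice[q qP] : forall x, exists p : rat, A x ->
    x < ratr p /\ forall y, A y -> x < y -> ratr p < y.
  move=> x; have [Ax|nAx] := pselect (A x); last by exists 0.
  have [b xb bP] := Ais x Ax; have [p /itvP pP] := rat_in_itvoo xb.
  exists p => _; rewrite pP; split=> // y Ay xy.
  by rewrite (@lt_le_trans _ _ b) ?pP ?bP.
apply: (@inj_countable _ _ A q) => x y Ax Ay qxy.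
have [xq xP] := qP x Ax; have [yq yP] := qP y Ay.
have [xy|yx|//] := ltgtP x y.
- by have := xP y Ay xy; rewrite qxy => /(lt_trans yq); rewrite ltxx.
- by have := yP x Ax yx; rewrite -qxy => /(lt_trans xq); rewrite ltxx.
Qed.

(** The first time is the supremum of the times up to which u stays below r. Continuity is required
    relative to [a, b] only, the form in which [der_cont] and [vder_cont] provide it on [0, +oo[. *)
Lemma first_hit (R : realType) (u : R -> R) (a b r : R) :
  a <= b -> u a < r -> r <= u b ->
  (forall t, a <= t <= b -> forall e : R, 0 < e -> exists2 d : R, 0 < d &
     forall s, a <= s <= b -> `|s - t| < d -> `|u s - u t| < e) ->
  exists t, [/\ a < t <= b, u t = r & forall s, a <= s < t -> u s < r].
Proof.
move=> ab uar rub uc.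
pose S := [set t | a <= t <= b /\ forall s, a <= s <= t -> u s < r].
have Sa : S a.
  split; first by rewrite lexx ab.
  by move=> s sa; have -> : s = a by lra.
have ubS : has_ubound S by exists b => s [/andP[]].
have hS : has_sup S by split => //; exists a.
have [c cE] : exists c, c = sup S by exists (sup S).
have ac : a <= c by rewrite cE; exact: ub_le_sup.
have cb : c <= b by rewrite cE; apply: ge_sup; [exists a|move=> s [/andP[]]].
have below s : a <= s < c -> u s < r.
  move=> /andP[as' sc]; have e0 : 0 < c - s by lra.
  by have [t [tab tP] st] := sup_adherent e0 hS; apply: tP; rewrite -cE in st; lra.
have uc_ge : r <= u c.
  case: (leP r (u c)) => // ucr; exfalso.
  have [||d d0 dP] := uc c _ (r - u c); [lra|lra|].
  have [cb'|bc] := ltP c b; last first.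
    have bc' : b = c by lra.
    by move: rub; rewrite bc'; lra.
  have [t [tb ct td]] : exists t, [/\ t <= b, c < t & t < c + d].
    by exists (Num.min b (c + d / 2)); rewrite /Num.min; case: ifPn => h; split; lra.
  suff : S t by move=> /(ub_le_sup ubS); rewrite -cE; lra.
  split; first lra.
  move=> s sat; have [sc|cs] := ltP s c; first by apply: below; lra.
  have := dP s ltac:(lra); rewrite ger0_norm; last lra.
  by move=> /(_ ltac:(lra)) /ltr_normlP[]; lra.
have uc_le : u c <= r.
  case: (leP (u c) r) => // ucr; exfalso.
  have [||d d0 dP] := uc c _ (u c - r); [lra|lra|].
  have [ac'|ca] := ltP a c; last first.
    have ac' : a = c by lra.
    by move: uar; rewrite ac'; lra.
  have [t [ta ct td]] : exists t, [/\ a <= t, t < c & c - d < t].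
    by exists (Num.max a (c - d / 2)); rewrite /Num.max; case: ifPn => h; split; lra.
  have := below t ltac:(lra); have := dP t ltac:(lra); rewrite ler0_norm; last lra.
  by move=> /(_ ltac:(lra)) /ltr_normlP[]; lra.
exists c; split => //; last by apply/le_anti/andP.
have [ac'|ca] := ltP a c; first lra.
have ac' : a = c by lra.
    by move: uar; rewrite ac'; lra.
Qed.

(** * Definability *)

Section definability.
Variables (R : realType) (S : forall k : nat, set (set 'rV[R]_k)).
Hypothesis HS : o_minimal_structure S.

(** Rows are padded with zeros to sequences, so that formulas with different numbers of variables
    live on one type. *)
Definition env k (v : 'rV[R]_k) (i : nat) : R :=
  if insub i is Some j then v 0 j else 0.

Lemma envE k (v : 'rV[R]_k) (i : 'I_k) : env v i = v 0 i.
Proof. by rewrite /env valK. Qed.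

Lemma envlt k (v : 'rV[R]_k) i (ik : (i < k)%N) : env v i = v 0 (Ordinal ik).
Proof. by rewrite -(envE v (Ordinal ik)). Qed.

Lemma env_lsub k m (v : 'rV[R]_(k + m)) i : (i < k)%N -> env (lsubmx v) i = env v i.
Proof.
by move=> ik; rewrite (envlt _ ik) mxE -envE.
Qed.

Lemma env_rsub k m (v : 'rV[R]_(k + m)) i :
  (i < m)%N -> env (rsubmx v) i = env v (k + i).
Proof.
by move=> ik; rewrite (envlt _ ik) mxE -envE.
Qed.

(* A formula with variables x_0, x_1, ... is a predicate on sequences; [dupto k P]
   says that P involves x_0, ..., x_(k-1) only and defines a set of S k. *)
Definition dupto k (P : (nat -> R) -> Prop) :=
  (forall e e', (forall i, (i < k)%N -> e i = e' i) -> P e -> P e') /\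
  S [set v : 'rV[R]_k | P (env v)].

Definition dpred P := exists k, dupto k P.

Lemma dupto_ext k P Q : (forall e, P e <-> Q e) -> dupto k P -> dupto k Q.
Proof.
move=> PQ; suff -> : P = Q by [].
by apply/funext => e; apply/propext.
Qed.

Lemma dpred_ext P Q : (forall e, P e <-> Q e) -> dpred P -> dpred Q.
Proof. by move=> PQ [k /(dupto_ext PQ) kQ]; exists k. Qed.

Lemma dupto_not k P : dupto k P -> dupto k (fun e => ~ P e).
Proof.
move=> [Pk SP]; split.
  by move=> e e' ee' nP Pe'; apply/nP/(Pk e') => // i /ee'.
exact: (omin_setC HS SP).
Qed.

Lemma dupto_or k P Q : dupto k P -> dupto k Q -> dupto k (fun e => P e \/ Q e).
Proof.
move=> [Pk SP] [Qk SQ]; split; last exact: (omin_setU HS SP SQ).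
by move=> e e' ee' [/(Pk _ _ ee')|/(Qk _ _ ee')]; [left|right].
Qed.

Lemma dupto_and k P Q : dupto k P -> dupto k Q -> dupto k (fun e => P e /\ Q e).
Proof.
move=> /dupto_not nP /dupto_not nQ; apply: dupto_ext (dupto_not (dupto_or nP nQ)) => e.
by rewrite not_orE !notE.
Qed.

Lemma dupto_S k P : dupto k P -> dupto k.+1 P.
Proof.
move=> [Pk SP]; split.
  by move=> e e' ee'; apply: Pk => i ik; apply: ee'; rewrite ltnW.
rewrite -addn1; have := omin_cylr HS SP; congr (S _).
by apply/seteqP; split => v /=; apply: Pk => i ik; rewrite env_lsub.
Qed.

Lemma dupto_le k k' P : (k <= k')%N -> dupto k P -> dupto k' P.
Proof. by move=> /subnK <- kP; elim: (k' - k)%N => // m /dupto_S. Qed.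

Lemma dupto_cons k P : dupto k P -> dupto k.+1 (fun e => P (fun i => e i.+1)).
Proof.
move=> [Pk SP]; split.
  by move=> e e' ee'; apply: Pk => i ik; apply: ee'.
have := omin_cyll HS SP; congr (S _).
by apply/seteqP; split => v /=; apply: Pk => i ik; rewrite env_rsub.
Qed.

Lemma dupto_proj k P : dupto k.+1 P ->
  dupto k (fun e => exists z, P (fun i => if i == k then z else e i)).
Proof.
move=> [Pk SP]; split.
  move=> e e' ee' [z Pz]; exists z; apply: Pk Pz => i; rewrite ltnS leq_eqVlt.
  by case: eqP => //= _ /ee'.
rewrite -addn1 in SP; have := omin_proj HS SP; congr (S _).
apply/seteqP; split => v /=.
  move=> [w Pw <-]; exists (env w k); apply: Pk Pw => i.
  rewrite ltnS leq_eqVlt => /predU1P[->|ik]; first by rewrite eqxx.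
  by rewrite (ltn_eqF ik) env_lsub.
move=> [z Pz]; exists (row_mx v z%:M); last by rewrite row_mxKl.
apply: Pk Pz => i; rewrite ltnS leq_eqVlt => /predU1P[->|ik].
  have := @env_rsub k 1 (row_mx v z%:M) 0 isT.
  by rewrite addn0 => <-; rewrite row_mxKr eqxx (@envlt 1 _ 0 isT) mxE mulr1n.
by rewrite (ltn_eqF ik) -(@env_lsub k 1) ?row_mxKl.
Qed.

Lemma dupto_eq k i j : (i < k)%N -> (j < k)%N -> dupto k (fun e => e i = e j).
Proof.
move=> ik jk; split; first by move=> e e' ee'; rewrite !ee'.
have := omin_diag HS (Ordinal ik) (Ordinal jk); congr (S _).
by apply/seteqP; split => v /=; rewrite !envlt.
Qed.

Lemma dupto_forall k n (P : nat -> (nat -> R) -> Prop) :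
  (forall i, (i < n)%N -> dupto k (P i)) ->
  dupto k (fun e => forall i, (i < n)%N -> P i e).
Proof.
elim: n => [|n IHn] nP.
  apply: (@dupto_ext _ (fun=> True)) => //.
  by split => //; apply: omin_setT.
have := dupto_and (IHn (fun i ni => nP i (ltnW ni))) (nP n (ltnSn n)).
apply: dupto_ext => e; split=> [[h1 h2] i|h].
  by rewrite ltnS leq_eqVlt => /predU1P[->|/h1].
by split=> [i /ltnW /h//|]; apply: h.
Qed.

Lemma dupto_proj_n m k P : dupto (m + k) P ->
  dupto m (fun e => exists w : nat -> R, P (fun i => if (i < m)%N then e i else w i)).
Proof.
elim: k P => [|k IHk] P.
  rewrite addn0 => mP; apply: (dupto_ext _ mP) => e; case: mP => Pm _.
  split=> [Pe|[w]]; last by apply: Pm => i ->.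
  by exists e; apply: Pm Pe => i ->.
rewrite addnS => mP; have [Pmk _] := mP.
apply: dupto_ext (IHk _ (dupto_proj mP)) => e; split=> [[w [z]]|[w Pw]].
  move=> Pw; exists (fun i => if i == (m + k)%N then z else w i).
  apply: Pmk Pw => i _; case: eqP => // ->.
  by rewrite ltnNge leq_addr.
exists w, (w (m + k)%N); apply: Pmk Pw => i _; case: eqP => // ->.
by rewrite ltnNge leq_addr.
Qed.

(** The axioms contain no permutation of coordinates. A copy of P is shifted to the variables m, m +
    1, ..., tied to the wanted ones by the diagonals x_(m+i) = x_(s i), and the extra variables are
    projected away. *)
Lemma dupto_rename k m (s : nat -> nat) P : dupto k P ->
  (forall i, (i < k)%N -> (s i < m)%N) -> dupto m (fun e => P (e \o s)).
Proof.
move=> kP sm; have [Pk _] := kP.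
have shiftP j : dupto (j + k) (fun e => P (fun i => e (j + i)%N)).
  by elim: j => [|j] //; rewrite addSn => /dupto_cons.
have eqP : dupto (m + k) (fun e => forall i, (i < k)%N -> e (m + i)%N = e (s i)).
  apply: dupto_forall => i ik; apply: dupto_eq; first by rewrite ltn_add2l.
  by rewrite ltn_addr// sm.
apply: dupto_ext (dupto_proj_n (dupto_and (shiftP m) eqP)) => e /=; split=> [[w [Pw we]]|Pe].
  apply: Pk Pw => i ik; have := we i ik.
  by rewrite sm.
exists (fun i => e (s (i - m)%N)); split.
  by apply: Pk Pe => i ik /=; rewrite ltnNge leq_addr /= addKn.
by move=> i ik; rewrite sm// ltnNge leq_addr /= addKn.
Qed.

Lemma dpred_rename s P : dpred P -> dpred (fun e => P (e \o s)).
Proof.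
move=> [k kP]; exists (\max_(i < k) (s i)).+1; apply: (dupto_rename kP) => i ik.
by rewrite ltnS (@leq_bigmax _ (fun i : 'I_k => s i) (Ordinal ik)).
Qed.

Lemma dpred_not P : dpred P -> dpred (fun e => ~ P e).
Proof. by move=> [k /dupto_not kP]; exists k. Qed.

Lemma dpred_or P Q : dpred P -> dpred Q -> dpred (fun e => P e \/ Q e).
Proof.
move=> [k kP] [l lQ]; exists (maxn k l); apply: dupto_or.
  by apply: dupto_le kP; exact: leq_maxl.
by apply: dupto_le lQ; exact: leq_maxr.
Qed.

Lemma dpred_and P Q : dpred P -> dpred Q -> dpred (fun e => P e /\ Q e).
Proof.
move=> /dpred_not nP /dpred_not nQ; apply: dpred_ext (dpred_not (dpred_or nP nQ)) => e.
by rewrite not_orE !notE.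
Qed.

Lemma dpred_imp P Q : dpred P -> dpred Q -> dpred (fun e => P e -> Q e).
Proof.
move=> /dpred_not nP DQ; apply: dpred_ext (dpred_or nP DQ) => e.
by split=> [[]//|PQ]; have [/PQ|] := pselect (P e); [right|left].
Qed.

Definition econs (z : R) (e : nat -> R) i := if i is j.+1 then e j else z.

(** Binders follow the de Bruijn convention: under the quantifier the bound variable has index 0 and
    all others move up by one. *)
Lemma dpred_ex (Q : R -> (nat -> R) -> Prop) :
  dpred (fun e => Q (e 0%N) (fun i => e i.+1)) -> dpred (fun e => exists z, Q z e).
Proof.
move=> [k kQ]; have [Qk _] := kQ; exists k.
(* Moves the bound variable from index 0 to the last index k, the one that [dupto_proj]
   eliminates. *)
pose s i := if i is j.+1 then j else k.
have /dupto_proj : dupto k.+1 (fun e => Q (e k) (fun i => e i)).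
  apply: (dupto_rename (s := s) kQ) => -[|i] //= ik.
  by rewrite ltnS ltnW// ltnW.
apply: dupto_ext => e; rewrite eqxx.
have Qe z : Q z (fun i => if i == k then z else e i) <-> Q z e.
  have ee i : (i < k)%N -> econs z (fun i => if i == k then z else e i) i = econs z e i.
    by case: i => [|i] //= ik; case: eqP ik => // ->; rewrite ltnNge leqnSn.
  split; first exact: (Qk _ _ ee).
  by apply: (Qk (econs z e) (econs z _)) => i /ee.
by split=> -[z /Qe]; exists z.
Qed.

Lemma dpred_all (Q : R -> (nat -> R) -> Prop) :
  dpred (fun e => Q (e 0%N) (fun i => e i.+1)) -> dpred (fun e => forall z, Q z e).
Proof.
move=> /dpred_not DQ.
apply: dpred_ext (dpred_not (@dpred_ex (fun z e => ~ Q z e) DQ)) => e.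
split=> [nQ z|h [z]]; last exact.
by apply: contrapT => nQz; apply: nQ; exists z.
Qed.

(** The graph, with the value at index 0 and the arguments shifted by one, so that a term can be
    substituted through [dpred_ex]. *)
Definition dfun (t : (nat -> R) -> R) := dpred (fun e => e 0%N = t (fun i => e i.+1)).

Lemma dfun_at t j s : dfun t -> dpred (fun e => e j = t (e \o s)).
Proof. exact: (dpred_rename (fun i => if i is i'.+1 then s i' else j)). Qed.

Lemma dfun_rename t s : dfun t -> dfun (fun e => t (e \o s)).
Proof. exact: (dfun_at _ (fun i => (s i).+1)). Qed.

Lemma dpred_subst t (Q : R -> (nat -> R) -> Prop) : dfun t ->
  dpred (fun e => Q (e 0%N) (fun i => e i.+1)) -> dpred (fun e => Q (t e) e).
Proof.
move=> Tt DQ.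
have := @dpred_ex (fun z e => z = t e /\ Q z e) (dpred_and Tt DQ).
by apply: dpred_ext => e; split=> [[_ [-> ]]//|]; exists (t e).
Qed.

Lemma dfun_var i : dfun (fun e => e i).
Proof. by exists i.+2; apply: dupto_eq. Qed.

Lemma dpred_set1 (A : set R) (s : seq (interval R)) :
  A = [set x | exists2 I, I \in s & x \in I] -> dpred (fun e => A (e 0%N)).
Proof.
move=> As; exists 1%N; split; first by move=> e e' /(_ 0%N isT) ->.
apply/(omin_dim1 HS); exists s.
by apply/seteqP; split => v /=; rewrite As (envE v 0 : env v 0%N = _).
Qed.

Lemma dfun_const c : dfun (fun=> c).
Proof.
apply: (@dpred_set1 [set x | x = c] [:: `[c, c]]); apply/seteqP; split => x /=.
  by move=> ->; exists `[c, c]; rewrite ?mem_head// in_itv /= lexx.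
by move=> [I]; rewrite inE => /eqP ->; rewrite in_itv /= => /le_anti.
Qed.

Lemma dpred_eq s t : dfun s -> dfun t -> dpred (fun e => s e = t e).
Proof.
move=> Ts Tt; apply: (@dpred_subst s (fun z e => z = t e)) => //.
Qed.

Lemma dfun_op (op : R -> R -> R) s t :
  dpred (fun e => op (e 0%N) (e 1%N) = e 2%N) -> dfun s -> dfun t ->
  dfun (fun e => op (s e) (t e)).
Proof.
move=> Dop Ts Tt.
have Ts' := dfun_rename succn Ts; have Tt' := dfun_rename succn Tt.
apply: (dpred_subst (Q := fun x e => e 0%N = op x (t (fun i => e i.+1)))) => //.
apply: (dpred_subst (t := fun e => t (fun i => e i.+2))
  (Q := fun y e => e 1%N = op (e 0%N) y)).
  exact: (dfun_rename (fun i => i.+2) Tt).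
have := dpred_rename (fun i => if i is i'.+1 then (if i' is 0%N then 0%N else 2%N) else 1%N) Dop.
by apply: dpred_ext => e /=; split.
Qed.

Lemma dpred_op3 (op : R -> R -> R) :
  S [set v : 'rV[R]_3 | op (v 0 0) (v 0 1) = v 0 2] ->
  dpred (fun e => op (e 0%N) (e 1%N) = e 2%N).
Proof.
move=> SA; exists 3%N; split; first by move=> e e' ee'; rewrite !ee'.
move: SA; congr (S _); apply/seteqP; split => v /=;
  by rewrite (envE v 0 : env v 0%N = _) (envE v 1 : env v 1%N = _) (envE v 2 : env v 2%N = _).
Qed.

Lemma dfun_add s t : dfun s -> dfun t -> dfun (fun e => s e + t e).
Proof. exact/(dfun_op (op := +%R))/dpred_op3/(omin_add HS). Qed.

Lemma dfun_mul s t : dfun s -> dfun t -> dfun (fun e => s e * t e).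
Proof. exact/(dfun_op (op := *%R))/dpred_op3/(omin_mul HS). Qed.

Lemma dfun_opp t : dfun t -> dfun (fun e => - t e).
Proof.
move=> /(dfun_mul (dfun_const (-1))); apply: dpred_ext => e.
by rewrite mulN1r.
Qed.

Lemma dpred_lt s t : dfun s -> dfun t -> dpred (fun e => s e < t e).
Proof.
move=> Ts Tt.
have pos : dpred (fun e => 0 < e 0%N).
  apply: (@dpred_set1 [set x | 0 < x] [:: `]0, +oo[]); apply/seteqP; split => x /=.
    by move=> x0; exists `]0, +oo[; rewrite ?mem_head// in_itv /= x0.
  by move=> [I]; rewrite inE => /eqP ->; rewrite in_itv /= andbT.
apply: dpred_ext (dpred_subst (Q := fun z _ => 0 < z) (dfun_add Tt (dfun_opp Ts)) pos) => e.
by rewrite subr_gt0.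
Qed.

Lemma dpred_le s t : dfun s -> dfun t -> dpred (fun e => s e <= t e).
Proof.
by move=> Ts Tt; apply: dpred_ext (dpred_not (dpred_lt Tt Ts)) => e; rewrite leNgt; split => /negP.
Qed.

Lemma dpred_normle s t : dfun s -> dfun t -> dpred (fun e => `|s e| <= t e).
Proof.
move=> Ts Tt; apply: dpred_ext (dpred_and (dpred_le (dfun_opp Tt) Ts) (dpred_le Ts Tt)) => e.
by rewrite ler_norml; split => /andP.
Qed.

Lemma dpred_exn n P : dpred P ->
  dpred (fun e => exists w : nat -> R, P (fun i => if (i < n)%N then w i else e (i - n)%N)).
Proof.
elim: n P => [|n IHn] P DP.
  apply: dpred_ext DP => e.
  have E (w : nat -> R) : (fun i => if (i < 0)%N then w i else e (i - 0)%N) = e.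
    by apply/funext => i; rewrite ltn0 subn0.
  by split=> [Pe|[w]]; [exists e|]; rewrite E.
apply: dpred_ext (IHn _ (@dpred_ex (fun z e => P (econs z e)) _)) => [e|]; last first.
  by apply: dpred_ext DP => e; rewrite (_ : econs _ _ = e)//; apply/funext => -[].
have E w z : econs z (fun i => if (i < n)%N then w i else e (i - n)%N) =
    (fun i => if (i < n.+1)%N then econs z w i else e (i - n.+1)%N).
  by apply/funext => -[].
split=> [[w [z]]|[w Pw]]; first by rewrite E; exists (econs z w).
exists (fun i => w i.+1), (w 0%N); rewrite E.
by rewrite (_ : econs _ _ = w)//; apply/funext => -[].
Qed.

Lemma dpred_exrv n (Q : 'rV[R]_n -> (nat -> R) -> Prop) :
  dpred (fun e => Q (\row_i e i) (fun i => e (n + i)%N)) -> dpred (fun e => exists x, Q x e).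
Proof.
move=> /(dpred_exn n); apply: dpred_ext => e.
have E w : (fun i => if (n + i < n)%N then w (n + i)%N else e (n + i - n)%N) = e.
  by apply/funext => i; rewrite ltnNge leq_addr addKn.
split=> [[w]|[x Qx]]; first by rewrite E; eexists; eassumption.
exists (env x); rewrite E (_ : \row_i _ = x)//.
by apply/rowP => i; rewrite mxE ltn_ord envE.
Qed.

Lemma dpred_allrv n (Q : 'rV[R]_n -> (nat -> R) -> Prop) :
  dpred (fun e => Q (\row_i e i) (fun i => e (n + i)%N)) -> dpred (fun e => forall x, Q x e).
Proof.
move=> /dpred_not DQ.
apply: dpred_ext (dpred_not (@dpred_exrv _ (fun x e => ~ Q x e) DQ)) => e.
split=> [nQ z|h [z]]; last exact.
by apply: contrapT => nQz; apply: nQ; exists z.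
Qed.

Lemma dpred_forall (I : finType) (P : I -> (nat -> R) -> Prop) :
  (forall i, dpred (P i)) -> dpred (fun e => forall i, P i e).
Proof.
move=> DP; suff : dpred (fun e => forall i, i \in enum I -> P i e).
  by apply: dpred_ext => e; split=> h i; [apply: h; rewrite mem_enum|move=> _; exact: h].
elim: (enum I) => [|j s IHs].
  by apply: (@dpred_ext (fun e => e 0%N = e 0%N)) => //; exact: dpred_eq (dfun_var _) (dfun_var _).
apply: dpred_ext (dpred_and (DP j) IHs) => e; split=> [[Pj Ps] i|h].
  by rewrite inE => /predU1P[->|/Ps].
by split=> [|i si]; apply: h; rewrite inE ?eqxx// si orbT.
Qed.

Lemma dfun_comp n (f : 'rV[R]_n -> R) (t : 'I_n -> (nat -> R) -> R) :
  dfun (fun e => f (\row_i e i)) -> (forall i, dfun (t i)) ->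
  dfun (fun e => f (\row_i t i e)).
Proof.
move=> Tf Tt; rewrite /dfun.
have : dpred (fun e => exists x : 'rV[R]_n,
    (forall i, x 0 i = t i (fun i => e i.+1)) /\ e 0%N = f x).
  apply: (dpred_exrv (Q := fun x e =>
    (forall i, x 0 i = t i (fun i => e i.+1)) /\ e 0%N = f x)).
  apply: dpred_and; first apply: dpred_forall => i.
    have := dfun_at i (fun j => (n + j.+1)%N) (Tt i).
    by apply: dpred_ext => e; rewrite mxE.
  exact: (@dfun_at _ (n + 0)%N id Tf).
apply: dpred_ext => e; split=> [[x [xt ->]]|->].
  by congr f; apply/rowP => i; rewrite xt mxE.
by eexists; split; last reflexivity; move=> i; rewrite mxE.
Qed.

Lemma dfun_fun n (f : 'rV[R]_n -> R) : definable_in S f -> dfun (fun e => f (\row_i e i)).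
Proof.
move=> Sf.
have : dpred (fun e => e n = f (\row_i e i)).
  exists (n + 1)%N; split.
    move=> e e' ee'; rewrite ee' ?addn1// => ->; congr f; apply/rowP => i.
    by rewrite !mxE ee'// addn1 ltnW// ltnS.
  move: Sf; congr (S _); apply/seteqP; split => v /=.
    move=> /rowP/(_ 0); rewrite !mxE mulr1n -envE /= addn0 => ->.
    by congr f; apply/rowP => i; rewrite !mxE -envE.
  move=> vf; apply/rowP => j; rewrite ord1 !mxE mulr1n -envE /= addn0 vf.
  by congr f; apply/rowP => i; rewrite !mxE -envE.
move=> /(dpred_rename (fun i => if (i < n)%N then i.+1 else 0%N)).
apply: dpred_ext => e /=; rewrite ltnn.
have -> // : \row_(i < n) e (if (i < n)%N then i.+1 else 0%N) = \row_(i < n) e i.+1.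
by apply/rowP => i; rewrite !mxE ltn_ord.
Qed.

Lemma dfun_sum (I : finType) (t : I -> (nat -> R) -> R) :
  (forall i, dfun (t i)) -> dfun (fun e => \sum_i t i e).
Proof.
move=> Tt; elim: (index_enum I) => [|i s IHs].
  by apply: dpred_ext (dfun_const 0) => e; rewrite big_nil.
by apply: dpred_ext (dfun_add (Tt i) IHs) => e; rewrite big_cons.
Qed.

Lemma dfun_abs t : dfun t -> dfun (fun e => `|t e|).
Proof.
move=> Tt; pose u (e : nat -> R) := t (fun i => e i.+1).
have Tu : dfun u by exact: dfun_rename succn Tt.
have D0 : dpred (fun e => 0 <= u e) by exact: dpred_le (dfun_const 0) Tu.
have := dpred_or (dpred_and D0 (dpred_eq (dfun_var 0) Tu))
  (dpred_and (dpred_not D0) (dpred_eq (dfun_var 0) (dfun_opp Tu))).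
apply: dpred_ext => e; rewrite /u.
have [u0|u0] := ger0P (t _); first by split=> [[[]|[]]|]//; left.
by split=> [[[]|[]]|->]//; right.
Qed.

(** A definable subset of the line is a finite union of intervals, and each interval contains or
    misses a whole right neighbourhood of z; the two cases propagate along the list. *)
Lemma germ (A : set R) (z : R) : dpred (fun e => A (e 0%N)) ->
  exists2 d : R, 0 < d & (forall t, z < t < z + d -> A t) \/
                         (forall t, z < t < z + d -> ~ A t).
Proof.
move=> [k kA].
(* The formula may be presented with k variables but depends on variable 0 only; renaming all of
   them to 0 brings it down to S 1. *)
have [_ /(omin_dim1 HS)[s As]] := dupto_rename (m := 1%N) (s := fun=> 0%N) kA (fun _ _ => isT).
have {As kA}-> : A = [set x | exists2 I, I \in s & x \in I].
  apply/funext => x; have /= := congr1 (fun B => B (const_mx x)) As.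
  by rewrite (envE _ 0 : env _ 0%N = _) !mxE.
elim: s => [|I s [d d0 IHs]]; first by exists 1 => //; right => t _ [].
have [e e0 eP] : exists2 e : R, 0 < e & (forall t, z < t < z + e -> t \in I) \/
    (forall t, z < t < z + e -> t \notin I).
  case: I => l r.
  have [l1 l10 l1P] : exists2 e : R, 0 < e & (forall t : R, z < t < z + e -> (l <= BLeft t)%O) \/
      (forall t : R, z < t < z + e -> ~~ (l <= BLeft t)%O).
    case: l => [b x|[]]; [|by exists 1 => //; left|by exists 1 => //; right].
    have [xz|zx] := leP x z.
      exists 1 => //; left => t /andP[zt _]; have xt : x < t by exact: le_lt_trans zt.
      by case: b; rewrite bnd_simp// ltW.
    exists (x - z); first by rewrite subr_gt0.
    right => t /andP[_]; rewrite addrC subrK => tx.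
    by case: b; rewrite bnd_simp -?ltNge -?leNgt// ltW.
  have [r1 r10 r1P] : exists2 e : R, 0 < e & (forall t : R, z < t < z + e -> (BRight t <= r)%O) \/
      (forall t : R, z < t < z + e -> ~~ (BRight t <= r)%O).
    case: r => [b x|[]]; [|by exists 1 => //; right|by exists 1 => //; left].
    have [xz|zx] := leP x z.
      exists 1 => //; right => t /andP[zt _]; have xt : x < t by exact: le_lt_trans zt.
      by case: b; rewrite bnd_simp -?ltNge -?leNgt// ltW.
    exists (x - z); first by rewrite subr_gt0.
    left => t /andP[_]; rewrite addrC subrK => tx.
    by case: b; rewrite bnd_simp// ltW.
  exists (Num.min l1 r1); first by rewrite lt_min l10.
  have sub t : z < t < z + Num.min l1 r1 -> z < t < z + l1 /\ z < t < z + r1.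
    by move=> /andP[->]; rewrite -!ltrBlDl lt_min => /andP[-> ->].
  case: l1P => l1P; last first.
    by right=> t /sub[/l1P tl _]; rewrite itv_boundlr (negbTE tl).
  case: r1P => r1P; last first.
    by right=> t /sub[_ /r1P tr]; rewrite itv_boundlr (negbTE tr) andbF.
  by left=> t /sub[/l1P tl /r1P tr]; rewrite itv_boundlr tl.
exists (Num.min d e); first by rewrite lt_min d0.
have sub t : z < t < z + Num.min d e -> z < t < z + d /\ z < t < z + e.
  by move=> /andP[->]; rewrite -!ltrBlDl lt_min => /andP[-> ->].
case: eP => eP; first by left=> t /sub[_ /eP tI]; exists I; rewrite ?mem_head.
case: IHs => IHs.
  by left=> t /sub[/IHs[J Js tJ] _]; exists J; rewrite // inE Js orbT.
right=> t /sub[/IHs ns /eP nI] [J]; rewrite inE => /predU1P[->|Js tJ].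
  by rewrite (negbTE nI).
by apply: ns; exists J.
Qed.

End definability.

(** * Monotonicity of definable functions near a point *)

Lemma rv_norm_le (R : realType) n (x : 'rV[R]_n) (r : R) : 0 <= r ->
  (`|x| <= r <-> forall i, `|x 0 i| <= r).
Proof.
move=> r0; rewrite [X in X <= _]mx_normrE; split.
  by move=> /bigmax_leP[_ xr] i; exact: (xr (0, i)).
by move=> xr; apply/bigmax_leP; split=> // -[i j] _ /=; rewrite ord1.
Qed.

Lemma rv_coord_le (R : realType) n (x : 'rV[R]_n) i : `|x 0 i| <= `|x|.
Proof. by have /rv_norm_le := lexx `|x|; apply. Qed.

Lemma rv_norm_sum (R : realType) n (x : 'rV[R]_n) : `|x| <= \sum_i `|x 0 i|.
Proof.
apply/rv_norm_le => [|i]; first exact: sumr_ge0.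
by rewrite (bigD1 i)//= lerDl sumr_ge0.
Qed.

Lemma ball_compact (R : realType) n (c : 'rV[R]_n) (r : R) :
  compact [set x : 'rV[R]_n | `|x - c| <= r].
Proof.
apply: bounded_closed_compact.
  exists (r + `|c|); split; first exact: num_real.
  move=> s rs x /= xr; rewrite -(subrK c x) (le_trans (ler_normD _ _))//.
  by rewrite (le_trans _ (ltW rs))// lerD2r.
apply: (@closed_comp _ _ (fun x : 'rV[R]_n => `|x - c|) [set s | s <= r]).
  by move=> x _; exact: (cvg_norm (cvgB cvg_id (cvg_cst c))).
exact: (@closed_le R r).
Qed.

(* By [germ], all points t to the right of z are of the same type: values of g
   at least, or less than, g t just after t, and at most, or more than, g t just
   before t. In the two types that give monotonicity [creep] passes from local to
   global; in the other two every t is a local extremum, strict on one side,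
   which [local_asym_countable] excludes on an interval. *)
Lemma mono_germ (R : realType) (S : forall k : nat, set (set 'rV[R]_k))
  (HS : o_minimal_structure S) (g : R -> R) (z : R) :
  dfun S (fun e => g (e 0%N)) ->
  exists2 d : R, 0 < d &
    (forall s t, z < s -> s <= t -> t < z + d -> g s <= g t) \/
    (forall s t, z < s -> s <= t -> t < z + d -> g t <= g s).
Proof.
move=> Tg.
have Tc t : dfun S t -> dfun S (fun e => g (t e)).
  move=> Tt; apply: (dpred_subst HS (Q := fun x e => e 0%N = g x)
    (dfun_rename HS succn Tt)).
  by apply: dpred_ext (dfun_at HS 1 (fun=> 0%N) Tg).
pose Rt t := exists b : R, t < b /\ forall s, t < s /\ s < b -> g t <= g s.
pose Lt t := exists a : R, a < t /\ forall s, a < s /\ s < t -> g s <= g t.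
have Tv := dfun_var HS.
have DR : dpred S (fun e => Rt (e 0%N)).
  apply: (dpred_ex HS (Q := fun b e => e 0%N < b /\ forall s, e 0%N < s /\ s < b -> g (e 0%N) <= g s)).
  apply: dpred_and => //; first exact: dpred_lt.
  apply: (dpred_all HS (Q := fun s e => e 1%N < s /\ s < e 0%N -> g (e 1%N) <= g s)).
  by apply: dpred_imp => //; [apply: dpred_and => //; apply: dpred_lt|apply: dpred_le => //; apply: Tc].
have DL : dpred S (fun e => Lt (e 0%N)).
  apply: (dpred_ex HS (Q := fun a e => a < e 0%N /\ forall s, a < s /\ s < e 0%N -> g s <= g (e 0%N))).
  apply: dpred_and => //; first exact: dpred_lt.
  apply: (dpred_all HS (Q := fun s e => e 0%N < s /\ s < e 1%N -> g s <= g (e 1%N))).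
  by apply: dpred_imp => //; [apply: dpred_and => //; apply: dpred_lt|apply: dpred_le => //; apply: Tc].
have nR t : ~ Rt t -> exists b : R, t < b /\ forall s, t < s < b -> g s < g t.
  move=> nRt; have := @germ _ _ HS (fun s => g t <= g s) t.
  case=> [|d d0 [dP|dP]].
  - by apply: dpred_le => //; exact: dfun_const.
  - case: nRt; exists (t + d); rewrite ltrDl; split=> // s /andP; exact: dP.
  - exists (t + d); rewrite ltrDl; split=> // s /dP.
    by move=> /negP; rewrite -ltNge.
(* [germ] sees right neighbourhoods; the reflection s -> - s turns the left side of t into the right
   side of - t. *)
have nL t : ~ Lt t -> exists a : R, a < t /\ forall s, a < s < t -> g t < g s.
  move=> nLt; have := @germ _ _ HS (fun s => g (- s) <= g t) (- t).
  case=> [|d d0 [dP|dP]].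
  - apply: dpred_le => //; last exact: dfun_const.
    by apply: Tc; exact: dfun_opp.
  - case: nLt; exists (t - d); rewrite ltrBlDr ltrDl; split=> // s sd.
    by rewrite -[s]opprK; apply: dP; lra.
  - exists (t - d); rewrite ltrBlDr ltrDl; split=> // s sd.
    have /dP : - t < - s < - t + d by lra.
    by rewrite opprK => /negP; rewrite -ltNge.
have [dR dR0 DRP] := germ HS z DR; have [dL dL0 DLP] := germ HS z DL.
have [d [d0 ddR ddL]] : exists d : R, [/\ 0 < d, d <= dR & d <= dL].
  by exists (Num.min dR dL); rewrite lt_min dR0 dL0 !ge_min !lexx orbT.
have noco : ~ countable `]z, (z + d)[%classic.
  by move=> /countable_no_itv/(_ (_ : z < z + d)); apply; rewrite // ltrDl.
exists d => //; case: DRP => DRP; case: DLP => DLP; [left|exfalso|exfalso|right].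
- move=> s t zs st tz; apply: (creep (P := fun s t => g s <= g t) st).
    by move=> ? ? ? ? ? ? ?; exact: le_trans.
  move=> c sct.
  have [|b [cb bP]] := DRP c; first lra.
  have [|a [ac aP]] := DLP c; first lra.
  exists (Num.min (b - c) (c - a)); first by rewrite lt_min !subr_gt0 cb.
  move=> r rst; split=> /andP[].
    rewrite ltrBlDr -ltrBlDl lt_min => /andP[_ rc1]; rewrite le_eqVlt => /predU1P[->//|rc].
    by apply: aP; lra.
  rewrite le_eqVlt => /predU1P[->//|rc]; rewrite -ltrBlDl lt_min => /andP[rc1 _].
  by apply: bP; lra.
- apply: noco; apply: (local_asym_countable (P := fun y x => g x < g y)) => x /=.
  rewrite in_itv /= => xz.
  have [|b [cb bP]] := DRP x; first lra.
  have [|a [ac aP]] := nL x; first by apply: DLP; lra.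
  exists a, b; rewrite ac cb; split=> // y; split=> [/aP//|/andP/bP].
  by rewrite leNgt => /negP.
- apply: noco; apply: (local_asym_countable (P := fun y x => g y <= g x)) => x /=.
  rewrite in_itv /= => xz.
  have [|b [cb bP]] := nR x; first by apply: DRP; lra.
  have [|a [ac aP]] := DLP x; first lra.
  exists a, b; rewrite ac cb; split=> // y; split=> [/andP/aP//|/bP].
  by rewrite ltNge => /negP.
- move=> s t zs st tz; apply: (creep (P := fun s t => g t <= g s) st).
    by move=> ? ? ? ? ? ? ? /[swap]; exact: le_trans.
  move=> c sct.
  have [|b [cb bP]] := nR c; first by apply: DRP; lra.
  have [|a [ac aP]] := nL c; first by apply: DLP; lra.
  exists (Num.min (b - c) (c - a)); first by rewrite lt_min !subr_gt0 cb.
  move=> r rst; split=> /andP[].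
    rewrite ltrBlDr -ltrBlDl lt_min => /andP[_ rc1]; rewrite le_eqVlt => /predU1P[->//|rc].
    by apply/ltW/aP; lra.
  rewrite le_eqVlt => /predU1P[->//|rc]; rewrite -ltrBlDl lt_min => /andP[rc1 _].
  by apply/ltW/bP; lra.
Qed.

(** * Kurdyka-Lojasiewicz inequality *)

Definition minset (R : realType) (T : Type) (h : T -> R) (A : set T) : set T :=
  [set p | A p /\ forall q, A q -> h p <= h q].

Lemma minset_compact (R : realType) (T : topologicalType) (h : T -> R) (A : set T) :
  continuous h -> compact A -> A !=set0 ->
  compact (minset h A) /\ minset h A !=set0.
Proof.
move=> ch cA A0.
have [c /set_mem Ac cmin] := compact_EVT_min A0 cA (continuous_subspaceT ch).
have {}cmin q : A q -> h c <= h q by move=> Aq; apply: cmin; exact: mem_set.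
split; last by exists c.
rewrite (_ : minset h A = A `&` [set p | h p <= h c]).
  apply: compact_closedI => //.
  by apply: (@closed_comp _ _ h [set s | s <= h c]) => //; exact: closed_le.
apply/seteqP; split=> p [Ap hp]; split=> //; first exact: hp.
by move=> q /cmin; exact: le_trans.
Qed.

(* For i = n the lexicographic minimum, a definable choice of a point in A. *)
Fixpoint lexset (R : realType) n (A : set 'rV[R]_n) (i : nat) : set 'rV[R]_n :=
  if i is j.+1 then minset (fun p => env p j) (lexset A j) else A.

Lemma env_continuous (R : realType) n j : continuous (fun p : 'rV[R]_n => env p j).
Proof.
have [jn|nj] := ltnP j n; last first.
  have -> : (fun p : 'rV[R]_n => env p j) = cst 0.
    by apply/funext => p; rewrite /env insubF// ltnNge nj.
  exact: cst_continuous.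
have -> : (fun p : 'rV[R]_n => env p j) = fun p => p 0 (Ordinal jn).
  by apply/funext => p; rewrite envlt.
exact: coord_continuous.
Qed.

Lemma lexset_compact (R : realType) n (A : set 'rV[R]_n) i :
  compact A -> A !=set0 -> compact (lexset A i) /\ lexset A i !=set0.
Proof.
move=> cA A0; elim: i => //= i [cAi Ai0].
by apply: minset_compact => //; exact: env_continuous.
Qed.

Lemma lexset_sub (R : realType) n (A : set 'rV[R]_n) i : lexset A i `<=` A.
Proof. by elim: i => //= i IH p [/IH]. Qed.

Lemma lexset_uniq (R : realType) n (A : set 'rV[R]_n) p q :
  lexset A n p -> lexset A n q -> p = q.
Proof.
move=> Ap Aq; suff eq i j : lexset A i p -> lexset A i q -> (j < i)%N -> env p j = env q j.
  by apply/rowP => i; rewrite -!envE; apply: (eq n).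
elim: i => //= i IH [Aip pmin] [Aiq qmin]; rewrite ltnS leq_eqVlt.
by move=> /predU1P[->|/IH]; [apply/le_anti; rewrite pmin ?qmin|exact].
Qed.

Lemma fin_pos_min (R : realType) n (d : 'I_n -> R) :
  (forall i, 0 < d i) -> exists2 e, 0 < e & forall i, e <= d i.
Proof.
move=> d0; exists (\big[Num.min/1]_i d i); last by move=> i; exact: bigmin_le.
by apply/lt_bigmin => [|i _]; [rewrite ltr01|exact: d0].
Qed.

Lemma ler_mul_addgt0 (R : realType) (x mu D : R) : 0 <= D ->
  (forall eta : R, 0 < eta -> x <= (mu + eta) * D) -> x <= mu * D.
Proof.
move=> D0 h; apply/ler_addgt0Pr => e e0.
have eD : 0 < e / (D + 1) by apply: divr_gt0 => //; lra.
apply: le_trans (h _ eD) _; rewrite mulrDl lerD2l mulrAC ler_pdivrMr; last lra.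
by rewrite ler_pM2l//; lra.
Qed.

(** * A definable curve of least slope through the level sets *)

Section curve.
Variables (R : realType) (S : forall k : nat, set (set 'rV[R]_k)).
Hypothesis HS : o_minimal_structure S.
Variables (n : nat) (F m : 'rV[R]_n -> R) (k : R).
Hypotheses (TF : dfun S (fun e => F (\row_i e i))) (Tm : dfun S (fun e => m (\row_i e i))).
Hypotheses (cF : continuous F) (cm : continuous m).
Hypothesis k0 : 0 <= k.

Let K : set 'rV[R]_n := [set p | `|p| <= k].

Definition level t : set 'rV[R]_n := [set p | `|p| <= k /\ F p = t].

(** The points of least slope m in the level set, then cut down lexicographically through the first
    i coordinates; for i = n at most one point remains. *)
Definition steep t i := lexset (minset m (level t)) i.

Lemma dpred_level : dpred S (fun e => level (e 0%N) (\row_i e i.+1)).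
Proof.
have Tv i : dfun S (fun e => e i) by exact: dfun_var.
apply: dpred_and => //.
  have := @dpred_forall _ _ HS _ _ (fun i : 'I_n => dpred_normle HS (Tv i.+1) (dfun_const HS k)).
  apply: dpred_ext => e; split=> [h|/rv_norm_le h i]; last by have := h k0 i; rewrite mxE.
  by apply/rv_norm_le => // i; rewrite mxE.
apply: dpred_eq => //.
by have := dfun_rename HS succn TF.
Qed.

Lemma dpred_minset (A : R -> set 'rV[R]_n) (h : 'rV[R]_n -> R) :
  dpred S (fun e => A (e 0%N) (\row_i e i.+1)) -> dfun S (fun e => h (\row_i e i)) ->
  dpred S (fun e => minset h (A (e 0%N)) (\row_i e i.+1)).
Proof.
move=> DA Th; apply: dpred_and => //.
apply: (dpred_allrv HS (Q := fun q e => A (e 0%N) q -> h (\row_i e i.+1) <= h q)).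
apply: dpred_imp => //.
  have := dpred_rename HS (fun i => if i is j.+1 then j else (n + 0)%N) DA.
  by apply: dpred_ext => e /=.
apply: dpred_le => //.
exact: (dfun_rename HS (fun i => (n + i.+1)%N) Th).
Qed.

Lemma dfun_env j : dfun S (fun e => env (\row_(i < n) e i) j).
Proof.
have [jn|nj] := ltnP j n.
  by apply: dpred_ext (dfun_var HS j) => e; rewrite envlt mxE.
by apply: dpred_ext (dfun_const HS 0) => e; rewrite /env insubF// ltnNge nj.
Qed.

Lemma dpred_steep i : dpred S (fun e => steep (e 0%N) i (\row_i e i.+1)).
Proof.
elim: i => [|i IH]; first exact: dpred_minset dpred_level Tm.
exact: (@dpred_minset (fun t => steep t i) _ IH (dfun_env i)).
Qed.

Lemma level_compact t : compact (level t).
Proof.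
rewrite (_ : level t = [set p | `|p - 0| <= k] `&` [set p | F p = t]).
  apply: compact_closedI; first exact: ball_compact.
  by apply: (@closed_comp _ _ F [set s | s = t]) => //; exact: closed_eq.
by apply/seteqP; split=> p; rewrite /level /= subr0.
Qed.

Lemma steep_nonempty t : level t !=set0 -> steep t n !=set0.
Proof.
move=> t0; have [c0 h0] := minset_compact cm (@level_compact t) t0.
by have [] := lexset_compact n c0 h0.
Qed.

Definition curve t : 'rV[R]_n :=
  if pselect (steep t n !=set0) is left h then projT1 (cid h) else 0.

Lemma curveP t : level t !=set0 -> steep t n (curve t).
Proof.
move=> /steep_nonempty h; rewrite /curve; case: pselect => // h'.
by case: cid.
Qed.

Lemma dfun_curve j : dfun S (fun e => env (curve (e 0%N)) j).
Proof.
pose P (e : nat -> R) := exists p, steep (e 1%N) n p /\ env p j = e 0%N.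
pose Q (e : nat -> R) := exists p, steep (e 1%N) n p.
have DP : dpred S P.
  apply: (dpred_exrv HS (Q := fun p e => steep (e 1%N) n p /\ env p j = e 0%N)).
  apply: dpred_and => //.
    by have := dpred_rename HS (fun i => if i is j.+1 then j else (n + 1)%N) (dpred_steep n).
  by apply: dpred_eq => //; [exact: dfun_env|exact: dfun_var].
have DQ : dpred S Q.
  apply: (dpred_exrv HS (Q := fun p e => steep (e 1%N) n p)).
  by have := dpred_rename HS (fun i => if i is j.+1 then j else (n + 1)%N) (dpred_steep n).
(* The second disjunct describes the default value 0 of [curve] at empty levels. *)
have := dpred_or HS DP (dpred_and HS (dpred_not HS DQ) (dpred_eq HS (dfun_var HS 0) (dfun_const HS 0))).
apply: dpred_ext => e; rewrite /P /Q /curve; case: pselect => [h|nh].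
  case: cid => p ph /=; split=> [[[q [qh <-]]|[[]]//]|->]; last by left; exists p.
  by rewrite (lexset_uniq ph qh).
have e0 : env (0 : 'rV[R]_n) j = 0.
  by rewrite /env; case: insub => // i; rewrite mxE.
rewrite e0; split=> [[[q [qh _]]|[]//]|]; first by exfalso; apply: nh; exists q.
by right; split.
Qed.

Lemma level_germ z : exists2 d : R, 0 < d &
  (forall t, z < t < z + d -> level t !=set0) \/
  (forall t, z < t < z + d -> ~ (level t !=set0)).
Proof.
apply: (germ HS).
apply: (dpred_exrv HS (Q := fun p e => level (e 0%N) p)).
have := dpred_rename HS (fun i => if i is j.+1 then j else (n + 0)%N) dpred_level.
by apply: dpred_ext.
Qed.

Hypothesis m0 : forall p, 0 <= m p.
Hypothesis Fm : forall p, `|p| <= k -> forall eta : R, 0 < eta ->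
  exists2 rho : R, 0 < rho & forall q, `|q - p| < rho ->
    `|F q - F p| <= (m p + eta) * `|q - p|.

(* psi is the sum of the variations of the coordinates of the curve, all of
   them monotone near z. *)
Lemma kl_right z : exists d (psi : R -> R), [/\ 0 < d,
  forall s t, z < s -> s <= t -> t < z + d -> psi s <= psi t,
  forall t, z < t < z + d -> 0 <= psi t,
  forall zeta : R, 0 < zeta -> exists t, z < t < z + d /\ psi t < zeta &
  forall a b mu, z < a -> a <= b -> b < z + d ->
    (forall tau, a <= tau <= b -> exists p, level tau p /\ m p <= mu) ->
    b - a <= mu * (psi b - psi a)].
Proof.
have [d d0 [lne|le0]] := level_germ z; last first.
  exists d, (fun=> 0); split=> // [zeta zeta0|a b mu za ab bz].
    by exists (z + d / 2); split=> //; lra.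
  by move=> /(_ a)[|p [ap _]]; [lra|case: (le0 a); [lra|exists p]].
pose g j t := env (curve t) j.
have gmono (j : 'I_n) := mono_germ HS (g := g j) z (dfun_curve j).
pose e j := projT1 (cid2 (gmono j)).
have e0 j : 0 < e j by rewrite /e; case: cid2.
have eP j : exists b : bool, forall s t, z < s -> s <= t -> t < z + e j ->
    (-1) ^+ b * g j s <= (-1) ^+ b * g j t.
  rewrite /e; case: cid2 => /= r _ [h|h]; [exists false|exists true] => s t zs st tr.
    by rewrite expr0 !mul1r h.
  by rewrite expr1 !mulN1r lerN2 h.
have [r r0 re] := fin_pos_min e0.
have /choice[sg sgP] := eP.
pose d' := Num.min d r.
have d'0 : 0 < d' by rewrite lt_min d0.
have d'd : d' <= d by rewrite ge_min lexx.
have d'r : d' <= r by rewrite ge_min lexx orbT.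
have gm (j : 'I_n) s t : z < s -> s <= t -> t < z + d' ->
    (-1) ^+ sg j * g j s <= (-1) ^+ sg j * g j t.
  move=> zs st tz; apply: sgP => //; apply: lt_le_trans tz _.
  by rewrite lerD2l (le_trans d'r).
pose psi0 t := \sum_(j < n) (-1) ^+ sg j * g j t.
have curveK t : z < t < z + d' -> `|curve t| <= k /\ F (curve t) = t.
  move=> zt; have /curveP/lexset_sub[] : level t !=set0 by apply: lne; lra.
  by [].
(* The infimum of psi0 is subtracted to make psi nonnegative and arbitrarily small near z. It is
   finite because the curve stays in the ball of radius k. *)
pose B := [set psi0 t | t in [set t | z < t < z + d']].
have Bne : B !=set0.
  by exists (psi0 (z + d' / 2)), (z + d' / 2) => //=; lra.
have Blb : has_lbound B.
  exists (\sum_(j < n) - k) => _ [t zt <-]; apply: ler_sum => j _.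
  have [/(rv_norm_le _ k0)/(_ j)] := curveK t zt; rewrite -envE -/(g j t) => gk _.
  rewrite lerNl; apply: le_trans gk; rewrite -(normrMsign (sg j) (g j t)).
  by rewrite -normrN ler_norm.
have Binf : has_inf B by [].
have psi0_mono s t : z < s -> s <= t -> t < z + d' -> psi0 s <= psi0 t.
  by move=> zs st tz; apply: ler_sum => j _; exact: gm.
(* Every coordinate, taken with its sign, is nondecreasing, so the sum of the increments dominates
   the displacement of the curve. *)
have curve_psi s t : z < s < z + d' -> z < t < z + d' ->
    `|curve t - curve s| <= `|psi0 t - psi0 s|.
  wlog st : s t / s <= t => [hw|] zs zt.
    have [st|/ltW ts] := leP s t; first exact: hw.
    by rewrite distrC [leRHS]distrC; exact: hw.
  rewrite [leRHS]ger0_norm; last by rewrite subr_ge0 psi0_mono//; lra.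
  apply: le_trans (rv_norm_sum _) _; rewrite /psi0 -sumrB; apply: ler_sum => j _.
  have := gm j s t; rewrite !mxE -!envE -/(g j t) -/(g j s) => gst.
  rewrite -mulrBr -[leLHS](normrMsign (sg j)) ger0_norm//.
  by rewrite mulrBr subr_ge0 gst//; lra.
exists d', (fun t => psi0 t - inf B); split=> //.
- by move=> s t zs st tz; rewrite lerD2r psi0_mono.
- by move=> t zt; rewrite subr_ge0; apply: ge_inf => //; exists t.
- move=> zeta zeta0; have [_ [t zt <-] tB] := inf_adherent zeta0 Binf.
  by exists t; split=> //; rewrite ltrBlDl.
move=> a b mu za ab bz hmu.
rewrite (_ : psi0 b - inf B - (psi0 a - inf B) = psi0 b - psi0 a); last by ring.
have psiab : 0 <= psi0 b - psi0 a by rewrite subr_ge0 psi0_mono.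
have main (eta : R) : 0 < eta -> b - a <= (mu + eta) * (psi0 b - psi0 a).
  move=> eta0.
  apply: (creep (P := fun s t => t - s <= (mu + eta) * (psi0 t - psi0 s)) ab).
    move=> r' s t _ _ _ _ rs st.
    have -> : (mu + eta) * (psi0 t - psi0 r') =
      (mu + eta) * (psi0 s - psi0 r') + (mu + eta) * (psi0 t - psi0 s) by ring.
    lra.
  move=> c cab; have zc : z < c < z + d' by lra.
  have [ck Fc] := curveK c zc.
  have mc : m (curve c) <= mu.
    have [p [pc pmu]] := hmu c cab.
    have /curveP/lexset_sub[_ /(_ p pc) mp] : level c !=set0 by exists p.
    exact: le_trans mp pmu.
  have mueta : 0 < mu + eta by have := m0 (curve c); lra.
  have [rho rho0 rhoP] := Fm ck eta0.
  (* The curve may jump at c. A jump of length at least rho pays for |t - c| < eta * rho by itself;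
     otherwise the slope bound at [curve c] applies. *)
  have near t : a <= t <= b -> `|t - c| < eta * rho ->
      `|t - c| <= (mu + eta) * `|psi0 t - psi0 c|.
    move=> tab tc; have zt : z < t < z + d' by lra.
    have [tk Ft] := curveK t zt.
    have cp := curve_psi c t zc zt.
    have [far|close] := leP rho `|curve t - curve c|.
      apply: le_trans (ltW tc) _; apply: ler_pM => //; [exact: ltW|exact: ltW| |].
        by have := m0 (curve c); lra.
      exact: le_trans far cp.
    have := rhoP _ close; rewrite Ft Fc => /le_trans; apply.
    apply: ler_pM => //; first by have := m0 (curve c); lra.
    lra.
  exists (eta * rho) => [|t tab]; first exact: mulr_gt0.
  have zt : z < t < z + d' by lra.
  split=> tc.
    have tc0 : t <= c by lra.
    have h1 : `|t - c| = c - t by rewrite ler0_norm ?opprB// subr_le0.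
    have h2 : `|psi0 t - psi0 c| = psi0 c - psi0 t.
      by rewrite ler0_norm ?opprB// subr_le0 psi0_mono//; lra.
    by have := near t tab; rewrite h1 h2; apply; lra.
  have tc0 : c <= t by lra.
  have h1 : `|t - c| = t - c by rewrite ger0_norm// subr_ge0.
  have h2 : `|psi0 t - psi0 c| = psi0 t - psi0 c.
    by rewrite ger0_norm// subr_ge0 psi0_mono//; lra.
  by have := near t tab; rewrite h1 h2; apply; lra.
exact: ler_mul_addgt0.
Qed.

End curve.

(** * The inequality on both sides of a value, and its Sard-type consequence *)

Section kurdyka_lojasiewicz.
Variables (R : realType) (S : forall k : nat, set (set 'rV[R]_k)).
Hypothesis HS : o_minimal_structure S.
Variables (n : nat) (m : 'rV[R]_n -> R) (k : R).
Hypothesis Tm : dfun S (fun e => m (\row_i e i)).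
Hypotheses (cm : continuous m) (k0 : 0 <= k) (m0 : forall p, 0 <= m p).

(** m dominates the upper pointwise slope of F, in the role of the norm of its gradient; the
    condition is the same for F and - F. *)
Definition slope_bound (F : 'rV[R]_n -> R) :=
  forall p, `|p| <= k -> forall eta : R, 0 < eta ->
  exists2 rho : R, 0 < rho & forall q, `|q - p| < rho ->
    `|F q - F p| <= (m p + eta) * `|q - p|.

(** Under this condition the inequality reads b - a <= mu * (psi b - psi a), the integrated form of
    psi'(F) * slope >= 1, meaningful for a merely monotone psi. *)
Definition attained (F : 'rV[R]_n -> R) mu a b :=
  forall tau, a <= tau <= b -> exists p, [/\ `|p| <= k, F p = tau & m p <= mu].

(** Extends [kl_right] to the endpoint by psi z = 0: an interval starting at z is approximated by
    intervals starting within e to the right of z. *)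
Lemma kl_half F z : dfun S (fun e => F (\row_i e i)) -> continuous F -> slope_bound F ->
  exists d (psi : R -> R), [/\ 0 < d,
  forall s t, z <= s -> s <= t -> t < z + d -> psi s <= psi t,
  psi z = 0,
  forall zeta : R, 0 < zeta -> exists t, z < t < z + d /\ psi t < zeta &
  forall a b mu, z <= a -> a <= b -> b < z + d -> 0 <= mu ->
    attained F mu a b -> b - a <= mu * (psi b - psi a)].
Proof.
move=> TF cF Fm.
have [d [psi [d0 mono ge0 small int]]] := kl_right HS TF Tm cF cm k0 m0 Fm z.
have {}int a b mu : z < a -> a <= b -> b < z + d -> attained F mu a b ->
    b - a <= mu * (psi b - psi a).
  move=> za ab bz att; apply: int => // tau /att[p [pk Fp mp]].
  by exists p.
pose psi' t := if t <= z then 0 else psi t.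
have psi'z : psi' z = 0 by rewrite /psi' lexx.
have psi'E t : z < t -> psi' t = psi t by rewrite /psi' ltNge => /negbTE ->.
exists d, psi'; split=> //.
- move=> s t; rewrite le_eqVlt => /predU1P[<-|zs] st tz.
    rewrite psi'z; move: st; rewrite le_eqVlt => /predU1P[<-|zt]; first by rewrite psi'z.
    by rewrite psi'E// ge0// zt.
  by rewrite !psi'E ?(lt_le_trans zs)// mono.
- move=> zeta /small[t [/andP[zt tz] pt]]; exists t; rewrite zt tz psi'E//.
move=> a b mu za ab bz mu0 att.
move: za; rewrite le_eqVlt => /predU1P[za|za]; last first.
  by rewrite !psi'E ?(lt_le_trans za)// int.
subst a; rewrite psi'z subr0.
move: ab; rewrite le_eqVlt => /predU1P[zb|zb].
  by rewrite -zb psi'z mulr0 subrr.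
rewrite psi'E//; apply/ler_addgt0Pr => e e0.
pose a := Num.min b (z + e).
have za : z < a by rewrite lt_min zb ltrDl.
have ab : a <= b by rewrite ge_min lexx.
have aze : a <= z + e by rewrite ge_min lexx orbT.
have atta : attained F mu a b.
  by move=> tau /andP[at' tb]; apply: att; rewrite tb (le_trans (ltW za) at').
have := int a b mu za ab bz atta.
have : mu * (psi b - psi a) <= mu * psi b.
  by rewrite ler_wpM2l// gerBl ge0// za (le_lt_trans ab).
lra.
Qed.

(** To the left of z this is [kl_half] for - F at - z, reflected. Both halves vanish at z, where an
    interval containing z is split. *)
Lemma kurdyka_lojasiewicz F z : dfun S (fun e => F (\row_i e i)) -> continuous F -> slope_bound F ->
  exists d (psi : R -> R), [/\ 0 < d,
  forall s t, z - d < s -> s <= t -> t < z + d -> psi s <= psi t,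
  forall zeta : R, 0 < zeta ->
    exists r, 0 < r < d /\ psi (z + r) - psi (z - r) < zeta &
  forall a b mu, z - d < a -> a <= b -> b < z + d -> 0 <= mu ->
    attained F mu a b -> b - a <= mu * (psi b - psi a)].
Proof.
move=> TF cF Fm.
have [d1 [psi1 [d10 mono1 psi1z small1 int1]]] := kl_half z TF cF Fm.
pose G p := - F p.
have TG : dfun S (fun e => G (\row_i e i)) by exact: dfun_opp.
have cG : continuous G by move=> x; exact: (cvgN (cF x)).
have Gm : slope_bound G.
  move=> p /Fm pF eta /pF[rho rho0 rhoP]; exists rho => // q /rhoP.
  by rewrite /G -opprD normrN.
have [d2 [psi2 [d20 mono2 psi2z small2 int2]]] := kl_half (- z) TG cG Gm.
have [d [d0 dd1 dd2]] : exists d : R, [/\ 0 < d, d <= d1 & d <= d2].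
  by exists (Num.min d1 d2); rewrite lt_min d10 d20 !ge_min !lexx orbT.
pose psi t := if z <= t then psi1 t else - psi2 (- t).
have psiR t : z <= t -> psi t = psi1 t by rewrite /psi => ->.
have psiL t : t <= z -> psi t = - psi2 (- t).
  move=> tz; rewrite /psi; case: (leP z t) => // zt; have -> : t = z by apply/le_anti/andP.
  by rewrite psi1z psi2z oppr0.
have monoR s t : z <= s -> s <= t -> t < z + d -> psi s <= psi t.
  move=> zs st tz; rewrite !psiR ?(le_trans zs)//; apply: mono1 => //; lra.
have monoL s t : z - d < s -> s <= t -> t <= z -> psi s <= psi t.
  move=> zs st tz; rewrite !psiL ?(le_trans st)// lerN2; apply: mono2; lra.
have intR a b mu : z <= a -> a <= b -> b < z + d -> 0 <= mu ->
    attained F mu a b -> b - a <= mu * (psi b - psi a).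
  move=> za ab bz mu0 att; rewrite !psiR ?(le_trans za)//; apply: int1 => //; lra.
have intL a b mu : z - d < a -> a <= b -> b <= z -> 0 <= mu ->
    attained F mu a b -> b - a <= mu * (psi b - psi a).
  move=> za ab bz mu0 att; rewrite !psiL ?(le_trans ab)//.
  have -> : - psi2 (- b) - - psi2 (- a) = psi2 (- a) - psi2 (- b) by ring.
  have -> : b - a = - a - - b by ring.
  apply: int2 => //; try lra.
  move=> tau tauab; have [|p [pk Fp mp]] := att (- tau); first lra.
  by exists p; rewrite /G Fp opprK.
exists d, psi; split=> //.
- move=> s t zs st tz; have [zs'|sz] := leP z s; first exact: monoR.
  have [tz'|zt] := leP t z; first exact: monoL.
  have h1 : psi s <= psi z by apply: monoL => //; exact: ltW.
  by apply: le_trans h1 _; apply: monoR => //; exact: ltW.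
- move=> zeta zeta0.
  have zeta20 : 0 < zeta / 2 by lra.
  have [t1 [zt1 pt1]] := small1 _ zeta20.
  have [t2 [zt2 pt2]] := small2 _ zeta20.
  have [r [r0 rd rt1 rt2]] : exists r : R, [/\ 0 < r, r < d, r <= t1 - z & r <= t2 + z].
    exists (Num.min (d / 2) (Num.min (t1 - z) (t2 + z))).
    rewrite !lt_min !gt_min !ge_min !lexx !orbT; split=> //; last by apply/orP; left; lra.
    by apply/and3P; split; lra.
  exists r; split; first lra.
  have := mono1 (z + r) t1; have := mono2 (- (z - r)) t2.
  rewrite psiR; last lra. rewrite psiL; last lra.
  move=> h2 h1.
  have {}h2 : psi2 (- (z - r)) <= psi2 t2 by apply: h2; lra.
  have {}h1 : psi1 (z + r) <= psi1 t1 by apply: h1; lra.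
  lra.
move=> a b mu za ab bz mu0 att.
have [za'|az] := leP z a; first exact: intR.
have [bz'|zb] := leP b z; first exact: intL.
have h1 : z - a <= mu * (psi z - psi a).
  apply: intL => //; [exact: ltW|].
  by move=> tau /andP[at' tz]; apply: att; rewrite at' (le_trans tz (ltW zb)).
have h2 : b - z <= mu * (psi b - psi z).
  apply: intR => //; [exact: ltW|].
  by move=> tau /andP[zt tb]; apply: att; rewrite tb (le_trans (ltW az) zt).
have -> : mu * (psi b - psi a) = mu * (psi z - psi a) + mu * (psi b - psi z) by ring.
lra.
Qed.

(** For mu = 0 the inequality leaves no length to an interval of attained values. *)
Lemma sard F a b : dfun S (fun e => F (\row_i e i)) -> continuous F -> slope_bound F ->
  a < b -> ~ attained F 0 a b.
Proof.
move=> TF cF Fm ab att.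
have [d [psi [d0 _ _ int]]] := kurdyka_lojasiewicz a TF cF Fm.
pose c := Num.min b (a + d / 2).
have ac : a < c by rewrite lt_min ab /=; lra.
have cb : c <= b by rewrite ge_min lexx.
have cd : c <= a + d / 2 by rewrite ge_min lexx orbT.
have attc : attained F 0 a c by move=> tau /andP[at' tc]; apply: att; rewrite at' (le_trans tc).
have := int a c 0; rewrite mul0r => /(_ _ _ _ _ attc) h.
have : c - a <= 0 by apply: h; lra.
lra.
Qed.

End kurdyka_lojasiewicz.

(** * Inner products and derivatives on [0, +oo[ *)

Section inner_product.
Variables (R : realType) (n : nat) (ip : {dot 'rV[R]_n for idfun}).

Lemma ip_sum u v : ip u v = \sum_i \sum_j u 0 i * v 0 j * ip (delta_mx 0 i) (delta_mx 0 j).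
Proof.
rewrite {1}(row_sum_delta u) linear_sumlz; apply: eq_bigr => i _.
rewrite linearZl_LR /= {1}(row_sum_delta v) linear_sum mulr_sumr; apply: eq_bigr => j _.
by rewrite linearZ /= mulrA.
Qed.

Lemma ip_sym u v : ip u v = ip v u.
Proof. by rewrite hermC expr0 mul1r. Qed.

Lemma ip_ge0 u : 0 <= ip u u.
Proof.
have [->|u0] := eqVneq u 0; first by rewrite linear0.
exact/ltW/neq0_dnorm_gt0.
Qed.

Lemma ip_le : exists2 C : R, 0 < C & forall u v, `|ip u v| <= C * `|u| * `|v|.
Proof.
pose C := \sum_i \sum_j `|ip (delta_mx 0 i) (delta_mx 0 j)|.
have C0 : 0 <= C by apply: sumr_ge0 => i _; exact: sumr_ge0.
exists (C + 1) => [|u v]; first by lra.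
have : `|ip u v| <= C * `|u| * `|v|.
  rewrite ip_sum; apply: le_trans (ler_norm_sum _ _ _) _.
  rewrite -mulrA mulr_suml; apply: ler_sum => i _.
  apply: le_trans (ler_norm_sum _ _ _) _.
  rewrite mulr_suml; apply: ler_sum => j _.
  rewrite !normrM mulrC ler_wpM2l// ler_pM ?rv_coord_le//.
move=> /le_trans; apply; rewrite -!mulrA ler_wpM2r ?mulr_ge0//; lra.
Qed.

(** By compactness ip u u has a positive minimum on the unit sphere of the max norm; homogeneity
    does the rest. *)
Lemma ip_ge : exists2 c : R, 0 < c & forall u, c * `|u| ^+ 2 <= ip u u.
Proof.
pose A := [set u : 'rV[R]_n | `|u - 0| <= 1] `&` [set u | `|u| = 1].
have cA : compact A.
  apply: compact_closedI; first exact: ball_compact.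
  apply: (@closed_comp _ _ (fun u : 'rV[R]_n => `|u|) [set s | s = 1]); last exact: closed_eq.
  by move=> u _; exact: norm_continuous.
have cip : continuous (fun u => ip u u).
  move=> u; rewrite (_ : (fun u => ip u u) = fun u =>
    \sum_i \sum_j u 0 i * u 0 j * ip (delta_mx 0 i) (delta_mx 0 j)); last first.
    by apply/funext => v; rewrite {1}ip_sum.
  apply: (@continuous_big _ _ _ _ _ add_continuous) => i _.
  apply: (@continuous_big _ _ _ _ _ add_continuous) => j _ v.
  exact: (cvgM (cvgM (@coord_continuous R 1 n 0 i v) (@coord_continuous R 1 n 0 j v))
    (cvg_cst _)).
have unit u : u != 0 -> A (`|u|^-1 *: u).
  move=> u0; have : `|(`|u|^-1 *: u)| = 1.
    by rewrite normrZ normfV normr_id mulVf// normr_eq0.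
  by move=> u1; split; rewrite /= ?subr0 u1.
(* The sphere is empty only if every vector is 0, and then any constant serves. *)
have [[u0 Au0]|A0] := pselect (A !=set0); last first.
  exists 1 => // u; have [->|/unit Au] := eqVneq u 0; last by case: A0; eexists; exact: Au.
  by rewrite normr0 expr0n mulr0 linear0.
have [c /set_mem[_ c1] cmin] :=
  compact_EVT_min (ex_intro _ _ Au0) cA (continuous_subspaceT cip).
have c0 : c != 0.
  by apply/eqP => c0; move: c1; rewrite /= c0 normr0 => /eqP; rewrite eq_sym oner_eq0.
exists (ip c c) => [|u]; first exact: neq0_dnorm_gt0.
have [->|u0'] := eqVneq u 0; first by rewrite normr0 expr0n mulr0 linear0.
have := cmin _ (mem_set (unit u u0')).
rewrite linearZl_LR linearZ /= mulrA -invfM -expr2 mulrC ler_pdivlMr//.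
by rewrite exprn_gt0// normr_gt0.
Qed.

Lemma ip_norm_le : exists c C : R, [/\ 0 < c, 0 < C &
  forall u, c * `|u| <= ip_norm ip u <= C * `|u| ].
Proof.
have [c c0 cP] := ip_ge; have [C C0 CP] := ip_le.
exists (Num.sqrt c), (Num.sqrt C); rewrite !sqrtr_gt0; split=> // u.
have sq (a : R) : 0 < a -> Num.sqrt a * `|u| = Num.sqrt (a * `|u| ^+ 2).
  by move=> a0; rewrite sqrtrM ?ltW// sqrtr_sqr normr_id.
rewrite !sq// /ip_norm !ler_wsqrtr// expr2 mulrA.
by apply: le_trans (CP u u); exact: ler_norm.
Qed.

End inner_product.

(** Differentiability relative to [0, +oo[, hence one-sided at t = 0. The product form avoids
    quotients, and the case s = t needs no exclusion. *)
Definition der (R : realType) (u : R -> R) (t d : R) : Prop :=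
  forall eta : R, 0 < eta -> exists2 r : R, 0 < r &
    forall s, 0 <= s -> `|s - t| < r -> `|u s - u t - d * (s - t)| <= eta * `|s - t|.

Definition vder (R : realType) n (x : R -> 'rV[R]_n) (t : R) (v : 'rV[R]_n) : Prop :=
  forall j, der (fun t => x t 0 j) t (v 0 j).

Section der.
Variable R : realType.
Implicit Types (u v : R -> R) (t d e : R).

Lemma der_lip u t d : der u t d -> exists2 r : R, 0 < r &
  forall s, 0 <= s -> `|s - t| < r -> `|u s - u t| <= (`|d| + 1) * `|s - t|.
Proof.
move=> /(_ 1 ltr01)[r r0 h]; exists r => // s s0 st; have := h s s0 st.
rewrite mulrDl -normrM => h'.
by have := ler_normD (u s - u t - d * (s - t)) (d * (s - t)); rewrite subrK; lra.
Qed.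

Lemma der_cont u t d : der u t d -> forall eta : R, 0 < eta -> exists2 r : R, 0 < r &
  forall s, 0 <= s -> `|s - t| < r -> `|u s - u t| < eta.
Proof.
move=> /der_lip[r r0 h] eta eta0; have d0 : 0 < `|d| + 1 by rewrite ltr_wpDl.
exists (Num.min r (eta / (`|d| + 1))); first by rewrite lt_min r0 divr_gt0.
move=> s s0; rewrite lt_min => /andP[sr]; rewrite ltr_pdivlMr// mulrC.
by apply: le_lt_trans; exact: h.
Qed.

Lemma der_cst c t : der (fun=> c) t 0.
Proof. by move=> eta eta0; exists 1 => // s _ _; rewrite subrr mul0r subr0 normr0 mulr_ge0// ltW. Qed.

Lemma der_id t : der id t 1.
Proof. by move=> eta eta0; exists 1 => // s _ _; rewrite mul1r subrr normr0 mulr_ge0// ltW. Qed.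

Lemma derD u v t d e : der u t d -> der v t e -> der (fun s => u s + v s) t (d + e).
Proof.
move=> du dv eta eta0; have eta2 : 0 < eta / 2 by lra.
have [r r0 hu] := du _ eta2; have [r' r'0 hv] := dv _ eta2.
exists (Num.min r r'); first by rewrite lt_min r0.
move=> s s0; rewrite lt_min => /andP[sr sr'].
have := hu s s0 sr; have := hv s s0 sr'.
have := ler_normD (u s - u t - d * (s - t)) (v s - v t - e * (s - t)).
have -> : u s - u t - d * (s - t) + (v s - v t - e * (s - t)) =
  u s + v s - (u t + v t) - (d + e) * (s - t) by ring.
lra.
Qed.

Lemma derZ u t d c : der u t d -> der (fun s => c * u s) t (c * d).
Proof.
move=> du eta eta0; have c0 : 0 < `|c| + 1 by rewrite ltr_wpDl.
have eta2 : 0 < eta / (`|c| + 1) by rewrite divr_gt0.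
have [r r0 hu] := du _ eta2; exists r => // s s0 st.
have -> : c * u s - c * u t - c * d * (s - t) = c * (u s - u t - d * (s - t)) by ring.
rewrite normrM; apply: le_trans (ler_wpM2l (normr_ge0 c) (hu s s0 st)) _.
rewrite mulrA ler_wpM2r// mulrCA ler_piMr ?(ltW eta0)//.
by rewrite ler_pdivrMr// mul1r; lra.
Qed.

Lemma derN u t d : der u t d -> der (fun s => - u s) t (- d).
Proof. by move=> /(derZ (-1)); rewrite mulN1r; under eq_fun do rewrite mulN1r. Qed.

Lemma derB u v t d e : der u t d -> der v t e -> der (fun s => u s - v s) t (d - e).
Proof. by move=> du /derN; exact: derD. Qed.

Lemma derM u v t d e : der u t d -> der v t e ->
  der (fun s => u s * v s) t (d * v t + u t * e).
Proof.
move=> du dv eta eta0.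
pose a := `|v t| + `|u t| + 1; have a0 : 0 < a by rewrite /a ltr_wpDl.
pose b := (`|d| + 1) * (`|e| + 1); have b0 : 0 < b by rewrite mulr_gt0// ltr_wpDl.
have eta2 : 0 < eta / (2 * a) by rewrite divr_gt0 ?mulr_gt0.
have [r1 r10 hu] := du _ eta2; have [r2 r20 hv] := dv _ eta2.
have [r3 r30 lu] := der_lip du; have [r4 r40 lv] := der_lip dv.
have r50 : 0 < eta / (2 * b) by rewrite divr_gt0 ?mulr_gt0.
exists (Num.min (Num.min r1 r2) (Num.min (Num.min r3 r4) (eta / (2 * b)))).
  by rewrite !lt_min r10 r20 r30 r40 r50.
move=> s s0; rewrite !lt_min => /andP[/andP[s1 s2] /andP[/andP[s3 s4] s5]].
have := hu s s0 s1; have := hv s s0 s2; have := lu s s0 s3; have := lv s s0 s4.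
set h := `|s - t| in s5 *; set du' := u s - u t - d * (s - t).
set dv' := v s - v t - e * (s - t) => lv' lu' hv' hu'.
have h0 : 0 <= h by exact: normr_ge0.
have -> : u s * v s - u t * v t - (d * v t + u t * e) * (s - t) =
  du' * v t + u t * dv' + (u s - u t) * (v s - v t) by rewrite /du' /dv'; ring.
have n1 : `|du' * v t| <= eta / (2 * a) * h * `|v t| by rewrite normrM ler_wpM2r.
have n2 : `|u t * dv'| <= eta / (2 * a) * h * `|u t| by rewrite normrM mulrC ler_wpM2r.
have n3 : `|(u s - u t) * (v s - v t)| <= b * h * h.
  have -> : b * h * h = ((`|d| + 1) * h) * ((`|e| + 1) * h) by rewrite /b; ring.
  by rewrite normrM ler_pM.
have n4 : b * h * h <= eta / 2 * h.
  rewrite ler_wpM2r//; move: (ltW s5); rewrite ler_pdivlMr ?mulr_gt0//; lra.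
have n5 : eta / (2 * a) * h * `|v t| + eta / (2 * a) * h * `|u t| <= eta / 2 * h.
  rewrite -mulrDr [leLHS]mulrAC ler_wpM2r//.
  have -> : eta / 2 = eta / (2 * a) * a by field; rewrite gt_eqF.
  by rewrite ler_wpM2l ?(ltW eta2)// /a; lra.
have := ler_normD (du' * v t + u t * dv') ((u s - u t) * (v s - v t)).
have := ler_normD (du' * v t) (u t * dv').
lra.
Qed.

Lemma der_bigsum (I : Type) (r : seq I) (u : I -> R -> R) (d : I -> R) t :
  (forall i, der (u i) t (d i)) -> der (fun s => \sum_(i <- r) u i s) t (\sum_(i <- r) d i).
Proof.
move=> du; elim: r => [|i r IH].
  by rewrite big_nil; under eq_fun do rewrite big_nil; exact: der_cst.
by rewrite big_cons; under eq_fun do rewrite big_cons; exact: derD.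
Qed.

(** Near each point the increment of u is at most eta times that of time; [creep] adds these
    estimates up, and then eta tends to 0. *)
Lemma der_nincr u a b : 0 <= a -> a <= b ->
  (forall t, a <= t <= b -> exists2 d, d <= 0 & der u t d) -> u b <= u a.
Proof.
move=> a0 ab du; suff h eta : 0 < eta -> u b - u a <= eta * (b - a).
  rewrite -subr_le0; apply/ler_addgt0Pr => e e0; rewrite add0r.
  have e1 : 0 < e / (b - a + 1) by apply: divr_gt0 => //; lra.
  apply: le_trans (h _ e1) _; rewrite mulrAC ler_pdivrMr; last lra.
  by rewrite ler_pM2l//; lra.
move=> eta0; apply: (creep (P := fun s t => u t - u s <= eta * (t - s)) ab).
  move=> r s t _ _ _ _ rs st; lra.
move=> c cab; have [d d0 dc] := du c cab; have [r r0 h] := dc _ eta0.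
exists r => // s sab.
have s0 : 0 <= s by lra.
split=> sc.
  have := h s s0; rewrite ler0_norm; last lra.
  move=> /(_ ltac:(lra)) /ler_normlP[h1 h2].
  have : d * (s - c) >= 0 by apply: mulr_le0 => //; lra.
  lra.
have := h s s0; rewrite ger0_norm; last lra.
move=> /(_ ltac:(lra)) /ler_normlP[h1 h2].
have : d * (s - c) <= 0 by apply: mulr_le0_ge0 => //; lra.
lra.
Qed.

Lemma der_le u a b M (d : R -> R) : 0 <= a -> a <= b ->
  (forall t, a <= t <= b -> der u t (d t)) -> (forall t, a <= t <= b -> d t <= M) ->
  u b - u a <= M * (b - a).
Proof.
move=> a0 ab du dM.
have := @der_nincr (fun t => u t - M * t) a b a0 ab.
suff /[swap]/[apply] : forall t, a <= t <= b ->
  exists2 d, d <= 0 & der (fun t => u t - M * t) t d by lra.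
move=> t tab; exists (d t - M * 1); first by have := dM t tab; lra.
by apply: derB; [exact: du|apply: derZ; exact: der_id].
Qed.

Lemma der_norm_le u a b M (d : R -> R) : 0 <= a -> a <= b ->
  (forall t, a <= t <= b -> der u t (d t)) -> (forall t, a <= t <= b -> `|d t| <= M) ->
  `|u b - u a| <= M * (b - a).
Proof.
move=> a0 ab du dM; apply/ler_normlP; split.
  have := @der_le (fun t => - u t) a b M (fun t => - d t) a0 ab.
  move=> h; have : - u b - - u a <= M * (b - a).
    by apply: h => t tab; [apply/derN/du|have /ler_normlP[] := dM t tab].
  lra.
by apply: (der_le a0 ab du) => t tab; have /ler_normlP[] := dM t tab.
Qed.

End der.

Lemma cvg_within_dnbhs (R : realType) (V : normedModType R) (g : R -> V) (A : set R) (v : V) :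
  g h @[h --> within A 0^'] --> v <->
  forall eta : R, 0 < eta -> exists2 r : R, 0 < r &
    forall h, A h -> h != 0 -> `|h| < r -> `|g h - v| <= eta.
Proof.
split=> [/cvgrPdist_le gv eta eta0|gv].
  have /nbhs_ballP[r /= r0 h] := gv eta eta0.
  exists r => // e Ae e0 er; rewrite distrC; apply: h => //.
  by rewrite -ball_normE /= sub0r normrN.
apply/cvgrPdist_le => eta eta0; have [r r0 h] := gv eta eta0.
apply/nbhs_ballP; exists r => // e; rewrite -ball_normE /= sub0r normrN => er e0 Ae.
by rewrite distrC h.
Qed.

Lemma der_is_derive (R : realType) (u : R -> R) (t d : R) : is_derive t 1 u d -> der u t d.
Proof.
move=> [du dE] eta eta0.
have : h^-1 *: (u (h *: 1 + t) - u t) @[h --> within setT 0^'] --> d.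
  have du' : h^-1 *: (u (h *: 1 + t) - u t) @[h --> 0^'] --> d by rewrite -dE; exact: du.
  by apply: cvg_trans du'; apply: cvg_app; exact: cvg_within.
move=> /cvg_within_dnbhs/(_ eta eta0)[r r0 hr]; exists r => // s s0 st.
have [->|st0] := eqVneq s t; first by rewrite !subrr mulr0 subrr normr0 mulr0.
have st' : s - t != 0 by rewrite subr_eq0.
have := hr (s - t) I st' st; rewrite scaler1 subrK => h.
rewrite -ler_pdivrMr ?normr_gt0// -normfV -normrM.
apply: le_trans h; rewrite le_eqVlt; apply/orP; left; apply/eqP; congr (`|_|).
rewrite /GRing.scale /=; by field.
Qed.

Lemma has_deriv_ge0P (R : realType) n (x : R -> 'rV[R]_n) t v : 0 <= t ->
  has_deriv_ge0 x t v <-> vder x t v.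
Proof.
move=> t0; rewrite /has_deriv_ge0; split=> [/cvg_within_dnbhs xv j eta eta0|xv].
  have [r r0 hr] := xv eta eta0; exists r => // s s0 st.
  have [->|st0] := eqVneq s t; first by rewrite !subrr mulr0 subrr normr0 mulr0.
  have st' : s - t != 0 by rewrite subr_eq0.
  have := hr (s - t); rewrite /= addrC subrK => /(_ s0 st' st) h.
  have := le_trans (rv_coord_le _ j) h; rewrite !mxE => {}h.
  rewrite -ler_pdivrMr ?normr_gt0// -normfV -normrM.
  apply: le_trans h; rewrite le_eqVlt; apply/orP; left; apply/eqP; congr (`|_|).
  by field.
apply/cvg_within_dnbhs => eta eta0.
have /choice[r rP] (j : 'I_n) : exists r : R, 0 < r /\ forall s, 0 <= s -> `|s - t| < r ->
    `|x s 0 j - x t 0 j - v 0 j * (s - t)| <= eta * `|s - t|.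
  by have [r r0 rP] := xv j eta eta0; exists r.
have [e e0 er] := fin_pos_min (fun j => (rP j).1).
exists e => // h th h0 he; apply/rv_norm_le; first exact: ltW.
move=> j; rewrite !mxE.
have := (rP j).2 (t + h) th; rewrite addrAC subrr add0r => /(_ (lt_le_trans he (er j))).
rewrite -ler_pdivrMr ?normr_gt0// -normfV -normrM => /(le_trans _); apply.
rewrite le_eqVlt; apply/orP; left; apply/eqP; congr (`|_|).
by field.
Qed.

Lemma diff_eps (R : realType) n (f : 'rV[R]_n -> R) p : differentiable f p ->
  forall eta : R, 0 < eta -> exists2 r : R, 0 < r & forall q, `|q - p| < r ->
    `|f q - f p - 'd f p (q - p)| <= eta * `|q - p|.
Proof.
move=> /diff_locally/eqaddoP df eta eta0.
have /nbhs_ballP[r /= r0 h] := df eta eta0; exists r => // q qp.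
have := h (q - p); rewrite -ball_normE /= sub0r normrN => /(_ qp).
by rewrite !fctE /= subrK opprD addrA.
Qed.

Lemma vder_lip (R : realType) n (x : R -> 'rV[R]_n) t v : vder x t v ->
  exists2 r : R, 0 < r & forall s, 0 <= s -> `|s - t| < r ->
    `|x s - x t| <= (`|v| + 1) * `|s - t|.
Proof.
move=> dx.
have /choice[r rP] (j : 'I_n) : exists r : R, 0 < r /\ forall s, 0 <= s -> `|s - t| < r ->
    `|x s 0 j - x t 0 j| <= (`|v 0 j| + 1) * `|s - t|.
  by have [r r0 rP] := der_lip (dx j); exists r.
have [e e0 er] := fin_pos_min (fun j => (rP j).1).
exists e => // s s0 st; apply/rv_norm_le; first by rewrite mulr_ge0// addr_ge0.
move=> j; rewrite !mxE; apply: le_trans ((rP j).2 s s0 (lt_le_trans st (er j))) _.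
by rewrite ler_wpM2r// lerD2r rv_coord_le.
Qed.

Lemma vder_cont (R : realType) n (x : R -> 'rV[R]_n) t v : vder x t v ->
  forall eta : R, 0 < eta -> exists2 r : R, 0 < r &
  forall s, 0 <= s -> `|s - t| < r -> `|x s - x t| < eta.
Proof.
move=> /vder_lip[r r0 h] eta eta0; have d0 : 0 < `|v| + 1 by rewrite ltr_wpDl.
exists (Num.min r (eta / (`|v| + 1))); first by rewrite lt_min r0 divr_gt0.
move=> s s0; rewrite lt_min => /andP[sr]; rewrite ltr_pdivlMr// mulrC.
by apply: le_lt_trans; exact: h.
Qed.

Lemma vder_norm_le (R : realType) n (x v : R -> 'rV[R]_n) a b M :
  0 <= a -> a <= b -> 0 <= M ->
  (forall t, a <= t <= b -> vder x t (v t)) -> (forall t, a <= t <= b -> `|v t| <= M) ->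
  `|x b - x a| <= M * (b - a).
Proof.
move=> a0 ab M0 dx vM; apply/rv_norm_le; first by rewrite mulr_ge0// subr_ge0.
move=> j; rewrite !mxE.
apply: (@der_norm_le _ (fun t => x t 0 j) a b M (fun t => v t 0 j)) => // t tab.
  exact: dx.
by apply: le_trans (rv_coord_le _ j) _; exact: vM.
Qed.

Lemma diff_lin_le (R : realType) n (f : 'rV[R]_n -> R) p v :
  `|'d f p v| <= (\sum_j `|'d f p (delta_mx 0 j)|) * `|v|.
Proof.
rewrite {1}(row_sum_delta v) linear_sum; apply: le_trans (ler_norm_sum _ _ _) _.
rewrite mulr_suml; apply: ler_sum => j _; rewrite linearZ /= normrM mulrC.
by rewrite ler_wpM2l// rv_coord_le.
Qed.

Lemma der_comp (R : realType) n (f : 'rV[R]_n -> R) (x : R -> 'rV[R]_n) t v :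
  differentiable f (x t) -> vder x t v -> der (fun s => f (x s)) t ('d f (x t) v).
Proof.
move=> df dx eta eta0.
have [r1 r10 lx] := vder_lip dx.
set C := `|v| + 1 in lx; have C0 : 0 < C by rewrite /C ltr_wpDl.
set D := \sum_j `|'d f (x t) (delta_mx 0 j)|.
have D0 : 0 <= D by exact: sumr_ge0.
have eta1 : 0 < eta / (2 * C) by rewrite divr_gt0 ?mulr_gt0.
have [r2 r20 fx] := diff_eps df eta1.
have [r3 r30 cx] := vder_cont dx r20.
have eta2 : 0 < eta / (2 * (D + 1)) by rewrite divr_gt0 ?mulr_gt0 ?ltr_wpDl.
have [r4 r40 xx] : exists2 r : R, 0 < r & forall s, 0 <= s -> `|s - t| < r ->
    `|x s - x t - (s - t) *: v| <= eta / (2 * (D + 1)) * `|s - t|.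
  have /choice[r rP] (j : 'I_n) : exists r : R, 0 < r /\ forall s, 0 <= s -> `|s - t| < r ->
      `|x s 0 j - x t 0 j - v 0 j * (s - t)| <= eta / (2 * (D + 1)) * `|s - t|.
    by have [r r0 rP] := dx j _ eta2; exists r.
  have [e e0 er] := fin_pos_min (fun j => (rP j).1).
  exists e => // s s0 st; apply/rv_norm_le; first by rewrite mulr_ge0// ltW.
  move=> j; rewrite !mxE [_ * v 0 j]mulrC.
  exact: (rP j).2 s s0 (lt_le_trans st (er j)).
exists (Num.min (Num.min r1 r3) r4); first by rewrite !lt_min r10 r30 r40.
move=> s s0; rewrite !lt_min => /andP[/andP[s1 s3] s4].
have := lx s s0 s1; have := fx _ (cx s s0 s3); have := xx s s0 s4.
set h := `|s - t|; set y := x s - x t => e1 e2 e3.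
have h0 : 0 <= h by exact: normr_ge0.
have -> : f (x s) - f (x t) - 'd f (x t) v * (s - t) =
    (f (x s) - f (x t) - 'd f (x t) y) + 'd f (x t) (y - (s - t) *: v).
  have -> : 'd f (x t) (y - (s - t) *: v) = 'd f (x t) y - (s - t) * 'd f (x t) v.
    by rewrite linearB linearZ.
  ring.
apply: le_trans (ler_normD _ _) _.
have n1 : eta / (2 * C) * `|y| <= eta / 2 * h.
  have -> : eta / 2 * h = eta / (2 * C) * (C * h) by field; rewrite gt_eqF.
  by rewrite ler_wpM2l// ltW.
have n2 : `|'d f (x t) (y - (s - t) *: v)| <= eta / 2 * h.
  apply: le_trans (diff_lin_le _ _ _) _; rewrite -/D.
  apply: le_trans (ler_wpM2l D0 e1) _.
  have -> : eta / 2 * h = (D + 1) * (eta / (2 * (D + 1)) * h).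
    by field; rewrite gt_eqF// ltr_wpDl.
  by apply: ler_wpM2r; [apply: mulr_ge0 => //; exact: ltW|rewrite lerDl].
lra.
Qed.

Lemma der_ip (R : realType) n (ip : {dot 'rV[R]_n for idfun}) (x y : R -> 'rV[R]_n) t v w :
  vder x t v -> vder y t w -> der (fun s => ip (x s) (y s)) t (ip v (y t) + ip (x t) w).
Proof.
move=> dx dy.
have : der (fun s => \sum_i \sum_j x s 0 i * y s 0 j * ip (delta_mx 0 i) (delta_mx 0 j)) t
   (\sum_i \sum_j ip (delta_mx 0 i) (delta_mx 0 j) * (v 0 i * y t 0 j + x t 0 i * w 0 j)).
  apply: der_bigsum => i; apply: der_bigsum => j.
  under eq_fun do rewrite mulrC.
  by apply: derZ; apply: derM; [exact: dx|exact: dy].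
under eq_fun do rewrite -ip_sum.
congr der; rewrite !ip_sum -big_split; apply: eq_bigr => i _ /=.
by rewrite -big_split; apply: eq_bigr => j _ /=; ring.
Qed.

Lemma vder_add (R : realType) n (x y : R -> 'rV[R]_n) t v w :
  vder x t v -> vder y t w -> vder (fun s => x s + y s) t (v + w).
Proof.
move=> dx dy j; rewrite mxE; under eq_fun do rewrite mxE.
by apply: derD; [exact: dx|exact: dy].
Qed.

Lemma vder_scale (R : realType) n (x : R -> 'rV[R]_n) t v c :
  vder x t v -> vder (fun s => c *: x s) t (c *: v).
Proof.
move=> dx j; rewrite mxE; under eq_fun do rewrite mxE.
by apply: derZ; exact: dx.
Qed.

Lemma der_shift (R : realType) (u : R -> R) a t d : 0 <= a ->
  der u (a + t) d -> der (fun s => u (a + s)) t d.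
Proof.
move=> a0 du eta /du[r r0 h]; exists r => // s s0.
have := h (a + s); rewrite opprD addrACA subrr add0r; apply.
exact: addr_ge0.
Qed.

Lemma gronwall (R : realType) (u : R -> R) K b (d : R -> R) : 0 <= b ->
  (forall t, 0 <= t <= b -> der u t (d t)) ->
  (forall t, 0 <= t <= b -> d t <= K * u t) -> u b <= u 0 * expR (K * b).
Proof.
move=> b0 du dK.
have h : u b * expR (- K * b) <= u 0 * expR (- K * 0).
  apply: (@der_nincr _ (fun t => u t * expR (- K * t))) => // t tb.
  exists (d t * expR (- K * t) + u t * (- K * expR (- K * t))).
    have := dK t tb; rewrite -subr_le0 => h.
    have -> : d t * expR (- K * t) + u t * (- K * expR (- K * t)) =
      (d t - K * u t) * expR (- K * t) by ring.
    by rewrite mulr_le0_ge0 ?expR_ge0.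
  apply: derM; first exact: du.
  apply: der_is_derive; apply: is_derive_eq.
  by rewrite /GRing.scale /= mulr1 mulrC.
rewrite mulr0 expR0 mulr1 in h.
rewrite -(ler_pM2r (expR_gt0 (- K * b))); apply: le_trans h _.
by rewrite -mulrA -expRD mulNr subrr expR0 mulr1.
Qed.

(** * Ordinary differential equations *)

Lemma ler_dist_max0 (R : realType) (s t : R) :
  `|Num.max s 0 - Num.max t 0| <= `|s - t|.
Proof.
have h1 := ler_norm (s - t); have := ler_norm (t - s); rewrite distrC => h2.
by have [s0|s0] := leP s 0; have [t0|t0] := leP t 0; apply/ler_normlP; split; lra.
Qed.

Lemma antiderivative (R : realType) (h : R -> R) :
  (forall t, 0 <= t -> forall eta : R, 0 < eta -> exists2 r : R, 0 < r &
     forall s, 0 <= s -> `|s - t| < r -> `|h s - h t| < eta) ->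
  exists H : R -> R, H 0 = 0 /\ forall t, 0 <= t -> der H t (h t).
Proof.
(* Extended by the constant h 0 to negative times, to be continuous on the whole line. *)
move=> hc; pose k t := h (Num.max t 0).
have kc : continuous k.
  move=> t; apply/cvgrPdist_lt => eta eta0.
  have t0 : 0 <= Num.max t 0 by rewrite le_max lexx orbT.
  have [r r0 rP] := hc _ t0 eta eta0.
  apply/nbhs_ballP; exists r => // s /= ts.
  rewrite distrC; apply: rP; first by rewrite le_max lexx orbT.
  by apply: le_lt_trans (ler_dist_max0 _ _) _; rewrite distrC.
(* With base point -1 every t >= 0 is interior to the interval [-1, t + 1], and F has a two-sided
   derivative there. *)
pose F x := (\int[lebesgue_measure]_(t in `[(-1 : R), x]) k t)%R.
have dF (t : R) : 0 <= t -> is_derive t 1 F (h t).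
  move=> t0; have [||||d dE] := @continuous_FTC1_closed R k (-1) t (t + 1).
  - lra.
  - apply: continuous_compact_integrable; first exact: segment_compact.
    exact: continuous_subspaceT.
  - lra.
  - exact: kc.
  by split=> //; rewrite -derive1E dE /k /Num.max ltNge t0.
exists (fun t => F t - F 0); split=> [|t t0]; first by rewrite subrr.
rewrite -[h t]subr0; apply: derB; last exact: der_cst.
exact/der_is_derive/dF.
Qed.

(** The intervals of centre a k whose radius q k is the tail of the geometric series are nested; the
    supremum of their left ends lies in all of them. *)
Lemma geometric_limit (R : realType) (a : nat -> R) (C : R) :
  (forall k, `|a k.+1 - a k| <= C / 2 ^+ k) ->
  exists l, forall k, `|a k - l| <= 2 * C / 2 ^+ k.
Proof.
move=> aC; pose q k := 2 * C / 2 ^+ k.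
have qS k : q k.+1 = q k - C / 2 ^+ k.
  by rewrite /q exprS; field; rewrite expf_neq0.
have step k : a k - q k <= a k.+1 - q k.+1 /\ a k.+1 + q k.+1 <= a k + q k.
  by have /ler_normlP[] := aC k; rewrite qS; lra.
have lo k m : a k - q k <= a (k + m)%N - q (k + m)%N.
  elim: m => [|m]; first by rewrite addn0.
  by rewrite addnS; have [] := step (k + m)%N; lra.
have hi k m : a (k + m)%N + q (k + m)%N <= a k + q k.
  elim: m => [|m]; first by rewrite addn0.
  by rewrite addnS; have [] := step (k + m)%N; lra.
have C0 : 0 <= C by have := le_trans (normr_ge0 _) (aC 0%N); rewrite expr0 divr1.
have q0 k : 0 <= q k by rewrite /q divr_ge0 ?mulr_ge0 ?exprn_ge0.
have cross k j : a k - q k <= a j + q j.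
  have := lo k j; have := hi j k; rewrite addnC; have := q0 (k + j)%N; lra.
pose S := [set a k - q k | k in setT].
have S0 : S !=set0 by exists (a 0%N - q 0%N), 0%N.
have ubS : has_ubound S by exists (a 0%N + q 0%N) => _ [k _ <-].
exists (sup S) => k; rewrite -/(q k); apply/ler_normlP; split.
  have : sup S <= a k + q k by apply: ge_sup => // _ [j _ <-].
  by rewrite opprB; lra.
have : a k - q k <= sup S by apply: ub_le_sup => //; exists k.
by lra.
Qed.

Lemma geometric_le (R : realType) (x a D : R) :
  (forall k : nat, x <= a + D / 2 ^+ k) -> x <= a.
Proof.
move=> h; apply/ler_addgt0Pr => e e0.
have [D0|D0] := leP D 0.
  by have := h 0%N; rewrite expr0 divr1; lra.
pose k := (Num.truncn (D / e)).+1.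
apply: le_trans (h k) _; rewrite lerD2l ler_pdivrMr ?exprn_gt0//.
have : D / e < 2 ^+ k.
  apply: lt_trans (truncnS_gt _) _; rewrite -natrX ltr_nat.
  exact: ltn_expl.
by rewrite ltr_pdivrMr// mulrC => /ltW.
Qed.

Section picard.
Variables (R : realType) (n : nat).
Implicit Types (G : 'rV[R]_n -> 'rV[R]_n) (y : R -> 'rV[R]_n).

Lemma vder_antiderivative (h : R -> 'rV[R]_n) (y0 : 'rV[R]_n) :
  (forall t, 0 <= t -> forall eta : R, 0 < eta -> exists2 r : R, 0 < r &
     forall s, 0 <= s -> `|s - t| < r -> `|h s - h t| < eta) ->
  exists y, y 0 = y0 /\ forall t, 0 <= t -> vder y t (h t).
Proof.
move=> hc.
have /choice[H HP] (j : 'I_n) : exists H : R -> R, H 0 = 0 /\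
    forall t, 0 <= t -> der H t (h t 0 j).
  apply: antiderivative => t t0 eta /(hc t t0)[r r0 rP]; exists r => // s s0 st.
  by have := le_lt_trans (rv_coord_le _ j) (rP s s0 st); rewrite !mxE.
exists (fun t => \row_j (y0 0 j + H j t)); split=> [|t t0 j].
  by apply/rowP => j; rewrite !mxE (HP j).1 addr0.
under eq_fun do rewrite mxE.
by have := derD (der_cst (y0 0 j) t) ((HP j).2 t t0); rewrite add0r.
Qed.

(* Picard iteration: successive iterates differ by at most a constant times
   B 2^-k e^(2 L t). *)
Lemma picard G (y0 : 'rV[R]_n) (L B : R) : 0 < L -> 0 <= B ->
  (forall p q, `|G p - G q| <= L * `|p - q|) -> (forall p, `|G p| <= B) ->
  exists y, y 0 = y0 /\ forall t, 0 <= t -> vder y t (G (y t)).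
Proof.
move=> L0 B0 GL GB.
(* The bound on the derivative makes every iterate B-Lipschitz: G along it is then continuous and
   has an antiderivative, and the remainder in [estk] is uniform in k. *)
pose good y := y 0 = y0 /\ exists w : R -> 'rV[R]_n,
  forall t, 0 <= t -> vder y t (w t) /\ `|w t| <= B.
have goodL y : good y -> forall s t, 0 <= s -> s <= t -> `|y t - y s| <= B * (t - s).
  move=> [_ [w wP]] s t s0 st; apply: (vder_norm_le (v := w)) => // r rst.
    by apply: (wP r _).1; lra.
  by apply: (wP r _).2; lra.
have nextP y : exists z, good y -> good z /\ forall t, 0 <= t -> vder z t (G (y t)).
  have [gy|] := pselect (good y); last by exists y.
  have [|z [z0 dz]] := @vder_antiderivative (fun t => G (y t)) y0.
    move=> t t0 eta eta0; have [_ [w wP]] := gy.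
    have eta1 : 0 < eta / L by rewrite divr_gt0.
    have [r r0 rP] := vder_cont (wP t t0).1 eta1.
    exists r => // s s0 /(rP s s0); rewrite ltr_pdivlMr// mulrC.
    exact: le_lt_trans.
  by exists z => _; split=> //; split=> //; exists (fun t => G (y t)) => t t0; split; [exact: dz|exact: GB].
have /choice[next nextE] := nextP.
pose Y k := iter k next (fun=> y0).
have good0 : good (fun=> y0).
  split=> //; exists (fun=> 0) => t _; rewrite normr0; split=> // j.
  by rewrite mxE; exact: der_cst.
have goodY k : good (Y k) by elim: k => //= k /nextE[].
have dY k t : 0 <= t -> vder (Y k.+1) t (G (Y k t)) by exact: (nextE _ (goodY k)).2.
have Y0 k : Y k 0 = y0 by case: (goodY k).
(* Chosen so that C * (2 * L * t) = B * t bounds the first difference; integrating L * expR (2 * L *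
   t) then gains a factor 1/2 per iteration. *)
pose C := B / (2 * L).
have C0 : 0 <= C by rewrite divr_ge0// mulr_ge0// ltW.
have der_exp (c t : R) : der (fun t => c * expR (2 * L * t)) t (c * (2 * L * expR (2 * L * t))).
  apply: derZ; apply: der_is_derive; apply: is_derive_eq.
  by rewrite /GRing.scale /= mulr1 mulrC.
have close k t : 0 <= t -> `|Y k.+1 t - Y k t| <= C / 2 ^+ k * expR (2 * L * t).
  elim: k t => [|k IH] t t0.
    rewrite expr0 divr1 -[Y 0%N t](Y0 1%N).
    apply: le_trans (goodL _ (goodY 1%N) _ _ (lexx 0) t0) _; rewrite subr0.
    have := expR_ge1Dx (2 * L * t) => e1.
    apply: (@le_trans _ _ (C * (2 * L * t))).
      by rewrite /C le_eqVlt; apply/orP; left; apply/eqP; field; rewrite gt_eqF.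
    by apply: ler_wpM2l => //; lra.
  have Ck : 0 <= C / 2 ^+ k by rewrite divr_ge0// exprn_ge0.
  have e0 : 0 <= expR (2 * L * t) by exact: expR_ge0.
  apply/rv_norm_le.
    by apply: mulr_ge0 => //; apply: divr_ge0 => //; exact: exprn_ge0.
  suff h (b : bool) j : (-1) ^+ b * (Y k.+2 t 0 j - Y k.+1 t 0 j) <= C / 2 ^+ k.+1 * expR (2 * L * t).
    move=> j; rewrite !mxE; apply/ler_normlP; split.
      by have := h true j; rewrite expr1 mulN1r.
    by have := h false j; rewrite expr0 mul1r.
  have := @der_nincr _ (fun s => (-1) ^+ b * (Y k.+2 s 0 j - Y k.+1 s 0 j) -
    C / 2 ^+ k.+1 * expR (2 * L * s)) 0 t (lexx 0) t0.
  rewrite !Y0 subrr mulr0 mulr0 expR0 sub0r mulr1.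
  have Ck1 : 0 <= C / 2 ^+ k.+1 by rewrite divr_ge0// exprn_ge0.
  suff /[swap]/[apply] : forall s, 0 <= s <= t -> exists2 d, d <= 0 &
    der (fun s => (-1) ^+ b * (Y k.+2 s 0 j - Y k.+1 s 0 j) -
    C / 2 ^+ k.+1 * expR (2 * L * s)) s d by lra.
  move=> s /andP[s0 st].
  exists ((-1) ^+ b * (G (Y k.+1 s) 0 j - G (Y k s) 0 j) - C / 2 ^+ k.+1 * (2 * L * expR (2 * L * s))).
    have h1 : `|(-1) ^+ b * (G (Y k.+1 s) 0 j - G (Y k s) 0 j)| <= L * (C / 2 ^+ k * expR (2 * L * s)).
      rewrite normrMsign; have := rv_coord_le (G (Y k.+1 s) - G (Y k s)) j.
      rewrite !mxE => /le_trans; apply; apply: le_trans (GL _ _) _.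
      by rewrite ler_wpM2l ?(ltW L0)// IH.
    have := ler_norm ((-1) ^+ b * (G (Y k.+1 s) 0 j - G (Y k s) 0 j)).
    have -> : C / 2 ^+ k.+1 * (2 * L * expR (2 * L * s)) = L * (C / 2 ^+ k * expR (2 * L * s)).
      by rewrite exprS; field; rewrite expf_neq0.
    lra.
  by apply: derB; [apply/derZ/derB; exact: dY|exact: der_exp].
have /choice[y yP] t : exists l : 'rV[R]_n, 0 <= t -> forall k,
    `|Y k t - l| <= 2 * (C * expR (2 * L * t)) / 2 ^+ k.
  have [t0|] := leP 0 t; last by exists 0 => //; rewrite leNgt => /negP.
  have /choice[l lP] (j : 'I_n) : exists l : R, forall k,
      `|Y k t 0 j - l| <= 2 * (C * expR (2 * L * t)) / 2 ^+ k.
    apply: geometric_limit => k.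
    have := le_trans (rv_coord_le _ j) (close k t t0); rewrite !mxE => /le_trans; apply.
    by rewrite mulrAC.
  exists (\row_j l j) => _ k; apply/rv_norm_le.
    apply: divr_ge0; last exact: exprn_ge0.
    by apply: mulr_ge0 => //; apply: mulr_ge0 => //; exact: expR_ge0.
  by move=> j; rewrite !mxE.
have lim0 : y 0 = y0.
  apply/eqP; rewrite eq_sym -subr_eq0 -normr_le0.
  apply: (@geometric_le _ _ _ (2 * (C * expR (2 * L * 0)))) => k.
  by rewrite add0r -(Y0 k) yP.
exists y; split=> // t t0 j eta eta0.
(* A quadratic remainder with a constant independent of k passes to the limit, which yields the
   derivative of y directly. *)
have estk k s : 0 <= s ->
    `|Y k.+1 s 0 j - Y k.+1 t 0 j - G (Y k t) 0 j * (s - t)| <= L * B * `|s - t| * `|s - t|.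
  move=> s0; pose u r := Y k.+1 r 0 j - G (Y k t) 0 j * r.
  have du r : 0 <= r -> der u r (G (Y k r) 0 j - G (Y k t) 0 j * 1).
    by move=> r0; apply: derB; [exact: dY|apply: derZ; exact: der_id].
  have bd r : 0 <= r -> `|r - t| <= `|s - t| ->
      `|G (Y k r) 0 j - G (Y k t) 0 j * 1| <= L * B * `|s - t|.
    move=> r0 rt; have := rv_coord_le (G (Y k r) - G (Y k t)) j; rewrite !mxE mulr1.
    move=> /le_trans; apply; apply: le_trans (GL _ _) _; rewrite -mulrA.
    apply: ler_wpM2l; first exact: ltW.
    apply: (@le_trans _ _ (B * `|r - t|)); last exact: ler_wpM2l.
    have [rt'|tr] := leP r t.
      by rewrite distrC [`|r - t|]distrC [`|t - r|]ger0_norm ?subr_ge0//; exact: (goodL _ (goodY k)).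
    have -> : `|r - t| = r - t by rewrite ger0_norm// subr_ge0 ltW.
    by apply: (goodL _ (goodY k)) => //; exact: ltW.
  have -> : Y k.+1 s 0 j - Y k.+1 t 0 j - G (Y k t) 0 j * (s - t) = u s - u t.
    by rewrite /u; ring.
  have [st|ts] := leP s t.
    have e1 : `|s - t| = t - s by rewrite distrC ger0_norm// subr_ge0.
    rewrite distrC [X in _ <= _ * X]e1.
    apply: (der_norm_le s0 st (d := fun r => G (Y k r) 0 j - G (Y k t) 0 j * 1)).
      by move=> r rst; apply: du; lra.
    move=> r rst; apply: bd; first lra.
    by rewrite e1 distrC ger0_norm; lra.
  have e1 : `|s - t| = s - t by rewrite ger0_norm// subr_ge0 ltW.
  rewrite [X in _ <= _ * X]e1.
  apply: (der_norm_le t0 (ltW ts) (d := fun r => G (Y k r) 0 j - G (Y k t) 0 j * 1)).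
    by move=> r rst; apply: du; lra.
  move=> r rst; apply: bd; first lra.
  by rewrite e1 ger0_norm; lra.
have est s : 0 <= s ->
    `|y s 0 j - y t 0 j - G (y t) 0 j * (s - t)| <= L * B * `|s - t| * `|s - t|.
  move=> s0.
  pose Es := 2 * (C * expR (2 * L * s)); pose Et := 2 * (C * expR (2 * L * t)).
  apply: (@geometric_le _ _ _ (Es + Et + L * Et * `|s - t|)) => k.
  have Es0 : 0 <= Es by rewrite /Es mulr_ge0// mulr_ge0// expR_ge0.
  have Et0 : 0 <= Et by rewrite /Et mulr_ge0// mulr_ge0// expR_ge0.
  have half (D : R) : 0 <= D -> D / 2 ^+ k.+1 <= D / 2 ^+ k.
    move=> D0; rewrite ler_wpM2l// lef_pV2 ?posrE ?exprn_gt0// exprS.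
    by rewrite ler_peMl ?exprn_ge0// ler1n.
  have h1 : `|Y k.+1 s 0 j - y s 0 j| <= Es / 2 ^+ k.
    apply: le_trans (half _ Es0); have := rv_coord_le (Y k.+1 s - y s) j; rewrite !mxE.
    by move=> /le_trans; apply; exact: yP.
  have h2 : `|Y k.+1 t 0 j - y t 0 j| <= Et / 2 ^+ k.
    apply: le_trans (half _ Et0); have := rv_coord_le (Y k.+1 t - y t) j; rewrite !mxE.
    by move=> /le_trans; apply; exact: yP.
  have h3 : `|(G (Y k t) 0 j - G (y t) 0 j) * (s - t)| <= L * (Et / 2 ^+ k) * `|s - t|.
    rewrite normrM ler_wpM2r//; have := rv_coord_le (G (Y k t) - G (y t)) j; rewrite !mxE.
    move=> /le_trans; apply; apply: le_trans (GL _ _) _.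
    by apply: ler_wpM2l; [exact: ltW|exact: yP].
  have h4 := estk k s s0.
  have -> : y s 0 j - y t 0 j - G (y t) 0 j * (s - t) =
    (Y k.+1 s 0 j - Y k.+1 t 0 j - G (Y k t) 0 j * (s - t)) +
    ((G (Y k t) 0 j - G (y t) 0 j) * (s - t) +
     ((Y k.+1 t 0 j - y t 0 j) - (Y k.+1 s 0 j - y s 0 j))) by ring.
  apply: le_trans (ler_normD _ _) _; apply: lerD => //.
  apply: le_trans (ler_normD _ _) _.
  have := ler_normB (Y k.+1 t 0 j - y t 0 j) (Y k.+1 s 0 j - y s 0 j).
  have -> : (Es + Et + L * Et * `|s - t|) / 2 ^+ k =
    Es / 2 ^+ k + Et / 2 ^+ k + L * (Et / 2 ^+ k) * `|s - t| by ring.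
  lra.
have LB1 : 0 < L * B + 1 by rewrite ltr_wpDl// mulr_ge0// ltW.
exists (eta / (L * B + 1)); first by rewrite divr_gt0.
move=> s s0; rewrite ltr_pdivlMr// => /ltW st.
apply: le_trans (est s s0) _; rewrite ler_wpM2r//.
by apply: le_trans st; rewrite mulrC ler_wpM2l//; lra.
Qed.

End picard.

Definition lipB (R : realType) n (G : 'rV[R]_n -> 'rV[R]_n) :=
  forall r, exists2 L : R, 0 < L &
    forall p q, `|p| <= r -> `|q| <= r -> `|G p - G q| <= L * `|p - q|.

Definition sol_on (R : realType) n (G : 'rV[R]_n -> 'rV[R]_n) (y : R -> 'rV[R]_n) (T : R) :=
  forall t, 0 <= t <= T -> vder y t (G (y t)).

(** A retraction onto the max-norm ball of radius M, 1-Lipschitz because it acts on each coordinate.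
    Composition with it makes a field that is Lipschitz on balls globally Lipschitz and bounded, as
    [picard] requires. *)
Definition clampv (R : realType) n (M : R) (p : 'rV[R]_n) : 'rV[R]_n :=
  \row_j Num.max (- M) (Num.min M (p 0 j)).

Section ode.
Variables (R : realType) (n : nat).
Implicit Types (G : 'rV[R]_n -> 'rV[R]_n) (y z : R -> 'rV[R]_n).

Lemma clampv_le (M : R) (p : 'rV[R]_n) : 0 <= M -> `|clampv M p| <= M.
Proof.
move=> M0; apply/rv_norm_le => // j; rewrite mxE; apply/ler_normlP.
by have [] := leP M (p 0 j); have [] := leP (- M) _; split; lra.
Qed.

Lemma clampv_id (M : R) (p : 'rV[R]_n) : `|p| <= M -> clampv M p = p.
Proof.
move=> pM; apply/rowP => j; rewrite mxE.
have /ler_normlP[h1 h2] := le_trans (rv_coord_le p j) pM.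
by rewrite min_r// max_r//; lra.
Qed.

Lemma clampv_lip (M : R) (p q : 'rV[R]_n) : 0 <= M ->
  `|clampv M p - clampv M q| <= `|p - q|.
Proof.
move=> M0; apply/rv_norm_le => // j.
apply: le_trans (rv_coord_le (p - q) j); rewrite !mxE.
have h1 := ler_norm (p 0 j - q 0 j); have := ler_norm (q 0 j - p 0 j).
rewrite distrC => h2.
have mM : Num.max (- M) M = M by rewrite max_r//; lra.
have [a1|a1] := leP M (p 0 j); have [a2|a2] := leP M (q 0 j); rewrite ?mM.
- by apply/ler_normlP; split; lra.
- by have [a4|a4] := leP (- M) (q 0 j); apply/ler_normlP; split; lra.
- by have [a3|a3] := leP (- M) (p 0 j); apply/ler_normlP; split; lra.
- have [a3|a3] := leP (- M) (p 0 j); have [a4|a4] := leP (- M) (q 0 j);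
    by apply/ler_normlP; split; lra.
Qed.

Lemma vder_bounded y (T : R) : 0 <= T ->
  (forall t, 0 <= t <= T -> exists v, vder y t v) ->
  exists M : R, forall t, 0 <= t <= T -> `|y t| <= M.
Proof.
move=> T0 dy.
apply: (creep (P := fun s t => exists M : R, forall r, s <= r <= t -> `|y r| <= M) T0).
  move=> r s t _ rs st _ [M1 h1] [M2 h2]; exists (Num.max M1 M2) => q /andP[rq qt].
  have [qs|sq] := leP q s; first by rewrite le_max h1 ?rq.
  by rewrite le_max h2 ?orbT// qt ltW.
move=> c cT; have [v dv] := dy c cT; have [r r0 rP] := vder_cont dv ltr01.
have near q : 0 <= q -> `|q - c| < r -> `|y q| <= `|y c| + 1.
  move=> q0 qc; have := rP q q0 qc; have := ler_normD (y q - y c) (y c).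
  rewrite subrK; lra.
exists r => // s sT; split=> sc; exists (`|y c| + 1) => q qs; apply: near; try lra.
  by apply/ltr_normlP; split; lra.
by apply/ltr_normlP; split; lra.
Qed.

Lemma rv_norm_sq (p : 'rV[R]_n) : `|p| ^+ 2 <= \sum_j p 0 j ^+ 2.
Proof.
have s0 : 0 <= \sum_j p 0 j ^+ 2 by apply: sumr_ge0 => j _; exact: sqr_ge0.
have : `|p| <= Num.sqrt (\sum_j p 0 j ^+ 2).
  apply/rv_norm_le; first exact: sqrtr_ge0.
  move=> j; rewrite -sqrtr_sqr ler_wsqrtr// (bigD1 j)//= lerDl.
  by apply: sumr_ge0 => i _; exact: sqr_ge0.
by move=> h; rewrite -[leRHS]sqr_sqrtr// lerXn2r ?nnegrE ?sqrtr_ge0.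
Qed.

(** Gronwall for the squared Euclidean distance, which is differentiable whereas the max norm is
    not. *)
Lemma sol_uniq G y z (T : R) : lipB G -> 0 <= T -> y 0 = z 0 ->
  sol_on G y T -> sol_on G z T -> forall t, 0 <= t <= T -> y t = z t.
Proof.
move=> GL T0 yz0 dy dz t /andP[t0 tT].
have [M1 y1] : exists M : R, forall t, 0 <= t <= T -> `|y t| <= M.
  by apply: vder_bounded => // s /dy h; eexists; exact: h.
have [M2 z2] : exists M : R, forall t, 0 <= t <= T -> `|z t| <= M.
  by apply: vder_bounded => // s /dz h; eexists; exact: h.
have [L L0 LP] := GL (Num.max M1 M2).
pose u s := \sum_j (y s 0 j - z s 0 j) ^+ 2.
have := @gronwall _ u (\sum_(j < n) (2 * L)) t
  (fun s => \sum_j ((G (y s) 0 j - G (z s) 0 j) * (y s 0 j - z s 0 j) +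
    (y s 0 j - z s 0 j) * (G (y s) 0 j - G (z s) 0 j))) t0.
have -> : u 0 = 0.
  by rewrite /u big1// => j _; rewrite yz0 subrr expr0n.
rewrite mul0r => h; have {}h : u t <= 0.
  apply: h => s /andP[s0 st].
    apply: der_bigsum => j; under eq_fun do rewrite expr2.
    by apply: derM; apply: derB; [apply: dy|apply: dz|apply: dy|apply: dz]; lra.
  rewrite mulr_suml; apply: ler_sum => j _.
  have sT : 0 <= s <= T by lra.
  have d1 : `|y s 0 j - z s 0 j| <= `|y s - z s|.
    by have := rv_coord_le (y s - z s) j; rewrite !mxE.
  have g1 : `|G (y s) 0 j - G (z s) 0 j| <= L * `|y s - z s|.
    have := rv_coord_le (G (y s) - G (z s)) j; rewrite !mxE => /le_trans; apply.
    by apply: LP; rewrite le_max ?y1 ?z2 ?orbT.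
  have := rv_norm_sq (y s - z s).
  have -> : \sum_j (y s - z s) 0 j ^+ 2 = u s.
    by apply: eq_bigr => i _; rewrite !mxE.
  move=> nu.
  have g2 : (G (y s) 0 j - G (z s) 0 j) * (y s 0 j - z s 0 j) <= L * `|y s - z s| ^+ 2.
    apply: le_trans (ler_norm _) _; rewrite normrM expr2 mulrA.
    by apply: ler_pM.
  have : L * `|y s - z s| ^+ 2 <= L * u s by rewrite ler_wpM2l// ltW.
  have -> : 2 * L * u s = 2 * (L * u s) by ring.
  by rewrite [(y s 0 j - z s 0 j) * _]mulrC; lra.
apply/rowP => j; apply/eqP; rewrite -subr_eq0 -sqrf_eq0 eq_le sqr_ge0 andbT.
apply: le_trans h; rewrite /u (bigD1 j)//= lerDl.
by apply: sumr_ge0 => i _; exact: sqr_ge0.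
Qed.

(** The field clamped at a radius M' larger than both M and |y0| has a global solution. It solves
    the original equation until its norm first reaches M', and at that time the a priori bound M is
    violated; so this never happens before T. *)
Lemma ode_global G (y0 : 'rV[R]_n) : lipB G ->
  (forall T : R, 0 <= T -> exists M : R, forall y T', y 0 = y0 -> 0 <= T' <= T ->
    sol_on G y T' -> `|y T'| <= M) ->
  exists y, y 0 = y0 /\ forall t, 0 <= t -> vder y t (G (y t)).
Proof.
move=> GL apriori.
have loc (T : R) : exists y, 0 <= T -> y 0 = y0 /\ sol_on G y T.
  have [T0|] := leP 0 T; last by exists (fun=> 0).
  have [M MP] := apriori T T0.
  pose M' := `|M| + `|y0| + 1.
  have M'0 : 0 <= M' by rewrite /M'; have := normr_ge0 M; have := normr_ge0 y0; lra.
  have [L L0 LP] := GL M'.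
  have [|||y [yi dy]] := @picard _ _ (G \o clampv M') y0 L (`|G 0| + L * M') L0.
  - by rewrite addr_ge0// mulr_ge0// ltW.
  - move=> p q; apply: le_trans (LP _ _ (clampv_le _ M'0) (clampv_le _ M'0)) _.
    by apply: ler_wpM2l; [exact: ltW|exact: clampv_lip].
  - move=> p; rewrite -(subrK (G 0) (_ p)) addrC; apply: le_trans (ler_normD _ _) _.
    rewrite lerD2l; apply: le_trans (LP _ _ (clampv_le _ M'0) _) _; first by rewrite normr0.
    by rewrite subr0; apply: ler_wpM2l; [exact: ltW|exact: clampv_le].
  exists y; split=> //.
  have small t : 0 <= t <= T -> `|y t| <= M'.
    move=> /andP[t0 tT]; rewrite leNgt; apply/negP => yt.
    have [||||s [/andP[s0 st] ys ysl]] := @first_hit R (fun s => `|y s|) 0 t M'.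
    - by [].
    - rewrite yi /M'; have := normr_ge0 M; lra.
    - exact: ltW.
    - move=> r rt e e0; have [d d0 dP] := vder_cont (dy r (andP rt).1) e0.
      exists d => // q /andP[q0 _] qr; apply: le_lt_trans (ler_dist_dist _ _) _; exact: dP.
    have : `|y s| <= M.
      apply: MP => //; first by rewrite (ltW s0) (le_trans st).
      move=> r /andP[r0 rs]; have := dy r r0; rewrite /= clampv_id//.
      by move: rs; rewrite le_eqVlt => /predU1P[->|rs]; [rewrite ys|apply/ltW/ysl; rewrite r0].
    rewrite ys /M'; have := ler_norm M; have := normr_ge0 y0; lra.
  by move=> t tT; have := dy t (andP tT).1; rewrite /= clampv_id// small.
have /choice[Y YP] := loc.
(* An integer beyond t. The value at t is read off from the solution on [0, N t]; by uniqueness any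
   other interval [0, T] containing t gives the same value. *)
pose N (t : R) : R := (Num.truncn t).+1%:R.
have tN (t : R) : 0 <= t -> t < N t by move=> t0; exact: truncnS_gt.
have N0 (t : R) : 0 <= N t by exact: ler0n.
pose y t := Y (N t) t.
have yY s (T : R) : 0 <= s -> s <= T -> y s = Y T s.
  move=> s0 sT; have T0 := le_trans s0 sT.
  have [YN0 YNs] := YP _ (N0 s); have [YT0 YTs] := YP _ T0.
  apply: (sol_uniq GL (y := Y (N s)) (z := Y T) s0) => //; last by rewrite s0 lexx.
  - by rewrite YN0 YT0.
  - by move=> r /andP[r0 rs]; apply: YNs; rewrite r0 (le_trans rs)// ltW// tN.
  - by move=> r /andP[r0 rs]; apply: YTs; rewrite r0 (le_trans rs).
exists y; split=> [|t t0].
  by rewrite (yY 0 0)//; have [] := YP 0 (lexx 0).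
have T0 : 0 <= t + 1 by lra.
have [_ YT] := YP _ T0.
have tT : t <= t + 1 by lra.
have := YT t; rewrite -yY// t0 tT => /(_ isT) dY j eta eta0.
have [r r0 rP] := dY j eta eta0.
exists (Num.min r 1); first by rewrite lt_min r0 ltr01.
move=> s s0; rewrite lt_min => /andP[sr s1].
have sT : s <= t + 1 by have := ler_norm (s - t); lra.
by rewrite (yY s (t + 1))// (yY t (t + 1))// in rP *; exact: rP.
Qed.

End ode.

(** * Energy estimates *)

(** Near-covering compactness with the filter of right neighbourhoods of 0 as parameter: finitely
    many local thresholds have a common lower bound. *)
Lemma compact_unif (R : realType) n (K : set 'rV[R]_n) (P : R -> 'rV[R]_n -> Prop) :
  compact K ->
  (forall eta eta' x, 0 < eta' -> eta' <= eta -> P eta x -> P eta' x) ->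
  (forall x, K x -> exists eta r : R, [/\ 0 < eta, 0 < r &
     forall x', `|x' - x| < r -> P eta x']) ->
  exists2 eta, 0 < eta & forall x, K x -> P eta x.
Proof.
move=> /compact_near_coveringP cK mono loc.
have := cK R (0^'+) P _.
case=> [x Kx|eps /= eps0 h]; last first.
  exists (eps / 2); first by rewrite divr_gt0.
  apply: h; last by rewrite /= divr_gt0.
  by rewrite /= sub0r normrN gtr0_norm ?divr_gt0//; lra.
have [eta [r [eta0 r0 rP]]] := loc x Kx.
exists ([set x' | `|x - x'| < r], [set e : R | 0 < e /\ e < eta]) => /=.
  split; first by apply/nbhs_ballP; exists r => // y; rewrite -ball_normE.
  exists eta => // e /=; rewrite sub0r normrN => ee e0; split=> //.
  by apply: le_lt_trans ee; exact: ler_norm.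
move=> [x' e] /= [xx' [e0 ee]]; apply: (mono eta) => //; first exact: ltW.
by apply: rP; rewrite distrC.
Qed.

(** The contrapositive of [compact_unif], in place of the extraction of a convergent subsequence as
    eta -> 0. *)
Lemma compact_cluster_unif (R : realType) n (K : set 'rV[R]_n) (Q : R -> 'rV[R]_n -> Prop) :
  compact K ->
  (forall eta eta' x, 0 < eta' -> eta' <= eta -> Q eta' x -> Q eta x) ->
  (forall eta : R, 0 < eta -> exists2 p, K p & Q eta p) ->
  exists2 x, K x & forall eta r : R, 0 < eta -> 0 < r ->
    exists p, `|p - x| < r /\ Q eta p.
Proof.
move=> cK mono ex; apply: contrapT => nx.
have [||eta eta0 h] := compact_unif (P := fun eta p => ~ Q eta p) cK.
- by move=> eta eta' x eta'0 le nQ Q'; apply: nQ; exact: mono Q'.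
- move=> x Kx; apply: contrapT => hx; apply: nx; exists x => // eta r eta0 r0.
  apply: contrapT => np; apply: hx; exists eta, r; split=> // p pr Qp.
  by apply: np; exists p.
by have [p /h] := ex eta eta0.
Qed.

Section dynamics.
Variables (R : realType) (n : nat) (ip : {dot 'rV[R]_n for idfun}).
Variables (gamma : R) (f : 'rV[R]_n -> R) (fmin : R).
Hypotheses (g0 : 0 < gamma) (fC : C11loc ip f) (fb : forall x, fmin <= f x).

Let gr := gradient ip f.
Implicit Types (eps a b k s t : R).

Lemma fdiff x : differentiable f x.
Proof. by have [] := fC. Qed.

Lemma fcont : continuous f.
Proof. by move=> x; exact/differentiable_continuous/fdiff. Qed.

Lemma fcont_eps x (eta : R) : 0 < eta -> exists2 r : R, 0 < r &
  forall y, `|y - x| < r -> `|f y - f x| < eta.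
Proof.
move=> eta0; have /cvgrPdist_lt/(_ eta eta0)/nbhs_ballP[r /= r0 h] := @fcont x.
exists r => // y; rewrite distrC => xy; rewrite distrC; apply: h.
by rewrite -ball_normE.
Qed.

(** Compactness gives one constant for short distances, and [creep] along the segment from y to z,
    which stays in the convex ball, gives it for all. The change of norm costs the factor C / c. *)
Lemma grad_lip : lipB gr.
Proof.
move=> r; have [_ _ loc] := fC.
have [c [C [c0 C0 cC]]] := ip_norm_le ip.
have cK : compact [set x : 'rV[R]_n | `|x - 0| <= r] by exact: ball_compact.
(* The Lipschitz constant is written eta^-1 so that the property is inherited by smaller eta. *)
pose P (eta : R) (x : 'rV[R]_n) := exists2 d : R, 0 < d & forall y z,
  `|y - x| < d -> `|z - x| < d -> `|gr y - gr z| <= eta^-1 * `|y - z|.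
have [||eta eta0 hP] := compact_unif (P := P) cK.
- move=> eta eta' x eta'0 le [d d0 dP]; exists d => // y z yx zx.
  apply: le_trans (dP y z yx zx) _; rewrite ler_wpM2r// lef_pV2// posrE//.
  exact: lt_le_trans le.
- move=> x _; have [U Ux [L LP]] := loc x.
  have /nbhs_ballP[d /= d0 dU] := Ux.
  have LL0 : 0 < (`|L| + 1) * C / c.
    by rewrite divr_gt0// mulr_gt0// ltr_wpDl.
  exists ((`|L| + 1) * C / c)^-1, (d / 2); split; rewrite ?invr_gt0//; first by lra.
  move=> x' x'x; exists (d / 2) => [|y z yx zx]; first by lra.
  have Uy w : `|w - x'| < d / 2 -> U w.
    move=> wx; apply: dU; rewrite -ball_normE /= distrC.
    have -> : w - x = (w - x') + (x' - x) by rewrite addrA subrK.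
    by apply: le_lt_trans (ler_normD _ _) _; lra.
  have /andP[h1 _] := cC (gr y - gr z); have /andP[_ h2] := cC (y - z).
  have h3 := LP y z (Uy y yx) (Uy z zx); rewrite -/gr in h3.
  rewrite invrK mulrAC ler_pdivlMr// mulrC; apply: le_trans h1 _.
  apply: le_trans h3 _; rewrite -mulrA.
  have ipn0 : 0 <= ip_norm ip (y - z) by exact: sqrtr_ge0.
  apply: (@le_trans _ _ ((`|L| + 1) * ip_norm ip (y - z))).
    by apply: ler_wpM2r => //; have := ler_norm L; lra.
  by apply: ler_wpM2l => //; rewrite addr_ge0.
exists eta^-1; first by rewrite invr_gt0.
move=> y z yr zr; rewrite [`|gr y - _|]distrC [`|y - z|]distrC.
pose w (t : R) := y + t *: (z - y).
have wr t : 0 <= t <= 1 -> `|w t - 0| <= r.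
  move=> /andP[t0 t1]; rewrite subr0.
  have -> : w t = (1 - t) *: y + t *: z.
    by rewrite /w scalerBr scalerBl scale1r addrA addrAC.
  apply: le_trans (ler_normD _ _) _; rewrite !normrZ ger0_norm ?subr_ge0// ger0_norm//.
  have -> : r = (1 - t) * r + t * r by ring.
  by apply: lerD; apply: ler_wpM2l; rewrite ?subr_ge0.
have wB s t : w t - w s = (t - s) *: (z - y).
  by rewrite /w opprD addrACA subrr add0r scalerBl.
have := creep (P := fun s t => `|gr (w t) - gr (w s)| <= eta^-1 * (`|z - y| * (t - s)))
  (@ler01 R).
have w0 : w 0 = y by rewrite /w scale0r addr0.
have w1 : w 1 = z by rewrite /w scale1r addrC subrK.
rewrite w0 w1 subr0 mulr1; apply.
- move=> q s t _ _ _ _ h1 h2.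
  rewrite (_ : gr (w t) - gr (w q) = (gr (w t) - gr (w s)) + (gr (w s) - gr (w q))).
    apply: le_trans (ler_normD _ _) _.
    have -> : eta^-1 * (`|z - y| * (t - q)) = eta^-1 * (`|z - y| * (t - s)) +
      eta^-1 * (`|z - y| * (s - q)) by ring.
    exact: lerD.
  by rewrite addrA subrK.
move=> a a01; have [d d0 dP] := hP (w a) (wr a a01).
have zy : 0 < `|z - y| + 1 by rewrite ltr_wpDl.
exists (d / (`|z - y| + 1)); first by rewrite divr_gt0.
have near s : `|s - a| < d / (`|z - y| + 1) -> `|w s - w a| < d.
  rewrite ltr_pdivlMr// wB normrZ => h; apply: le_lt_trans h.
  by apply: ler_wpM2l => //; lra.
have wcc : `|w a - w a| < d by rewrite subrr normr0.
move=> s s01; split=> sc.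
  have sc' : `|s - a| = a - s by rewrite distrC ger0_norm//; lra.
  apply: le_trans (dP _ _ wcc (near s _)) _; first by rewrite sc'; lra.
  by rewrite wB normrZ ger0_norm; [rewrite mulrC [`|z - y| * _]mulrC mulrC|lra].
have sc' : `|s - a| = s - a by rewrite ger0_norm//; lra.
apply: le_trans (dP _ _ (near s _) wcc) _; first by rewrite sc'; lra.
by rewrite wB normrZ ger0_norm; [rewrite [`|z - y| * _]mulrC|lra].
Qed.

Definition sol2 (eps : R) (x v : R -> 'rV[R]_n) :=
  (forall t, 0 <= t -> vder x t (v t)) /\
  (forall t, 0 <= t -> vder v t (- eps^-1 *: (gamma *: v t + gr (x t)))).

Definition sol1 (x : R -> 'rV[R]_n) :=
  forall t, 0 <= t -> vder x t (- gamma^-1 *: gr (x t)).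

Definition energy (eps : R) (x v : R -> 'rV[R]_n) (t : R) :=
  f (x t) + eps / 2 * ip (v t) (v t).

Lemma der_f (x : R -> 'rV[R]_n) t v : vder x t v ->
  der (fun s => f (x s)) t (ip (gr (x t)) v).
Proof. by move=> /(der_comp (fdiff (x t))); rewrite (gradientP ip). Qed.

(** Stated at a single time, to be available for solutions on a bounded interval in
    [sol2_exists]. *)
Lemma energy_der_at eps x v t : 0 < eps -> vder x t (v t) ->
  vder v t (- eps^-1 *: (gamma *: v t + gr (x t))) ->
  der (energy eps x v) t (- (gamma * ip (v t) (v t))).
Proof.
move=> eps0 dx dv.
have := derD (der_f dx) (derZ (eps / 2) (der_ip ip dv dv)).
congr der; rewrite [ip (- _ *: _) _]ip_sym -mulr2n linearZ linearD linearZ /= ip_sym.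
by rewrite mulr2n; field; rewrite gt_eqF.
Qed.

Lemma energy_der eps x v t : 0 < eps -> sol2 eps x v -> 0 <= t ->
  der (energy eps x v) t (- (gamma * ip (v t) (v t))).
Proof. by move=> eps0 [dx dv] t0; apply: energy_der_at => //; [exact: dx|exact: dv]. Qed.

Lemma energy_nincr eps x v s t : 0 < eps -> sol2 eps x v -> 0 <= s -> s <= t ->
  energy eps x v t <= energy eps x v s.
Proof.
move=> eps0 sol s0 st; apply: der_nincr => // r rst.
exists (- (gamma * ip (v r) (v r))); last by apply: energy_der => //; lra.
by rewrite oppr_le0 mulr_ge0 ?ip_ge0// ltW.
Qed.

Lemma energy_ge eps x v t : 0 < eps -> fmin <= energy eps x v t.
Proof.
move=> eps0; apply: le_trans (fb (x t)) _.
by rewrite lerDl mulr_ge0 ?ip_ge0// divr_ge0// ltW.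
Qed.

Lemma kinetic_le eps x v t : 0 < eps -> sol2 eps x v -> 0 <= t ->
  eps * ip (v t) (v t) <= 2 * (energy eps x v 0 - fmin).
Proof.
move=> eps0 sol t0; have := energy_nincr eps0 sol (lexx 0) t0.
rewrite {1}/energy => h; have := fb (x t).
have -> : eps * ip (v t) (v t) = 2 * (eps / 2 * ip (v t) (v t)) by field.
lra.
Qed.

Lemma sol2_shift eps x v a : 0 <= a -> sol2 eps x v ->
  sol2 eps (fun t => x (a + t)) (fun t => v (a + t)).
Proof.
move=> a0 [dx dv]; split=> t t0 j.
  exact: (der_shift (u := fun s => x s 0 j) a0 (dx _ (addr_ge0 a0 t0) j)).
exact: (der_shift (u := fun s => v s 0 j) a0 (dv _ (addr_ge0 a0 t0) j)).
Qed.

(* Young's inequality |v| <= (1 + |v|^2) / 2 bounds the length by the elapsed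
   time and the energy loss. *)
Lemma young_length : exists2 C : R, 0 < C &
  forall (x v : R -> 'rV[R]_n) (E : R -> R) a b, 0 <= a -> a <= b ->
  (forall t, a <= t <= b -> vder x t (v t)) ->
  (forall t, a <= t <= b -> der E t (- (gamma * ip (v t) (v t)))) ->
  E b <= E a /\ `|x b - x a| <= (b - a) + C * (E a - E b).
Proof.
have [c c0 cP] := ip_ge ip.
have C0 : 0 < (c * gamma)^-1 by rewrite invr_gt0 mulr_gt0.
exists (c * gamma)^-1 => // x v E a b a0 ab dx dE.
have Eab : E b <= E a.
  apply: der_nincr => // t tab; exists (- (gamma * ip (v t) (v t))); last exact: dE.
  by rewrite oppr_le0 mulr_ge0 ?ip_ge0// ltW.
split=> //.
have D0 : 0 <= (c * gamma)^-1 * (E a - E b) by rewrite mulr_ge0 ?subr_ge0// ltW.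
apply/rv_norm_le; first by apply: addr_ge0 => //; lra.
suff h (sg : bool) j : (-1) ^+ sg * (x b 0 j - x a 0 j) <=
    (b - a) + (c * gamma)^-1 * (E a - E b).
  move=> j; rewrite !mxE; apply/ler_normlP; split.
    by have := h true j; rewrite expr1 mulN1r.
  by have := h false j; rewrite expr0 mul1r.
have := @der_nincr _ (fun t => (-1) ^+ sg * x t 0 j - t + (c * gamma)^-1 * E t) a b a0 ab.
suff /[swap]/[apply] : forall t, a <= t <= b -> exists2 d, d <= 0 &
  der (fun t => (-1) ^+ sg * x t 0 j - t + (c * gamma)^-1 * E t) t d by lra.
move=> t tab; have t0 : 0 <= t by lra.
exists ((-1) ^+ sg * v t 0 j - 1 + (c * gamma)^-1 * - (gamma * ip (v t) (v t))); last first.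
  apply: derD; last by apply: derZ; exact: dE.
  by apply: derB; [apply: derZ; exact: dx|exact: der_id].
have -> : (c * gamma)^-1 * - (gamma * ip (v t) (v t)) = - (ip (v t) (v t) / c).
  by field; rewrite !gt_eqF.
have h1 : `|v t| ^+ 2 <= ip (v t) (v t) / c by rewrite ler_pdivlMr// mulrC cP.
have h2 : (-1) ^+ sg * v t 0 j <= `|v t|.
  by apply: le_trans (ler_norm _) _; rewrite normrMsign rv_coord_le.
have h3 := sqr_ge0 (`|v t| - 1); have := normr_ge0 (v t).
rewrite sqrrB1 in h3; lra.
Qed.

Lemma displacement : exists2 C : R, 0 < C & forall eps x v a b, 0 < eps -> sol2 eps x v ->
  0 <= a -> a <= b ->
  `|x b - x a| <= (b - a) + C * (energy eps x v a - energy eps x v b).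
Proof.
have [C C0 CP] := young_length; exists C => // eps x v a b eps0 sol a0 ab.
apply: (CP x v _ a b a0 ab _ _).2 => t tab; first by apply: sol.1; lra.
by apply: energy_der => //; lra.
Qed.

(** Otherwise the energy would fall faster than at rate k. At time s the kinetic term eps * ip (v s)
    (v s) is at most eps * k / gamma, so that the trajectory can be restarted there as one that is
    almost at rest. *)
Lemma slow_time eps x v a b k : 0 < eps -> sol2 eps x v -> 0 <= a -> a <= b ->
  energy eps x v a - energy eps x v b < k * (b - a) ->
  exists2 s, a <= s <= b & gamma * ip (v s) (v s) <= k.
Proof.
move=> eps0 sol a0 ab Ek; apply: contrapT => nex.
have := @der_le _ (energy eps x v) a b (- k) (fun t => - (gamma * ip (v t) (v t))) a0 ab.
move=> h; have : energy eps x v b - energy eps x v a <= - k * (b - a).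
  apply: h => t tab; first by apply: energy_der => //; lra.
  rewrite lerN2 leNgt; apply/negP => lt; apply: nex; exists t => //; exact: ltW.
lra.
Qed.

End dynamics.

(** * The limit eps -> 0 *)

Lemma sqr_le_of_sum (R : realType) (g p q r : R) : 0 <= g * r -> g * r <= p + q ->
  g ^+ 2 * r ^+ 2 <= 2 * (p ^+ 2 + q ^+ 2).
Proof.
move=> r0 h; rewrite -exprMn; have : (g * r) ^+ 2 <= (p + q) ^+ 2.
  by rewrite lerXn2r ?nnegrE//; lra.
have := sqr_ge0 (p - q); rewrite sqrrB sqrrD; lra.
Qed.

Section dynamics2.
Variables (R : realType) (n : nat) (ip : {dot 'rV[R]_n for idfun}).
Variables (gamma : R) (f : 'rV[R]_n -> R) (fmin : R).
Hypotheses (g0 : 0 < gamma) (fC : C11loc ip f) (fb : forall x, fmin <= f x).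
Implicit Types (eps a b k s t T : R) (x y v w : R -> 'rV[R]_n).

Let gr := gradient ip f.
Notation sol1 := (sol1 ip gamma f).
Notation sol2 := (sol2 ip gamma f).
Notation energy := (energy ip f).

(* D = gamma (y - x) + eps w satisfies D' = grad f x - grad f y, to which
   Gronwall applies as long as y stays close to x; eps w is O(sqrt eps) by
   energy conservation. *)
Lemma converge x T eta : sol1 x -> 0 <= T -> 0 < eta -> exists2 k : R, 0 < k &
  forall eps y w, 0 < eps -> eps < k -> sol2 eps y w -> `|y 0 - x 0| < k ->
    eps * ip (w 0) (w 0) < k -> forall t, 0 <= t <= T -> `|y t - x t| < eta.
Proof.
move=> dx T0 eta0.
have [c c0 cP] := ip_ge ip; have [C C0 CP] := ip_le ip.
have [M xM] : exists M : R, forall t, 0 <= t <= T -> `|x t| <= M.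
  by apply: vder_bounded => // t /andP[t0 _]; eexists; exact: dx.
have [L L0 LP] := grad_lip fC (M + eta).
have [r1 r10 fr1] := fcont_eps fC (x 0) ltr01.
(* From f (y 0) < f (x 0) + 1 and eps * ip (w 0) (w 0) < 1: twice a bound for the initial energy
   above [fmin], hence a bound for eps * ip (w t) (w t) at all times. *)
pose B := 2 * (f (x 0) + 2 - fmin).
have B0 : 0 < B by have := fb (x 0); rewrite /B; lra.
pose a1 := 2 / (gamma ^+ 2 * c).
have a10 : 0 < a1 by rewrite divr_gt0// mulr_gt0// exprn_gt0.
pose K := C * L * (c^-1 + a1).
have K0 : 0 < K by apply: mulr_gt0; [exact: mulr_gt0|rewrite addr_gt0// invr_gt0].
pose W := 2 * C * (gamma ^+ 2 + c^-1) + B.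
have W0 : 0 < W.
  by rewrite addr_gt0// mulr_gt0 ?mulr_gt0// addr_gt0 ?exprn_gt0// invr_gt0.
(* If eps, the initial offset and the initial kinetic term are below k, Gronwall keeps the squared
   distance below Q * k; hence the threshold eta ^+ 2 / Q. *)
pose Q := a1 * W * expR (K * T).
have Q0 : 0 < Q by apply: mulr_gt0; [exact: mulr_gt0|exact: expR_gt0].
have k10 : 0 < eta ^+ 2 / Q by rewrite divr_gt0// exprn_gt0.
exists (Num.min (Num.min 1 r1) (Num.min eta (eta ^+ 2 / Q))).
  by rewrite !lt_min ltr01 r10 eta0.
move=> eps y w eps0; rewrite !lt_min => /andP[/andP[eps1 _] /andP[_ eps3]] sol.
move=> /andP[/andP[y01 y02] /andP[y04 y03]] /andP[/andP[w01 _] /andP[_ w03]].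
have [dy dw] := sol.
have kin t : 0 <= t -> eps * ip (w t) (w t) <= B.
  move=> t0; apply: le_trans (kinetic_le g0 fC fb eps0 sol t0) _.
  have /ltr_normlP[_ h] := fr1 _ y02.
  have -> : energy eps y w 0 = f (y 0) + (eps * ip (w 0) (w 0)) / 2.
    by rewrite /energy; field.
  rewrite /B; lra.
have epsw t : 0 <= t -> c * (eps * `|w t|) ^+ 2 <= eps * B.
  move=> t0; apply: le_trans (ler_wpM2l (ltW eps0) (kin t t0)).
  have -> : c * (eps * `|w t|) ^+ 2 = eps * (eps * (c * `|w t| ^+ 2)) by ring.
  by do 2 (apply: ler_wpM2l; first exact: ltW); exact: cP.
pose D t := gamma *: y t + eps *: w t + (- gamma) *: x t.
have dD t : 0 <= t -> vder D t (gr (x t) - gr (y t)).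
  move=> t0.
  have := vder_add (vder_add (vder_scale gamma (dy t t0)) (vder_scale eps (dw t t0)))
    (vder_scale (- gamma) (dx t t0)).
  congr vder; rewrite !scalerA mulrN mulfV ?gt_eqF// mulrN mulNr opprK mulfV ?gt_eqF//.
  by rewrite scale1r scaleN1r opprD addrA subrr add0r addrC.
(* The constant eps * B absorbs the term eps w of D: thanks to it u dominates |y - x|^2 up to a
   factor, which closes the Gronwall inequality. *)
pose u t := ip (D t) (D t) + eps * B.
have dist_u t : 0 <= t -> `|y t - x t| ^+ 2 <= a1 * u t.
  move=> t0; rewrite /a1 mulrAC ler_pdivlMr; last by rewrite mulr_gt0// exprn_gt0.
  have h1 : gamma * `|y t - x t| <= `|D t| + eps * `|w t|.
    have -> : gamma * `|y t - x t| = `|D t - eps *: w t|.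
      have -> : D t - eps *: w t = gamma *: (y t - x t).
        by rewrite /D scalerBr scaleNr addrAC addrK.
      by rewrite normrZ gtr0_norm.
    have -> : eps * `|w t| = `|eps *: w t| by rewrite normrZ gtr0_norm.
    exact: ler_normB.
  have h2 := sqr_le_of_sum (mulr_ge0 (ltW g0) (normr_ge0 _)) h1.
  have h3 := epsw t t0; have h4 := cP (D t).
  have := ler_wpM2l (ltW c0) h2; rewrite /u.
  have -> : c * (2 * (`|D t| ^+ 2 + (eps * `|w t|) ^+ 2)) =
    2 * (c * `|D t| ^+ 2) + 2 * (c * (eps * `|w t|) ^+ 2) by ring.
  have -> : `|y t - x t| ^+ 2 * (gamma ^+ 2 * c) = c * (gamma ^+ 2 * `|y t - x t| ^+ 2) by ring.
  lra.
have u0 : u 0 <= Num.max (eps * ip (w 0) (w 0)) (Num.max eps `|y 0 - x 0|) * W.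
  set k := Num.max _ _.
  have [k1 k2 k3] : [/\ eps * ip (w 0) (w 0) <= k, eps <= k & `|y 0 - x 0| <= k].
    by rewrite /k !le_max !lexx !orbT.
  have k1' : k < 1 by rewrite /k !gt_max w01 eps1 y01.
  have k0 : 0 < k by exact: lt_le_trans eps0 k2.
  have h1 : ip (D 0) (D 0) <= C * `|D 0| ^+ 2.
    by apply: le_trans (ler_norm _) _; rewrite expr2 mulrA.
  have h2 : 1 * `|D 0| <= gamma * `|y 0 - x 0| + eps * `|w 0|.
    have -> : D 0 = gamma *: (y 0 - x 0) + eps *: w 0.
      by rewrite /D scalerBr scaleNr addrAC.
    rewrite mul1r; apply: le_trans (ler_normD _ _) _.
    by rewrite !normrZ !gtr0_norm.
  have h3 : `|D 0| ^+ 2 <= 2 * ((gamma * `|y 0 - x 0|) ^+ 2 + (eps * `|w 0|) ^+ 2).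
    by have := sqr_le_of_sum (mulr_ge0 ler01 (normr_ge0 _)) h2; rewrite expr1n mul1r.
  have h4 : (gamma * `|y 0 - x 0|) ^+ 2 <= gamma ^+ 2 * k.
    rewrite exprMn ler_wpM2l ?sqr_ge0// expr2 -[leRHS]mul1r ler_pM//.
    by rewrite (le_trans k3)// ltW.
  have h5 : (eps * `|w 0|) ^+ 2 <= c^-1 * k.
    have -> : (eps * `|w 0|) ^+ 2 = eps * (eps * `|w 0| ^+ 2) by ring.
    have : eps * (eps * `|w 0| ^+ 2) <= 1 * (eps * `|w 0| ^+ 2).
      by apply: ler_wpM2r; [rewrite mulr_ge0 ?sqr_ge0// ltW|exact: ltW].
    rewrite mul1r => /le_trans; apply.
    rewrite -(ler_pM2l c0) [leRHS]mulrA mulfV ?gt_eqF// mul1r; apply: le_trans k1.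
    rewrite mulrCA; apply: ler_wpM2l; [exact: ltW|exact: cP].
  have h6 : eps * B <= k * B by apply: ler_wpM2r => //; exact: ltW.
  have h7 : C * `|D 0| ^+ 2 <= C * (2 * (gamma ^+ 2 * k + c^-1 * k)).
    by apply: ler_wpM2l; [exact: ltW|lra].
  rewrite /u /W.
  have -> : k * (2 * C * (gamma ^+ 2 + c^-1) + B) =
    C * (2 * (gamma ^+ 2 * k + c^-1 * k)) + k * B by ring.
  lra.
have uQ : a1 * (u 0 * expR (K * T)) < eta ^+ 2.
  apply: (@le_lt_trans _ _ (Num.max (eps * ip (w 0) (w 0)) (Num.max eps `|y 0 - x 0|) * Q)).
    rewrite /Q; have := ler_wpM2r (expR_ge0 (K * T)) u0.
    move=> /(ler_wpM2l (ltW a10)) /le_trans; apply; rewrite le_eqVlt; apply/orP; left.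
    by apply/eqP; ring.
  by rewrite -ltr_pdivlMr// !gt_max w03 eps3 y03.
have close t : 0 <= t <= T -> (forall s, 0 <= s <= t -> `|y s - x s| <= eta) ->
    `|y t - x t| < eta.
  move=> /andP[t0 tT] near.
  have ut : u t <= u 0 * expR (K * t).
    apply: (@gronwall _ u K t (fun s => ip (gr (x s) - gr (y s)) (D s) +
      ip (D s) (gr (x s) - gr (y s)) + 0)) => // s st.
      have s0 : 0 <= s by lra.
      by apply: derD; [apply: der_ip; exact: dD|exact: der_cst].
    have s0 : 0 <= s by lra.
    have sT : 0 <= s <= T by lra.
    have xs := xM s sT.
    have ys : `|y s| <= M + eta.
      have -> : y s = x s + (y s - x s) by rewrite addrC subrK.
      by apply: le_trans (ler_normD _ _) _; apply: lerD => //; exact: near.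
    have gxy := LP (x s) (y s) ltac:(lra) ys; rewrite [`|x s - y s|]distrC in gxy.
    have h1 : ip (D s) (gr (x s) - gr (y s)) <= C * `|D s| * (L * `|y s - x s|).
      apply: le_trans (ler_norm _) _; apply: le_trans (CP _ _) _.
      by apply: ler_wpM2l => //; rewrite mulr_ge0// ltW.
    rewrite addr0 ip_sym.
    have h2 := dist_u s s0; have h3 := cP (D s).
    have h4 : `|D s| ^+ 2 <= c^-1 * u s.
      rewrite -(ler_pM2l c0) [leRHS]mulrA mulfV ?gt_eqF// mul1r /u.
      by apply: le_trans h3 _; rewrite lerDl mulr_ge0// ltW.
    have h5 := sqr_ge0 (`|D s| - `|y s - x s|).
    rewrite sqrrB addrAC -mulr_natl subr_ge0 in h5.
    have h6 : C * L * (2 * (`|D s| * `|y s - x s|)) <= C * L * ((c^-1 + a1) * u s).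
      apply: ler_wpM2l; first by rewrite mulr_ge0// ltW.
      by rewrite [leRHS]mulrDl; apply: le_trans h5 (lerD h4 h2).
    rewrite /K -mulrA; apply: le_trans h6.
    have -> : C * L * (2 * (`|D s| * `|y s - x s|)) =
      C * `|D s| * (L * `|y s - x s|) + C * `|D s| * (L * `|y s - x s|) by ring.
    exact: lerD.
  have : `|y t - x t| ^+ 2 < eta ^+ 2.
    apply: le_lt_trans (dist_u t t0) _; apply: le_lt_trans uQ.
    apply: ler_wpM2l; first exact: ltW.
    apply: le_trans ut _; apply: ler_wpM2l.
      by rewrite /u addr_ge0 ?ip_ge0// mulr_ge0// ltW.
    by rewrite ler_expR ler_wpM2l// ltW.
  by rewrite ltr_pXn2r ?nnegrE ?normr_ge0 ?(ltW eta0).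
move=> t /andP[t0 tT]; rewrite ltNge; apply/negP => far.
have [s sT d d0|s [/andP[s0 st] ys ysl]] := first_hit t0 (u := fun s => `|y s - x s|) y04 far.
  have s0 : 0 <= s by lra.
  have [r r0 rP] := vder_cont (vder_add (dy s s0) (vder_scale (-1) (dx s s0))) d0.
  exists r => // q qt sr; have q0 : 0 <= q by lra.
  have := rP q q0 sr; rewrite !scaleN1r.
  by apply: le_lt_trans; exact: ler_dist_dist.
have : `|y s - x s| < eta.
  apply: close => [|q /andP[q0 qs]]; first by rewrite ltW//= (le_trans st).
  by move: qs; rewrite le_eqVlt => /predU1P[->|qs]; [rewrite ys|apply/ltW/ysl; rewrite q0].
by rewrite ys ltxx.
Qed.

(** * Existence of global solutions, and translation of the solution notions of the statement *)

Lemma sol1_exists (x0 : 'rV[R]_n) : exists x, x 0 = x0 /\ sol1 x.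
Proof.
apply: (@ode_global _ _ (fun p => - gamma^-1 *: gr p)) => [r|T T0].
  have [L L0 LP] := grad_lip fC r; exists (gamma^-1 * L) => [|p q pr qr].
    by rewrite mulr_gt0// invr_gt0.
  rewrite -scalerBr normrZ normrN gtr0_norm ?invr_gt0// -mulrA.
  by apply: ler_wpM2l; [rewrite invr_ge0 ltW|exact: LP].
(* The a priori bound: with f along y as energy, the displacement up to T' is at most T plus a
   multiple of the possible descent f x0 - fmin. *)
have [C C0 CP] := young_length ip g0.
exists (`|x0| + (T + C * (f x0 - fmin))) => y T' y0 /andP[T'0 T'T] dy.
have [|_ ] := CP y (fun t => - gamma^-1 *: gr (y t)) (fun t => f (y t)) 0 T' (lexx 0) T'0 dy.
  move=> t /dy /(der_f fC); congr der.
  rewrite -/gr; set g := gr (y t); set k := - gamma^-1.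
  have h1 : ip g (k *: g) = k * ip g g by rewrite linearZ.
  have h2 : ip (k *: g) (k *: g) = k * (k * ip g g) by rewrite linearZ /= ip_sym h1.
  by rewrite h2 h1 /k; field; rewrite gt_eqF.
rewrite y0 subr0 => h.
have -> : y T' = x0 + (y T' - x0) by rewrite addrC subrK.
apply: le_trans (ler_normD _ _) _; rewrite lerD2l; apply: le_trans h _; apply: lerD => //.
by apply: ler_wpM2l; [exact: ltW|rewrite lerD2l lerN2].
Qed.

Lemma row_mx_le m (r : R) (p : 'rV[R]_n) (q : 'rV[R]_m) : 0 <= r -> `|p| <= r -> `|q| <= r ->
  `|row_mx p q| <= r.
Proof.
move=> r0 pr qr; apply/rv_norm_le => // j; rewrite mxE.
by case: splitP => k _; apply: le_trans (rv_coord_le _ k) _.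
Qed.

Lemma lsubmx_le (p : 'rV[R]_(n + n)) : `|lsubmx p| <= `|p|.
Proof. by apply/rv_norm_le => // j; rewrite mxE rv_coord_le. Qed.

Lemma rsubmx_le (p : 'rV[R]_(n + n)) : `|rsubmx p| <= `|p|.
Proof. by apply/rv_norm_le => // j; rewrite mxE rv_coord_le. Qed.

(** A first-order system for the pair of position and velocity. A priori, the energy bounds the
    velocity directly and the position through [young_length]. *)
Lemma sol2_exists eps (x0 v0 : 'rV[R]_n) : 0 < eps ->
  exists x v, [/\ x 0 = x0, v 0 = v0 & sol2 eps x v].
Proof.
move=> eps0.
pose G (p : 'rV[R]_(n + n)) := row_mx (rsubmx p)
  (- eps^-1 *: (gamma *: rsubmx p + gr (lsubmx p))).
have dxv (y : R -> 'rV[R]_(n + n)) t : vder y t (G (y t)) -> vder (fun t => lsubmx (y t)) t (rsubmx (y t)) /\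
    vder (fun t => rsubmx (y t)) t
      (- eps^-1 *: (gamma *: rsubmx (y t) + gr (lsubmx (y t)))).
  move=> dy; split=> j.
      have := dy (lshift n j); rewrite row_mxEl.
    by rewrite (_ : (fun t => lsubmx _ _ _) = fun t => y t 0 (lshift n j))//;
      apply/funext => s; rewrite mxE.
  have := dy (rshift n j); rewrite row_mxEr.
  by rewrite (_ : (fun t => rsubmx _ _ _) = fun t => y t 0 (rshift n j))//;
    apply/funext => s; rewrite mxE.
have [c c0 cP] := ip_ge ip; have [C C0 CP] := young_length ip g0.
have [||y [y0 dy]] := @ode_global _ _ G (row_mx x0 v0).
- move=> r; have [L L0 LP] := grad_lip fC r.
  exists (1 + eps^-1 * (gamma + L)).
    by rewrite addr_gt0// mulr_gt0 ?invr_gt0// addr_gt0.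
  move=> p q pr qr; rewrite /G opp_row_mx add_row_mx.
  have e0 : 0 <= eps^-1 by rewrite invr_ge0 ltW.
  have lpq := lsubmx_le (p - q); have rpq := rsubmx_le (p - q).
  rewrite !linearB /= in lpq rpq.
  have pq0 : 0 <= `|p - q| by exact: normr_ge0.
  have eq0 : 0 <= eps^-1 * (gamma + L) by rewrite mulr_ge0// addr_ge0// ltW.
  apply: row_mx_le; first by apply: mulr_ge0 => //; rewrite addr_ge0.
    by apply: le_trans rpq _; rewrite ler_peMl// lerDl.
  rewrite -scalerBr normrZ normrN ger0_norm//.
  apply: (@le_trans _ _ (eps^-1 * (gamma + L) * `|p - q|)); last first.
    by apply: ler_wpM2r => //; lra.
  rewrite -mulrA; apply: ler_wpM2l => //.
  rewrite opprD addrACA -scalerBr mulrDl; apply: le_trans (ler_normD _ _) _; apply: lerD.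
    by rewrite normrZ gtr0_norm//; apply: ler_wpM2l => //; exact: ltW.
  apply: le_trans (LP _ _ (le_trans (lsubmx_le _) pr) (le_trans (lsubmx_le _) qr)) _.
  by apply: ler_wpM2l => //; exact: ltW.
- move=> T T0; pose E0 := f x0 + eps / 2 * ip v0 v0.
  have E0f : 0 <= E0 - fmin.
    rewrite subr_ge0 /E0; apply: le_trans (fb x0) _; rewrite lerDl mulr_ge0 ?ip_ge0//.
    by rewrite divr_ge0// ltW.
  (* From |v| <= 1 + |v|^2 and the energy bound on |v|^2. *)
  pose V := 1 + 2 * (E0 - fmin) / (eps * c).
  have V1 : 1 <= V by rewrite lerDl divr_ge0 ?mulr_ge0// ltW.
  pose X := `|x0| + (T + C * (E0 - fmin)).
  have X0 : 0 <= X by rewrite !addr_ge0// mulr_ge0// ltW.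
  exists (X + V) => y T' y0 /andP[T'0 T'T] dy.
  pose x t := lsubmx (y t); pose v t := rsubmx (y t).
  have dx t : 0 <= t <= T' -> vder x t (v t) by move=> /dy/dxv[].
  have dE t : 0 <= t <= T' -> der (energy eps x v) t (- (gamma * ip (v t) (v t))).
    by move=> /dy/dxv[]; exact: energy_der_at.
  have [ET' xT'] := CP x v _ 0 T' (lexx 0) T'0 dx dE.
  have E00 : energy eps x v 0 = E0.
    by rewrite /energy /x /v y0 row_mxKl row_mxKr.
  have fT' : fmin <= energy eps x v T' by exact: energy_ge.
  rewrite E00 in ET' xT'.
  rewrite -[y T']hsubmxK; apply: row_mx_le; first by rewrite addr_ge0//; lra.
    apply: (@le_trans _ _ X); last by lra.
    have -> : lsubmx (y T') = x0 + (x T' - x 0).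
      by rewrite /x y0 row_mxKl addrC subrK.
    apply: le_trans (ler_normD _ _) _; rewrite lerD2l; apply: le_trans xT' _.
    rewrite subr0; apply: lerD => //; apply: ler_wpM2l; first exact: ltW.
    by rewrite lerD2l lerN2.
  apply: (@le_trans _ _ V); last by lra.
  have h1 : eps / 2 * ip (v T') (v T') <= E0 - fmin.
    by move: ET'; rewrite /energy; have := fb (x T'); lra.
  have h2 : `|v T'| ^+ 2 <= 2 * (E0 - fmin) / (eps * c).
    rewrite ler_pdivlMr ?mulr_gt0//.
    have := ler_wpM2l (ltW eps0) (cP (v T')).
    have -> : eps * ip (v T') (v T') = 2 * (eps / 2 * ip (v T') (v T')) by field.
    have -> : `|v T'| ^+ 2 * (eps * c) = eps * (c * `|v T'| ^+ 2) by ring.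
    lra.
  rewrite -/(v T'); have := sqr_ge0 (`|v T'| - 1); rewrite sqrrB1 /V.
  have := normr_ge0 (v T'); lra.
exists (fun t => lsubmx (y t)), (fun t => rsubmx (y t)).
rewrite y0 row_mxKl row_mxKr; split=> //.
by split=> t t0; have [] := dxv y t (dy t t0).
Qed.

Lemma first_order_solutionP (x0 : 'rV[R]_n) x :
  first_order_solution ip f gamma x0 x <-> x 0 = x0 /\ sol1 x.
Proof.
split=> [[x' [dx ode x00]]|[x00 dx]].
  split=> // t t0; have /(has_deriv_ge0P _ _ t0) := dx t t0.
  congr vder; have /eqP := ode t t0; rewrite addr_eq0 => /eqP h.
  by rewrite -/gr in h; rewrite scaleNr -scalerN -h scalerA mulVf ?gt_eqF// scale1r.
exists (fun t => - gamma^-1 *: gr (x t)); split=> // t t0.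
  by apply/has_deriv_ge0P => //; exact: dx.
by rewrite scalerA mulrN mulfV ?gt_eqF// scaleN1r addNr.
Qed.

Lemma second_order_solutionP eps (x0 v0 : 'rV[R]_n) x : 0 < eps ->
  second_order_solution ip f gamma eps x0 v0 x <->
  exists v, [/\ x 0 = x0, v 0 = v0 & sol2 eps x v].
Proof.
move=> eps0; split=> [[x' [x'' [dx dx' ode x00 v00]]]|[v [x00 v00 [dx dv]]]].
  exists x'; split=> //; split=> t t0; first by apply/has_deriv_ge0P => //; exact: dx.
  have /(has_deriv_ge0P _ _ t0) := dx' t t0.
  congr vder; have /eqP := ode t t0; rewrite -addrA addr_eq0 => /eqP h.
  by rewrite -/gr in h; rewrite scaleNr -scalerN -h scalerA mulVf ?gt_eqF// scale1r.
exists v, (fun t => - eps^-1 *: (gamma *: v t + gr (x t))); split=> // t t0.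
- by apply/has_deriv_ge0P => //; exact: dx.
- by apply/has_deriv_ge0P => //; exact: dv.
- by rewrite scalerA mulrN mulfV ?gt_eqF// scaleN1r -addrA addNr.
Qed.

End dynamics2.

(** * Critical values and the energy function *)

Lemma delta_norm_le (R : realType) n (j : 'I_n) (h : R) :
  `|h *: (delta_mx 0 j : 'rV[R]_n)| <= `|h|.
Proof.
apply/rv_norm_le => // i; rewrite !mxE eqxx /=.
by case: (i == j); rewrite ?mulr1// mulr0 normr0.
Qed.

Section kl_energy.
Variables (R : realType) (n : nat) (ip : {dot 'rV[R]_n for idfun}) (f : 'rV[R]_n -> R).
Variable (S : forall k : nat, set (set 'rV[R]_k)).
Hypotheses (HS : o_minimal_structure S) (Sf : definable_in S f) (fC : C11loc ip f).

Let gr := gradient ip f.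
Let fd := fdiff fC.

Lemma diffZr (x : 'rV[R]_n) (h : R) (v : 'rV[R]_n) : 'd f x (h *: v) = 'd f x v * h.
Proof. by rewrite linearZ mulrC. Qed.

(** The right-hand side involves only values of f and quantifiers over reals; this makes the partial
    derivatives definable. *)
Lemma partialP (x : 'rV[R]_n) (j : 'I_n) (d : R) :
  d = 'd f x (delta_mx 0 j) <->
  forall eta : R, 0 < eta -> exists r : R, 0 < r /\ forall h : R, `|h| <= r ->
    `|f (x + h *: delta_mx 0 j) - f x - d * h| <= eta * `|h|.
Proof.
split=> [-> eta eta0|hd].
  have [r r0 rP] := diff_eps (fd x) eta0.
  exists (r / 2); split=> [|h hr]; first by lra.
  have hj := delta_norm_le j h.
  have := rP (x + h *: delta_mx 0 j); rewrite addrAC subrr add0r => /(_ ltac:(lra)).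
  rewrite diffZr => /le_trans; apply.
  by apply: ler_wpM2l => //; exact: ltW.
apply/eqP; rewrite -subr_eq0 -normr_le0; apply/ler_addgt0Pr => e e0; rewrite add0r.
have e20 : 0 < e / 2 by lra.
have [r [r0 rP]] := hd _ e20; have [r' r'0 rP'] := diff_eps (fd x) e20.
pose h := Num.min r (r' / 2).
have h0 : 0 < h by rewrite lt_min r0 /=; lra.
have hr : h <= r by rewrite ge_min lexx.
have hr' : h <= r' / 2 by rewrite ge_min lexx orbT.
have hn : `|h| = h by rewrite gtr0_norm.
have h1 := rP h; rewrite hn in h1; have {}h1 := h1 hr.
have hj := delta_norm_le j h; rewrite hn in hj.
have := rP' (x + h *: delta_mx 0 j); rewrite addrAC subrr add0r => /(_ ltac:(lra)).
rewrite diffZr => h2.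
have h3 : e / 2 * `|h *: (delta_mx 0 j : 'rV[R]_n)| <= e / 2 * h by apply: ler_wpM2l => //; lra.
rewrite -(ler_pM2r h0) -[X in _ * X <= _]hn -normrM.
set A := f _ - f x in h1 h2; set b := 'd f x _ in h2 *.
have -> : (d - b) * h = (A - b * h) - (A - d * h) by ring.
apply: le_trans (ler_normB _ _) _.
have -> : e * h = e / 2 * h + e / 2 * h by field.
by apply: lerD => //; apply: le_trans h2 h3.
Qed.

Lemma dfun_partial (j : 'I_n) : dfun S (fun e => 'd f (\row_i e i) (delta_mx 0 j)).
Proof.
have Tv i : dfun S (fun e => e i) by exact: dfun_var.
have Tf := dfun_fun HS Sf.
pose P (eta : R) (e : nat -> R) := 0 < eta -> exists r : R, 0 < r /\ forall h : R, `|h| <= r ->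
    `|f (\row_(i < n) e i.+1 + h *: delta_mx 0 j) - f (\row_(i < n) e i.+1) - e 0%N * h| <= eta * `|h|.
apply: (dpred_ext (P := fun e => forall eta, P eta e)); last first.
  apply: dpred_all => //; apply: dpred_imp => //; first exact: (dpred_lt HS (dfun_const HS 0) (Tv 0%N)).
  apply: (dpred_ex HS (Q := fun r e => 0 < r /\ forall h : R, `|h| <= r ->
    `|f (\row_(i < n) e i.+2 + h *: delta_mx 0 j) - f (\row_(i < n) e i.+2) - e 1%N * h| <=
    e 0%N * `|h|)).
  apply: dpred_and => //; first exact: (dpred_lt HS (dfun_const HS 0) (Tv 0%N)).
  apply: (dpred_all HS (Q := fun h e => `|h| <= e 0%N ->
    `|f (\row_(i < n) e i.+3 + h *: delta_mx 0 j) - f (\row_(i < n) e i.+3) - e 2%N * h| <=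
    e 1%N * `|h|)).
  apply: dpred_imp => //; first exact: dpred_normle.
  apply: dpred_normle => //; last by apply: dfun_mul => //; exact: dfun_abs.
  apply: dfun_add => //; last by apply: dfun_opp => //; exact: dfun_mul.
  apply: dfun_add => //; last by apply: dfun_opp => //; exact: (dfun_comp HS (t := fun i e => e i.+4) Tf).
  have := dfun_comp HS (t := fun i e => e i.+4 + e 0%N * (i == j)%:R) Tf.
  have h i : dfun S (fun e => e (nat_of_ord i).+4 + e 0%N * (i == j)%:R).
    by apply: dfun_add => //; apply: dfun_mul => //; exact: dfun_const.
  move=> /(_ h); apply: dpred_ext => e.
  suff -> : \row_(i < n) (e i.+4.+1 + e 1%N * (i == j)%:R) =
    \row_(i < n) e i.+4.+1 + e 1%N *: delta_mx 0 j by [].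
  by apply/rowP => i; rewrite !mxE eqxx.
by move=> e; rewrite partialP; split=> h eta; exact: h.
Qed.

(** The energy as a function of the position and of s = sqrt (eps * ip v v), stored as last
    coordinate; eps no longer appears. *)
Definition fE (p : 'rV[R]_(n + 1)) := f (lsubmx p) + p 0 (rshift n 0) ^+ 2 / 2.
(** The norm of the differential of [fE] that is dual to the max norm. *)
Definition mE (p : 'rV[R]_(n + 1)) :=
  \sum_j `|'d f (lsubmx p) (delta_mx 0 j)| + `|p 0 (rshift n 0)|.

Lemma lsub_row (e : nat -> R) : lsubmx (\row_(i < n + 1) e i) = \row_(i < n) e i.
Proof. by apply/rowP => i; rewrite !mxE. Qed.

Lemma dfun_fE : dfun S (fun e => fE (\row_i e i)).
Proof.
have Tf := dfun_fun HS Sf; have Tn : dfun S (fun e => e n) by exact: dfun_var.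
have := dfun_add HS Tf (dfun_mul HS (dfun_mul HS Tn Tn) (dfun_const HS 2^-1)).
by apply: dpred_ext => e; rewrite /fE (lsub_row (fun i => e i.+1)) !mxE /= addn0 expr2.
Qed.

Lemma dfun_mE : dfun S (fun e => mE (\row_i e i)).
Proof.
have Tn : dfun S (fun e => e n) by exact: dfun_var.
have := dfun_add HS (dfun_sum HS (fun j => dfun_abs HS (dfun_partial j))) (dfun_abs HS Tn).
by apply: dpred_ext => e; rewrite /mE (lsub_row (fun i => e i.+1)) !mxE /= addn0.
Qed.

Lemma lsub_comp_continuous (g : 'rV[R]_n -> R) :
  continuous g -> continuous (fun p : 'rV[R]_(n + 1) => g (lsubmx p)).
Proof.
by move=> cg p; apply: (@continuous_comp _ _ _ lsubmx g p);
  [exact: continuous_lsubmx|exact: cg].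
Qed.

Lemma fE_continuous : continuous fE.
Proof.
move=> p; have c := @coord_continuous R 1 (n + 1) 0 (rshift n 0) p.
exact: (cvgD (lsub_comp_continuous (fcont fC) (x:=p)) (cvgM (cvgM c c) (cvg_cst (2^-1 : R)))).
Qed.

Lemma partial_continuous (j : 'I_n) : continuous (fun x => 'd f x (delta_mx 0 j)).
Proof.
have gc : continuous gr by have [] := fC.
have -> : (fun x => 'd f x (delta_mx 0 j)) = fun x =>
    \sum_i \sum_k gr x 0 i * ((delta_mx 0 j : 'rV[R]_n) 0 k * ip (delta_mx 0 i) (delta_mx 0 k)).
  apply/funext => x; rewrite (gradientP ip) ip_sum.
  by apply: eq_bigr => i _; apply: eq_bigr => k _; rewrite mulrA.
apply: (@continuous_big _ _ _ _ _ add_continuous) => i _.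
apply: (@continuous_big _ _ _ _ _ add_continuous) => k _ x.
have h : {for x, continuous (fun x => gr x 0 i)}.
  apply: (@continuous_comp _ _ _ gr (fun y : 'rV[R]_n => y 0 i)); first exact: gc.
  exact: coord_continuous.
exact: (cvgM h (cvg_cst _)).
Qed.

Lemma mE_continuous : continuous mE.
Proof.
move=> p; have c := @coord_continuous R 1 (n + 1) 0 (rshift n 0) p.
apply: (@cvgD _ _ _ _ _ _ _ _ _ _ (cvg_norm c)).
move: p {c}; apply: (@continuous_big _ _ _ _ _ add_continuous) => j _ p.
exact: (cvg_norm (lsub_comp_continuous (@partial_continuous j) (x:=p))).
Qed.

Lemma mE_ge0 p : 0 <= mE p.
Proof. by rewrite addr_ge0 ?sumr_ge0. Qed.

Lemma fE_slope k : slope_bound mE k fE.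
Proof.
move=> p _ eta eta0; have eta20 : 0 < eta / 2 by lra.
have [r r0 rP] := diff_eps (fd (lsubmx p)) eta20.
exists (Num.min r eta); first by rewrite lt_min r0.
move=> q; rewrite lt_min => /andP[qr qeta].
have lpq : `|lsubmx q - lsubmx p| <= `|q - p|.
  by rewrite -linearB; apply/rv_norm_le => // j; rewrite mxE rv_coord_le.
have spq := rv_coord_le (q - p) (rshift n 0); rewrite !mxE in spq.
have h1 := rP _ (le_lt_trans lpq qr).
have h2 := diff_lin_le f (lsubmx p) (lsubmx q - lsubmx p).
rewrite /fE /mE; set x := lsubmx p in lpq h1 h2 *; set y := lsubmx q in lpq h1 h2 *.
set s := p 0 _ in spq *; set t := q 0 _ in spq *; set h := `|q - p| in qeta lpq spq *.
set D := \sum_j _ in h2 *.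
have D0 : 0 <= D by exact: sumr_ge0.
have h0 : 0 <= h by exact: normr_ge0.
have -> : f y + t ^+ 2 / 2 - (f x + s ^+ 2 / 2) =
  (f y - f x - 'd f x (y - x)) + ('d f x (y - x) + (t - s) * (s + (t - s) / 2)) by field.
apply: le_trans (ler_normD _ _) _.
have n1 : eta / 2 * `|y - x| <= eta / 2 * h by apply: ler_wpM2l => //; lra.
have n2 : D * `|y - x| <= D * h by exact: ler_wpM2l.
have n3 : `|(t - s) * (s + (t - s) / 2)| <= h * (`|s| + eta / 2).
  rewrite normrM; apply: ler_pM => //; apply: le_trans (ler_normD _ _) _.
  by rewrite lerD2l normrM [`|2^-1|]ger0_norm//; lra.
have n4 := ler_normD ('d f x (y - x)) ((t - s) * (s + (t - s) / 2)).
have -> : (D + `|s| + eta) * h = eta / 2 * h + (D * h + h * (`|s| + eta / 2)) by field.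
lra.
Qed.

Lemma kl_fE k z : 0 <= k -> exists d (psi : R -> R), [/\ 0 < d,
  forall s t, z - d < s -> s <= t -> t < z + d -> psi s <= psi t,
  forall zeta : R, 0 < zeta ->
    exists r, 0 < r < d /\ psi (z + r) - psi (z - r) < zeta &
  forall a b mu, z - d < a -> a <= b -> b < z + d -> 0 <= mu ->
    attained mE k fE mu a b -> b - a <= mu * (psi b - psi a)].
Proof.
move=> k0; apply: (kurdyka_lojasiewicz HS dfun_mE mE_continuous k0 mE_ge0).
- exact: dfun_fE.
- exact: fE_continuous.
- exact: fE_slope.
Qed.

Definition crit_value t := exists x, gr x = 0 /\ f x = t.

Lemma grad_eq0 x : gr x = 0 <-> forall j, 'd f x (delta_mx 0 j) = 0.
Proof.
split=> [g0 j|h]; first by rewrite (gradientP ip) -/gr g0 ip_sym linear0.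
have : ip (gr x) (gr x) = 0.
  rewrite -(gradientP ip) {1}(row_sum_delta (gr x)) linear_sum big1// => j _.
  by rewrite linearZ /= h scaler0.
move=> ip0; apply/eqP/negPn/negP => gx0.
have : 0 < ip (gr x) (gr x) by exact: neq0_dnorm_gt0.
by rewrite ip0 ltxx.
Qed.

Lemma sard_box k a b : 0 <= k -> a < b ->
  ~ (forall t, a <= t <= b -> exists x, [/\ `|x| <= k, gr x = 0 & f x = t]).
Proof.
move=> k0 ab h.
apply: (sard HS dfun_mE mE_continuous k0 mE_ge0 dfun_fE fE_continuous (@fE_slope k) ab).
move=> tau /h[x [xk gx fx]]; exists (row_mx x 0).
rewrite /fE /mE row_mxKl row_mxEr mxE expr0n mul0r addr0 normr0 addr0; split=> //.
  apply/rv_norm_le => // j; rewrite mxE; case: splitP => i _.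
    exact: le_trans (rv_coord_le _ i) xk.
  by rewrite mxE normr0.
by rewrite big1// => j _; move/grad_eq0 : gx => ->; rewrite normr0.
Qed.

Lemma dpred_crit : dpred S (fun e => crit_value (e 0%N)).
Proof.
have Tv i : dfun S (fun e => e i) by exact: dfun_var.
apply: (dpred_exrv HS (Q := fun x e => gr x = 0 /\ f x = e 0%N)).
apply: dpred_and => //; last by apply: dpred_eq => //; exact: dfun_fun.
have : dpred S (fun e => forall j : 'I_n, 'd f (\row_i e i) (delta_mx 0 j) = 0).
  by apply: dpred_forall => // j; apply: dpred_eq => //; [exact: dfun_partial|exact: dfun_const].
by apply: dpred_ext => e; rewrite grad_eq0.
Qed.

Lemma dpred_crit_box (k : R) : 0 <= k ->
  dpred S (fun e => exists x, [/\ `|x| <= k, gr x = 0 & f x = e 0%N]).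
Proof.
move=> k0; have Tv i : dfun S (fun e => e i) by exact: dfun_var.
have Dk : dpred S (fun e => `|\row_(i < n) e i| <= k).
  have := @dpred_forall _ _ HS _ _ (fun i : 'I_n => dpred_normle HS (Tv i) (dfun_const HS k)).
  apply: dpred_ext => e; split=> [h|/(rv_norm_le _ k0) h i]; last by have := h i; rewrite mxE.
  by apply/rv_norm_le => // i; rewrite mxE.
have Dg : dpred S (fun e => forall j : 'I_n, 'd f (\row_i e i) (delta_mx 0 j) = 0).
  by apply: dpred_forall => // j; apply: dpred_eq => //; [exact: dfun_partial|exact: dfun_const].
apply: (dpred_exrv HS (Q := fun x e => [/\ `|x| <= k, gr x = 0 & f x = e 0%N])).
have := dpred_and HS Dk (dpred_and HS Dg (dpred_eq HS (dfun_fun HS Sf) (Tv (n + 0)%N))).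
by apply: dpred_ext => e; rewrite -grad_eq0; split=> [[? []]|[]].
Qed.

(** For critical points of norm at most k, [sard_box] excludes that all values just above v are
    critical; by [germ] there are then none, and each critical value of the ball is isolated on its
    right. *)
Lemma crit_countable : countable crit_value.
Proof.
pose C (k : nat) := [set t | exists x, [/\ `|x| <= k%:R, gr x = 0 & f x = t]].
apply: (@sub_countable _ _ _ (\bigcup_k C k)).
  apply: subset_card_le => t [x [gx fx]]; exists (Num.truncn `|x|).+1 => //.
  by exists x; split=> //; rewrite ltW// truncnS_gt.
apply: bigcup_countable => // k _; apply: right_isolated_countable => v Cv.
have k0 : 0 <= k%:R :> R by exact: ler0n.
have [d d0 [full|none]] := @germ _ _ HS (C k) v (dpred_crit_box k0).
  have ab : v + d / 3 < v + d / 2 by lra.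
  by exfalso; apply: (sard_box k0 ab) => t tab; apply: full; lra.
exists (v + d); first by rewrite ltrDl.
by move=> y Cy vy; rewrite leNgt; apply/negP => yd; apply: (none y); rewrite ?vy.
Qed.

(** Here the critical points range over the whole space, where [sard_box] says nothing; an interval
    of critical values is excluded by countability instead. *)
Lemma crit_isolated v : exists2 d : R, 0 < d & forall t, v < t < v + d -> ~ crit_value t.
Proof.
have [d d0 [full|none]] := @germ _ _ HS crit_value v dpred_crit; last by exists d.
have vd : v < v + d by rewrite ltrDl.
exfalso; apply: (countable_no_itv crit_countable vd) => t /=.
by rewrite in_itv; exact: full.
Qed.

End kl_energy.

(** * Length of second-order trajectories *)

Lemma ler_sub_shift (R : realType) (p q r s w : R) :
  p <= q -> r - s <= w -> p - s <= q - r + w.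
Proof. lra. Qed.

Lemma ler_oscillation (R : realType) (p q r s w w' m : R) :
  p - q <= r - s + w -> - p <= m -> q <= m -> w <= w' -> s <= 2 * m + r + w'.
Proof. lra. Qed.

Section windows.
Variables (R : realType) (n : nat) (ip : {dot 'rV[R]_n for idfun}).
Variables (gamma : R) (f : 'rV[R]_n -> R).
Hypotheses (g0 : 0 < gamma) (fC : C11loc ip f).
Implicit Types (eps a b k s t T : R) (x y v w : R -> 'rV[R]_n).

Let gr := gradient ip f.
Notation sol2 := (sol2 ip gamma f).
Notation energy := (energy ip f).

(* On a time window of length eps the velocity relaxes to the gradient, so the
   maximal speed mu controls the gradient from above and the energy loss from
   below. *)
Lemma window k : exists C c : R, [/\ 0 < C, 0 < c &
  forall eps x v a, 0 < eps -> eps <= 1 -> sol2 eps x v -> 0 <= a ->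
    (forall s, a <= s <= a + eps -> `|x s| <= k) ->
  exists mu : R, [/\ 0 <= mu, forall s, a <= s <= a + eps -> `|v s| <= mu,
    forall s, a <= s <= a + eps -> `|gr (x s)| <= C * mu &
    c * eps * mu ^+ 2 <= energy eps x v a - energy eps x v (a + eps)]].
Proof.
have [L L0 LP] := grad_lip fC k; have [c c0 cP] := ip_ge ip.
(* Integrate eps v' = - gamma v - grad f over the window: the change of v contributes 2 mu, friction
   gamma mu, and the variation of the gradient at most L mu, as eps <= 1. *)
pose C := 2 + gamma + L.
have C0 : 0 < C by rewrite /C addr_gt0// addr_gt0.
have gC0 : 0 < gamma + C by exact: addr_gt0.
exists C, (gamma * c / (16 * (gamma + C))); split=> //.
  by rewrite divr_gt0 ?mulr_gt0.
move=> eps x v a eps0 eps1 sol a0 xk; have [dx dv] := sol.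
have ae : a <= a + eps by lra.
have [V vV] : exists V : R, forall s, 0 <= s <= a + eps -> `|v s| <= V.
  apply: vder_bounded; first by lra.
  by move=> t /andP[t0 _]; eexists; exact: dv.
pose A := [set `|v s| | s in [set s | a <= s <= a + eps]].
have A0 : A !=set0 by exists `|v a|, a => //=; lra.
have ubA : has_ubound A by exists V => _ [s sa <-]; apply: vV; move: sa => /=; lra.
pose mu := sup A.
have vmu s : a <= s <= a + eps -> `|v s| <= mu.
  by move=> sa; apply: ub_le_sup => //; exists s.
have mu0 : 0 <= mu by apply: le_trans (vmu a _); rewrite ?lexx.
have xL s t : a <= s <= a + eps -> a <= t <= a + eps -> `|x s - x t| <= mu * eps.
  wlog st : s t / t <= s => [hw|] sa ta.
    by have [ts|/ltW st] := leP t s; [exact: hw|rewrite distrC; exact: hw].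
  apply: (@le_trans _ _ (mu * (s - t))); last by apply: ler_wpM2l => //; lra.
  apply: (vder_norm_le (v := v)) => //; first lra.
    by move=> r rst; apply: dx; lra.
  by move=> r rst; apply: vmu; lra.
have grC s : a <= s <= a + eps -> `|gr (x s)| <= C * mu.
  move=> sa; apply/rv_norm_le; first by rewrite mulr_ge0// ltW.
  have h (sg : bool) j : (-1) ^+ sg * gr (x s) 0 j <= C * mu.
    have := @der_le _ (fun t => (-1) ^+ sg * v t 0 j) a (a + eps)
      (eps^-1 * (gamma * mu - (-1) ^+ sg * gr (x s) 0 j + L * (mu * eps)))
      (fun t => (-1) ^+ sg * (- eps^-1 *: (gamma *: v t + gr (x t))) 0 j) a0 ae.
    have -> : eps^-1 * (gamma * mu - (-1) ^+ sg * gr (x s) 0 j + L * (mu * eps)) * (a + eps - a) =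
      gamma * mu - (-1) ^+ sg * gr (x s) 0 j + L * (mu * eps).
      by field; rewrite gt_eqF.
    have nv t : a <= t <= a + eps -> `|(-1) ^+ sg * v t 0 j| <= mu.
      by move=> ta; rewrite normrMsign (le_trans (rv_coord_le _ j))// vmu.
    move=> hd; have {}hd : (-1) ^+ sg * v (a + eps) 0 j - (-1) ^+ sg * v a 0 j <=
        gamma * mu - (-1) ^+ sg * gr (x s) 0 j + L * (mu * eps).
      apply: hd => t ta; first by apply: derZ; apply: dv; lra.
      rewrite !mxE.
      have -> : (-1) ^+ sg * (- eps^-1 * (gamma * v t 0 j + gr (x t) 0 j)) =
        eps^-1 * (gamma * - ((-1) ^+ sg * v t 0 j) - (-1) ^+ sg * gr (x t) 0 j) by ring.
      apply: ler_wpM2l; first by rewrite invr_ge0 ltW.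
      have h1 : gamma * - ((-1) ^+ sg * v t 0 j) <= gamma * mu.
        by apply: ler_wpM2l; [exact: ltW|have /ler_normlP[] := nv t ta].
      have h2 : `|(-1) ^+ sg * gr (x s) 0 j - (-1) ^+ sg * gr (x t) 0 j| <= L * (mu * eps).
        rewrite -mulrBr normrMsign; have := rv_coord_le (gr (x s) - gr (x t)) j.
        rewrite !mxE => /le_trans; apply; apply: le_trans (LP _ _ (xk s sa) (xk t ta)) _.
        by apply: ler_wpM2l; [exact: ltW|exact: xL].
      have /ler_normlP[_ h3] := h2.
      exact: ler_sub_shift.
    have n1 := nv (a + eps) ltac:(lra); have n2 := nv a ltac:(lra).
    have /ler_normlP[n11 n12] := n1; have /ler_normlP[n21 n22] := n2.
    have n3 : L * (mu * eps) <= L * mu.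
      by apply: ler_wpM2l; [exact: ltW|rewrite ler_piMr].
    have -> : C * mu = 2 * mu + gamma * mu + L * mu by rewrite /C; ring.
    exact: ler_oscillation hd n11 n22 n3.
  move=> j; apply/ler_normlP; split.
    by have := h true j; rewrite expr1 mulN1r.
  by have := h false j; rewrite expr0 mul1r.
exists mu; split=> //.
have [mu00|mupos] := leP mu 0.
  have -> : mu = 0 by apply/le_anti/andP.
  by rewrite expr2 !mulr0 subr_ge0; apply: (energy_nincr g0 fC).
have mu4 : 0 < mu / 4 by lra.
have [_ [s0 s0a <-] s0mu] := sup_adherent mu4 (conj A0 ubA).
rewrite -/mu /= in s0mu s0a.
(* Since |v'| <= (gamma + C) * mu / eps, the speed changes by at most mu / 4 within time d. It
   exceeds 3 mu / 4 at s0, hence is at least mu / 2 up to time d away. *)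
pose d := eps / (4 * (gamma + C)).
have d0 : 0 < d by rewrite divr_gt0// mulr_gt0.
have de : d <= eps / 2.
  rewrite /d ler_pdivrMr ?mulr_gt0// -mulrA ler_peMr// ?ltW//.
  by rewrite /C; have := g0; have := L0; lra.
have dmu : (gamma + C) * mu / eps * d = mu / 4.
  by rewrite /d; field; rewrite !gt_eqF.
have vL s t : a <= s <= a + eps -> a <= t <= a + eps -> s <= t -> t - s <= d ->
    `|v t - v s| <= mu / 4.
  move=> sa ta st tsd.
  have G0 : 0 <= (gamma + C) * mu / eps by rewrite divr_ge0 ?mulr_ge0 ?ltW.
  apply: (@le_trans _ _ ((gamma + C) * mu / eps * (t - s))); last first.
    by rewrite -dmu; exact: ler_wpM2l.
  apply: (vder_norm_le (v := fun r => - eps^-1 *: (gamma *: v r + gr (x r)))) => //.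
  - by lra.
  - by move=> r rst; apply: dv; lra.
  move=> r rst; have ra : a <= r <= a + eps by lra.
  rewrite normrZ normrN gtr0_norm ?invr_gt0// mulrC.
  apply: ler_wpM2r; first by rewrite invr_ge0 ltW.
  rewrite mulrDl; apply: le_trans (ler_normD _ _) _; apply: lerD; last exact: grC.
  rewrite normrZ gtr0_norm//; apply: ler_wpM2l; [exact: ltW|exact: vmu].
have fast s : a <= s <= a + eps -> `|s - s0| <= d -> mu / 2 <= `|v s|.
  move=> sa sd.
  have h1 : `|v s0 - v s| <= mu / 4.
    have [ss|/ltW ss] := leP s s0.
      by apply: vL => //; have /ler_normlP[] := sd; lra.
    by rewrite distrC; apply: vL => //; have /ler_normlP[] := sd; lra.
  have := ler_normD (v s0 - v s) (v s); rewrite subrK; lra.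
have [p [q [ap pq qa qpd near]]] : exists p q, [/\ a <= p, p <= q, q <= a + eps, q - p = d &
    forall s, p <= s <= q -> `|s - s0| <= d].
  have [h|h] := leP (s0 + d) (a + eps).
    exists s0, (s0 + d); split=> //; try lra.
    by move=> s sp; apply/ler_normlP; split; lra.
  exists (s0 - d), s0; split=> //; try lra.
  by move=> s sp; apply/ler_normlP; split; lra.
have Epq : energy eps x v q - energy eps x v p <= - (gamma * (c * (mu / 2) ^+ 2)) * (q - p).
  apply: (@der_le _ (energy eps x v) p q _ (fun t => - (gamma * ip (v t) (v t)))) => //.
  - by lra.
  - by move=> t tp; apply: energy_der => //; lra.
  move=> t tp; rewrite lerN2; apply: ler_wpM2l; first exact: ltW.
  apply: le_trans (cP _); apply: ler_wpM2l; first exact: ltW.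
  have ht : mu / 2 <= `|v t| by apply: fast; [lra|exact: near].
  by rewrite lerXn2r ?nnegrE//; lra.
have E1 : energy eps x v p <= energy eps x v a by apply: (energy_nincr g0 fC) => //; lra.
have E2 : energy eps x v (a + eps) <= energy eps x v q by apply: (energy_nincr g0 fC) => //; lra.
have -> : gamma * c / (16 * (gamma + C)) * eps * mu ^+ 2 =
    gamma * (c * (mu / 2) ^+ 2) * (q - p).
  by rewrite qpd /d; field; rewrite gt_eqF.
move: Epq; rewrite mulNr; lra.
Qed.

Variable (S : forall k : nat, set (set 'rV[R]_k)).
Hypotheses (HS : o_minimal_structure S) (Sf : definable_in S f).

(** All energies between Eb and Ea are attained along the window, at points of slope at most C4 *
    mu, so the energy drop is at most C4 * mu times the increment of psi. By [window] the drop is at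
    least c2 * eps * mu ^+ 2. Dividing by mu bounds eps * mu, which dominates the displacement. *)
Lemma window_length k z : 0 <= k -> exists d C (psi : R -> R), [/\ 0 < d, 0 < C,
  forall s t, z - d < s -> s <= t -> t < z + d -> psi s <= psi t,
  forall zeta : R, 0 < zeta ->
    exists r, 0 < r < d /\ psi (z + r) - psi (z - r) < zeta &
  forall eps x v a, 0 < eps -> eps <= 1 -> sol2 eps x v -> 0 <= a ->
    (forall s, a <= s <= a + eps -> `|x s| <= k) ->
    (forall s, a <= s <= a + eps -> eps * ip (v s) (v s) <= k ^+ 2) ->
    z - d < energy eps x v (a + eps) -> energy eps x v a < z + d ->
    `|x (a + eps) - x a| <= C * (psi (energy eps x v a) - psi (energy eps x v (a + eps)))].
Proof.
move=> k0; have [d [psi [d0 mono small int]]] := kl_fE HS Sf fC z k0.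
have [C1 [c2 [C10 c20 win]]] := window k.
have [C C0 CP] := ip_le ip.
(* The first term comes from the n partial derivatives, the second from the kinetic coordinate,
   which is at most sqrt C * mu as eps <= 1. *)
pose C4 := n%:R * C * C1 + Num.sqrt C.
have C40 : 0 < C4.
  rewrite /C4 ltr_wpDl ?sqrtr_gt0// !mulr_ge0 ?ler0n ?ltW//.
exists d, (C4 / c2), psi; split=> //; first exact: divr_gt0.
move=> eps x v a eps0 eps1 sol a0 xk vk zE Ez.
have [mu [mu0 vmu gmu Edrop]] := win eps x v a eps0 eps1 sol a0 xk.
have [dx dv] := sol.
have ae : a <= a + eps by lra.
set Ea := energy eps x v a in Ez Edrop *.
set Eb := energy eps x v (a + eps) in zE Edrop *.
have Eba : Eb <= Ea by apply: (energy_nincr g0 fC).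
have psi0 : 0 <= psi Ea - psi Eb by rewrite subr_ge0; apply: mono.
have xx : `|x (a + eps) - x a| <= mu * eps.
  have -> : mu * eps = mu * (a + eps - a) by ring.
  apply: (vder_norm_le (v := v)) => // t ta.
  by apply: dx; lra.
have [mu00|mupos] := leP mu 0.
  have mu00' : mu = 0 by apply/le_anti/andP.
  apply: le_trans xx _; rewrite mu00' mul0r.
  by apply: mulr_ge0 => //; apply/ltW/divr_gt0.
have att : attained (mE f) k (fE f) (C4 * mu) Eb Ea.
  move=> tau /andP[tb ta].
  have [s [sa Es]] : exists s, a <= s <= a + eps /\ energy eps x v s = tau.
    have [tE|tE] := eqVneq tau Ea; first by exists a; rewrite tE lexx.
    have tlt : tau < Ea by rewrite lt_neqAle tE.
    have [|||s [sa Es _]] := @first_hit R (fun s => - energy eps x v s) a (a + eps) (- tau) ae.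
    - by rewrite ltrN2.
    - by rewrite lerN2.
    - move=> t tab e e0; have t0 : 0 <= t by lra.
      have [r r0 rP] := der_cont (derN (energy_der fC eps0 sol t0)) e0.
      by exists r => // q qab; apply: rP; lra.
    by exists s; split; [lra|apply: oppr_inj].
  pose q := Num.sqrt (eps * ip (v s) (v s)).
  have q0 : 0 <= eps * ip (v s) (v s) by rewrite mulr_ge0 ?ip_ge0// ltW.
  exists (row_mx (x s) (\row_(j < 1) q)).
  have qk : q <= k.
    by rewrite -[leRHS](ger0_norm k0) -sqrtr_sqr ler_wsqrtr// vk.
  split.
  - apply: row_mx_le => //; first exact: xk.
    by apply/rv_norm_le => // j; rewrite mxE ger0_norm// sqrtr_ge0.
  - rewrite /fE row_mxKl row_mxEr mxE sqr_sqrtr// -Es /energy.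
    by rewrite mulrAC.
  rewrite /mE row_mxKl row_mxEr mxE /C4 mulrDl; apply: lerD.
    apply: (@le_trans _ _ (\sum_(j < n) C * (C1 * mu))).
      apply: ler_sum => j _; rewrite (gradientP ip); apply: le_trans (CP _ _) _.
      rewrite -mulrA; apply: ler_wpM2l; first exact: ltW.
      rewrite -[leRHS]mulr1; apply: ler_pM => //; first exact: gmu.
      by have := delta_norm_le j (1 : R); rewrite scale1r normr1.
    by rewrite sumr_const card_ord -[X in X <= _]mulr_natl !mulrA lexx.
  have -> : Num.sqrt C * mu = Num.sqrt (C * mu ^+ 2).
    by rewrite sqrtrM ?ltW// sqrtr_sqr ger0_norm.
  rewrite ger0_norm ?sqrtr_ge0//; apply: ler_wsqrtr.
  apply: (@le_trans _ _ (ip (v s) (v s))).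
    by rewrite ler_piMl// ip_ge0.
  apply: le_trans (ler_norm _) _; apply: le_trans (CP _ _) _.
  rewrite -mulrA -expr2; apply: ler_wpM2l; first exact: ltW.
  by rewrite lerXn2r ?nnegrE// vmu.
have C4mu : 0 <= C4 * mu by apply/ltW/mulr_gt0.
have := int Eb Ea _ zE Eba Ez C4mu att => h.
apply: le_trans xx _.
rewrite -(ler_pM2l c20) -(ler_pM2r mupos).
have -> : c2 * (mu * eps) * mu = c2 * eps * mu ^+ 2 by ring.
have -> : c2 * (C4 / c2 * (psi Ea - psi Eb)) * mu = C4 * mu * (psi Ea - psi Eb).
  by field; rewrite gt_eqF.
exact: le_trans Edrop h.
Qed.

Lemma path_length k z : 0 <= k -> exists d C (psi : R -> R), [/\ 0 < d, 0 < C,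
  forall s t, z - d < s -> s <= t -> t < z + d -> psi s <= psi t,
  forall zeta : R, 0 < zeta ->
    exists r, 0 < r < d /\ psi (z + r) - psi (z - r) < zeta &
  forall eps x v (m : nat), 0 < eps -> eps <= 1 -> sol2 eps x v ->
    (forall s, 0 <= s <= m%:R * eps -> `|x s| <= k) ->
    (forall s, 0 <= s <= m%:R * eps -> eps * ip (v s) (v s) <= k ^+ 2) ->
    z - d < energy eps x v (m%:R * eps) -> energy eps x v 0 < z + d ->
    `|x (m%:R * eps) - x 0| <=
      C * (psi (energy eps x v 0) - psi (energy eps x v (m%:R * eps)))].
Proof.
move=> k0; have [d [C [psi [d0 C0 mono small len]]]] := window_length z k0.
exists d, C, psi; split=> // eps x v m eps0 eps1 sol.
elim: m => [|m IH] xk vk zE Ez; first by rewrite mul0r !subrr mulr0 normr0.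
have m0 : 0 <= m%:R * eps by rewrite mulr_ge0// ltW.
have mS : m.+1%:R * eps = m%:R * eps + eps by rewrite -natr1 mulrDl mul1r.
rewrite mS in xk vk zE *.
have Em : energy eps x v (m%:R * eps + eps) <= energy eps x v (m%:R * eps).
  by apply: (energy_nincr g0 fC) => //; lra.
have E0 : energy eps x v (m%:R * eps) <= energy eps x v 0 by apply: (energy_nincr g0 fC).
have h1 : `|x (m%:R * eps) - x 0| <=
    C * (psi (energy eps x v 0) - psi (energy eps x v (m%:R * eps))).
  apply: IH => //; last exact: lt_le_trans Em.
  - by move=> s /andP[s0 sm]; apply: xk; rewrite s0 (le_trans sm)// lerDl ltW.
  - by move=> s /andP[s0 sm]; apply: vk; rewrite s0 (le_trans sm)// lerDl ltW.
have h2 := len eps x v (m%:R * eps) eps0 eps1 sol m0.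
have {}h2 : `|x (m%:R * eps + eps) - x (m%:R * eps)| <=
    C * (psi (energy eps x v (m%:R * eps)) - psi (energy eps x v (m%:R * eps + eps))).
  apply: h2 => //; last exact: le_lt_trans Ez.
  - by move=> s /andP[s0 sm]; apply: xk; rewrite sm (le_trans m0).
  - by move=> s /andP[s0 sm]; apply: vk; rewrite sm (le_trans m0).
rewrite -(subrK (x (m%:R * eps)) (x (_ + eps))) -addrA.
apply: le_trans (ler_normD _ _) _; apply: le_trans (lerD h2 h1) _.
by rewrite -mulrDr addrC subrKA.
Qed.

End windows.

(** * Escaping trajectories *)

Lemma min_pos (R : realType) (s : seq R) : all (fun e => 0 < e) s ->
  exists2 e, 0 < e & all (fun e' => e <= e') s.
Proof.
elim: s => [|a s IH] /=; first by exists 1.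
move=> /andP[a0 /IH[e e0 es]]; exists (Num.min a e); first by rewrite lt_min a0.
rewrite ge_min lexx; apply: sub_all es => b eb.
by rewrite (le_trans _ eb)// ge_min lexx orbT.
Qed.

Lemma variation_le (R : realType) (psi : R -> R) (z d r c s t : R) :
  (forall s t, z - d < s -> s <= t -> t < z + d -> psi s <= psi t) ->
  r < d -> 0 <= c -> z - r < s -> s <= t -> t <= z + r ->
  c * (psi t - psi s) <= c * (psi (z + r) - psi (z - r)).
Proof.
move=> mono rd c0 rs st tr; apply: ler_wpM2l => //.
by apply: lerB; apply: mono; lra.
Qed.

Lemma three_quarters (R : realType) (p q r : R) :
  p < 4^-1 -> q < 4^-1 -> r < 4^-1 -> 1 <= p + (q + r) -> False.
Proof. lra. Qed.

Section escape.
Variables (R : realType) (n : nat) (ip : {dot 'rV[R]_n for idfun}).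
Variables (gamma : R) (f : 'rV[R]_n -> R) (fmin : R).
Hypotheses (g0 : 0 < gamma) (fC : C11loc ip f) (fb : forall x, fmin <= f x).
Implicit Types (eps eta a b k s t T M r l m : R) (x y v w : R -> 'rV[R]_n) (p q : 'rV[R]_n).

Let gr := gradient ip f.
Notation sol1 := (sol1 ip gamma f).
Notation sol2 := (sol2 ip gamma f).
Notation energy := (energy ip f).

(** A single eta measures the size of eps, of the initial offset and of the kinetic term, and
    through eta^-1 the distance reached, so that the property gets stronger as eta decreases. *)
Definition escapes eta p := exists eps x v,
  [/\ 0 < eps < eta, sol2 eps x v, `|x 0 - p| < eta, eps * ip (v 0) (v 0) < eta &
      exists2 t, 0 <= t & eta^-1 < `|x t|].

(* The failure of (i) near p in the limit eps -> 0; with this definition bad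
   points form a closed set. *)
Definition bad p := forall eta, 0 < eta -> escapes eta p.

Lemma escapes_le eta eta' p q : 0 < eta' -> eta' + `|p - q| <= eta ->
  escapes eta' p -> escapes eta q.
Proof.
move=> e'0 le; have pq := normr_ge0 (p - q); have e'e : eta' <= eta by lra.
move=> [eps [x [v [/andP[eps0 eps1] sol x0 v0 [t t0 xt]]]]].
exists eps, x, v; split=> //.
- by rewrite eps0 (lt_le_trans eps1).
- have := ler_normD (x 0 - p) (p - q); rewrite addrA subrK; lra.
- exact: lt_le_trans v0 _.
exists t => //; apply: le_lt_trans xt; rewrite lef_pV2// posrE//.
exact: lt_le_trans e'e.
Qed.

(** Points of a compact set that escape for ever smaller eta accumulate at a bad point; Q carries
    along further information, to be passed to the limit by continuity. *)
Lemma bad_cluster (K : set 'rV[R]_n) (Q : R -> 'rV[R]_n -> Prop) : compact K ->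
  (forall eta eta' p, 0 < eta' -> eta' <= eta -> Q eta' p -> Q eta p) ->
  (forall eta, 0 < eta -> exists p, [/\ K p, Q eta p & escapes eta p]) ->
  exists p, bad p /\ forall eta r : R, 0 < eta -> 0 < r ->
    exists q, `|q - p| < r /\ Q eta q.
Proof.
move=> cK Qm ex.
have [||p Kp h] := compact_cluster_unif (Q := fun eta p => Q eta p /\ escapes eta p) cK.
- move=> eta eta' p e'0 le [Qp ep]; split; first exact: Qm Qp.
  by apply: escapes_le ep => //; rewrite subrr normr0 addr0.
- by move=> eta /ex[p [Kp Qp ep]]; exists p.
exists p; split=> [eta eta0|eta r eta0 r0].
  have e2 : 0 < eta / 2 by lra.
  have [q [qp [_ eq]]] := h _ _ e2 e2.
  by apply: escapes_le eq => //; lra.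
by have [q [qp [Qq _]]] := h _ _ eta0 r0; exists q.
Qed.

(** Up to time s the trajectory stays within r <= l, so the time at which its norm exceeds l comes
    later, and the trajectory shifted by s still escapes. *)
Lemma restart eta p eps x v s r l : 0 < eps < eta -> sol2 eps x v -> 0 <= s ->
  (forall t, 0 <= t <= s -> `|x t| <= r) -> r <= l -> eta^-1 <= l ->
  (exists2 t, 0 <= t & l < `|x t|) ->
  `|x s - p| < eta -> eps * ip (v s) (v s) < eta -> escapes eta p.
Proof.
move=> eps0 sol s0 xr rl el [t t0 lt] xs vs.
exists eps, (fun t => x (s + t)), (fun t => v (s + t)).
split; [exact: eps0|exact: sol2_shift|by rewrite addr0|by rewrite addr0|].
exists (t - s); last by rewrite addrC subrK (le_lt_trans el).
rewrite subr_ge0 leNgt; apply/negP => ts.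
have := xr t; rewrite t0 (ltW ts) => /(_ isT); lra.
Qed.

Lemma energy0_lt eps x v m p : 0 < eps -> `|f (x 0) - f p| < m / 2 ->
  eps * ip (v 0) (v 0) < m -> energy eps x v 0 < f p + m.
Proof.
move=> eps0 /ltr_normlP[_ h1] h2.
have -> : energy eps x v 0 = f (x 0) + eps * ip (v 0) (v 0) / 2 by rewrite /energy; field.
lra.
Qed.

(** An escaping solution that starts near y 0 follows y up to time s + th. It is restarted not at s
    but at a slow time shortly after, where its kinetic term is known to be small with eps. *)
Lemma bad_flow y M : sol1 y -> (forall t, 0 <= t -> `|y t| <= M) -> bad (y 0) ->
  forall s, 0 <= s -> bad (y s).
Proof.
move=> dy yM by0 s s0 eta eta0.
have M0 : 0 <= M by apply: le_trans (yM 0 (lexx 0)).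
have eta20 : 0 < eta / 2 by lra.
have [th [th0 near]] : exists th, 0 < th /\ forall t, s <= t <= s + th -> `|y t - y s| < eta / 2.
  have [r r0 rP] := vder_cont (dy s s0) eta20.
  exists (r / 2); split; first lra.
  by move=> t st; apply: rP; [lra|rewrite ger0_norm; lra].
have e10 : 0 < Num.min (eta / 2) 1 by rewrite lt_min eta20 ltr01.
have T0 : 0 <= s + th by lra.
have [k k0 conv] := converge g0 fC fb dy T0 e10.
have half0 : 0 < 1 / 2 :> R by lra.
have [r1 r10 fr1] := fcont_eps fC (y 0) half0.
pose B := f (y 0) + 1 - fmin.
have B0 : 0 < B by have := fb (y 0); rewrite /B; lra.
have kk0 : 0 < B / th by rewrite divr_gt0.
have eg0 : 0 < eta * gamma / (B / th) by apply: divr_gt0 => //; exact: mulr_gt0.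
have M10 : 0 < (M + 1)^-1 by rewrite invr_gt0 ltr_wpDl.
have [|e2 e20] := @min_pos _ [:: k; r1; 1; eta; eta * gamma / (B / th); (M + 1)^-1].
  by rewrite /= k0 r10 ltr01 eta0 eg0 M10.
move=> /= /and5P[ek er e1 ee /and3P[eg eM _]].
have [eps [x [v [/andP[eps0 epse] sol x0 v0 [t t0 xt]]]]] := by0 _ e20.
have tube := conv eps x v eps0 (lt_le_trans epse ek) sol (lt_le_trans x0 ek) (lt_le_trans v0 ek).
have xM t' : 0 <= t' <= s + th -> `|x t'| <= M + 1.
  move=> t'T; have := tube t' t'T; rewrite lt_min => /andP[_ h].
  have := ler_normD (x t' - y t') (y t'); rewrite subrK.
  by have := yM t' (andP t'T).1; lra.
have E0 : energy eps x v 0 < f (y 0) + 1.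
  by apply: energy0_lt => //; [apply: fr1; exact: lt_le_trans er|exact: lt_le_trans e1].
have [||s' ss' slow] := @slow_time _ _ ip gamma f fC eps x v s (s + th) (B / th) eps0 sol s0.
- by lra.
- have := energy_ge ip fb x v (s + th) eps0.
  have := energy_nincr g0 fC eps0 sol (lexx 0) s0.
  have -> : B / th * (s + th - s) = B by field; rewrite gt_eqF.
  rewrite /B; lra.
have s'0 : 0 <= s' by lra.
have s'T : 0 <= s' <= s + th by lra.
apply: (restart (x := x) (v := v) (s := s') (r := M + 1) (l := e2^-1) (eps := eps)) => //.
- by rewrite eps0 (lt_le_trans epse).
- by move=> t' t's; apply: xM; lra.
- by rewrite -[leLHS]invrK lef_pV2// posrE.
- by rewrite lef_pV2// posrE.
- by exists t.
- have := tube s' s'T; rewrite lt_min => /andP[h1 _].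
  have h2 := near s' ss'; have := ler_normD (x s' - y s') (y s' - y s).
  by rewrite addrA subrK; lra.
have h1 : eps < eta * gamma / (B / th) by exact: lt_le_trans eg.
rewrite ltr_pdivlMr// in h1.
rewrite -(ltr_pM2r g0); apply: le_lt_trans h1.
by rewrite -mulrA; apply: ler_wpM2l; [exact: ltW|rewrite mulrC].
Qed.

(** As f is bounded below, the gradient becomes arbitrarily small along y. The points y t where it
    does are bad and lie in a ball; continuity of f and of its gradient carries both conditions of Q
    to the limit. *)
Lemma bad_crit y M : sol1 y -> (forall t, 0 <= t -> `|y t| <= M) -> bad (y 0) ->
  exists p, [/\ bad p, gr p = 0 & f p <= f (y 0)].
Proof.
move=> dy yM by0.
have M0 : 0 <= M by apply: le_trans (yM 0 (lexx 0)).
have [c c0 cP] := ip_ge ip.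
have df t : 0 <= t -> der (fun s => f (y s)) t (- (gamma^-1 * ip (gr (y t)) (gr (y t)))).
  move=> t0; have := der_f fC (dy t t0); congr der.
  by rewrite linearZ /= mulNr.
have fle t : 0 <= t -> f (y t) <= f (y 0).
  move=> t0; apply: (der_nincr (u := fun s => f (y s))) => // s st; eexists; last by apply: df; lra.
  by rewrite oppr_le0 mulr_ge0 ?ip_ge0// invr_ge0 ltW.
have slow eta : 0 < eta -> exists2 t, 0 <= t & `|gr (y t)| <= eta.
  move=> eta0; apply: contrapT => nex.
  pose k := gamma^-1 * (c * eta ^+ 2).
  have k0 : 0 < k by rewrite mulr_gt0 ?invr_gt0// mulr_gt0// exprn_gt0.
  pose t := (f (y 0) - fmin + 1) / k.
  have ft := fb (y 0).
  have t0 : 0 <= t by rewrite divr_ge0 ?ltW//; lra.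
  have := @der_le _ (fun s => f (y s)) 0 t (- k)
    (fun s => - (gamma^-1 * ip (gr (y s)) (gr (y s)))) (lexx 0) t0.
  rewrite subr0 mulNr => h; have {}h : f (y t) - f (y 0) <= - (k * t).
    apply: h => s /andP[s0 st]; first exact: df.
    rewrite lerN2; apply: ler_wpM2l; first by rewrite invr_ge0 ltW.
    apply: le_trans (cP _); apply: ler_wpM2l; first exact: ltW.
    rewrite lerXn2r ?nnegrE// ?(ltW eta0)// leNgt; apply/negP => lt.
    by apply: nex; exists s => //; exact: ltW.
  have kt : k * t = f (y 0) - fmin + 1 by rewrite /t mulrC divfK// gt_eqF.
  by have := fb (y t); lra.
have cK := @ball_compact R n 0 M.
have [||p [badp near]] := bad_cluster (Q := fun eta q => f q <= f (y 0) /\ `|gr q| <= eta) cK.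
- by move=> eta eta' q _ le [fq gq]; split=> //; exact: le_trans gq le.
- move=> eta eta0; have [t t0 gt] := slow eta eta0.
  exists (y t); split; first by rewrite /= subr0 yM.
    by split=> //; exact: fle.
  exact: bad_flow dy yM by0 t t0 eta eta0.
exists p; split=> //.
  apply/eqP; rewrite -normr_le0; apply/ler_addgt0Pr => e e0; rewrite add0r.
  have [L L0 LP] := grad_lip fC (`|p| + 1).
  have e20 : 0 < e / 2 by lra.
  have r0 : 0 < Num.min 1 (e / 2 / L) by rewrite lt_min ltr01 divr_gt0.
  have [q [qp [_ gq]]] := near _ _ e20 r0; rewrite lt_min in qp.
  have /andP[q1 q2] := qp; rewrite ltr_pdivlMr// mulrC in q2.
  have qn : `|q| <= `|p| + 1.
    by have := ler_normD (q - p) p; rewrite subrK; lra.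
  have pn : `|p| <= `|p| + 1 by lra.
  have h1 := LP q p qn pn.
  have -> : gr p = gr q - (gr q - gr p) by rewrite opprB addrC subrK.
  have -> : e = e / 2 + e / 2 by field.
  apply: le_trans (ler_normB _ _) _; apply: lerD => //.
  exact: le_trans h1 (ltW q2).
apply/ler_addgt0Pr => e e0; have [r r0 rP] := fcont_eps fC p e0.
have [q [qp [fq _]]] := near 1 r ltr01 r0.
by have /ltr_normlP[h1 _] := rP q qp; lra.
Qed.

Variable (S : forall k : nat, set (set 'rV[R]_k)).
Hypotheses (HS : o_minimal_structure S) (Sf : definable_in S f).

(** Meant for the last, incomplete window: a kinetic term at most B allows speeds of order
    eps^(-1/2) only, hence a displacement of order eps^(1/2) within time eps. The factor 1/16 is the
    square of the 1/4 claimed. *)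
Lemma short_step : exists2 c : R, 0 < c & forall eps x v a T B, 0 < eps -> 0 < B ->
  sol2 eps x v -> (forall t, 0 <= t -> eps * ip (v t) (v t) <= B) ->
  0 <= a -> a <= T -> T <= a + eps -> eps < c / B -> `|x T - x a| < 4^-1.
Proof.
have [c c0 cP] := ip_ge ip; exists (c / 16); first by rewrite divr_gt0.
move=> eps x v a T B eps0 B0 [dx _] kin a0 aT Ta epsc.
pose V := Num.sqrt (B / (c * eps)).
have V0 : 0 <= V by exact: sqrtr_ge0.
have ceps : 0 < c * eps by exact: mulr_gt0.
have Beps : 0 <= B / (c * eps) by rewrite divr_ge0// ltW.
have h4 : `|x T - x a| <= V * (T - a).
  apply: (vder_norm_le (v := v)) => // s sa; first by apply: dx; lra.
  rewrite -[leLHS]ger0_norm// -sqrtr_sqr; apply: ler_wsqrtr.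
  rewrite ler_pdivlMr// mulrC -mulrA mulrCA.
  apply: le_trans (kin s _); last by lra.
  by apply: ler_wpM2l; [exact: ltW|exact: cP].
have h6 : V * (T - a) <= V * eps by apply: ler_wpM2l => //; lra.
apply: le_lt_trans h4 _; apply: le_lt_trans h6 _.
have q40 : 0 < 4^-1 :> R by rewrite invr_gt0.
have Ve : 0 <= V * eps by rewrite mulr_ge0// ltW.
rewrite -(@ltr_pXn2r _ 2) ?nnegrE ?(ltW q40)// exprMn sqr_sqrtr//.
have -> : B / (c * eps) * eps ^+ 2 = eps * (B / c) by field; rewrite !gt_eqF.
rewrite -ltr_pdivlMr ?divr_gt0//; apply: lt_le_trans epsc _.
by rewrite le_eqVlt; apply/orP; left; apply/eqP; field; rewrite !gt_eqF.
Qed.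

(* A solution escaping from near p has lost a definite amount of energy when
   it is at distance 1 from p, because of [path_length]. *)
Lemma bad_exit p : bad p -> exists2 q, bad q & f q < f p.
Proof.
move=> badp; set z := f p.
pose B := 2 * (z + 1 - fmin).
have B2 : 2 <= B by have := fb p; rewrite -/z /B; lra.
have zB : z + 1 - fmin <= B by rewrite /B in B2 *; lra.
have B0 : 0 < B by lra.
(* Large enough for the positions before the exit, of norm at most |p| + 1, and for the kinetic
   coordinate, as eps * ip v v <= B <= k ^+ 2. *)
pose k := `|p| + 2 + B.
have p0 := normr_ge0 p.
have k0 : 0 <= k by rewrite /k; lra.
have pk : `|p| + 1 <= k by rewrite /k; lra.
have k2 : B <= k ^+ 2.
  by rewrite expr2; apply: (@le_trans _ _ (1 * k)); [|apply: ler_wpM2r => //]; rewrite /k; lra.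
have [d [C [psi [d0 C0 mono small len]]]] := path_length g0 fC HS Sf z k0.
(* Without the energy drop, the path over the complete windows would be shorter than 1/4. The
   initial offset and the incomplete window also count less than 1/4 each, and the distance 1 would
   not be reached. *)
have zeta0 : 0 < (4 * C)^-1 by rewrite invr_gt0 mulr_gt0.
have [r [/andP[r0 rd] psir]] := small _ zeta0.
have [m [m0 mr m1]] : exists m : R, [/\ 0 < m, m <= r & m <= 1].
  by exists (Num.min r 1); rewrite lt_min r0 ltr01 !ge_min !lexx orbT.
have zr : z - r < z + 1 by lra.
have m20 : 0 < m / 2 by lra.
have [r1 r10 fr1] := fcont_eps fC p m20.
have [c c0 step] := short_step; have [Cd Cd0 disp] := displacement g0 fC.
(* At time a the norm is at most |p| + 1; the restart takes place within time 1 after a, during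
   which [displacement] allows at most 1 + Cd * B. *)
pose M := `|p| + 1 + (1 + Cd * B).
have CdB : 0 <= Cd * B by rewrite mulr_ge0// ltW//; lra.
have M0 : 0 < M by rewrite /M; lra.
have pM : `|p| + 1 <= M by rewrite /M; lra.
have Bc0 : 0 < c / B by exact: divr_gt0.
suff main eta : 0 < eta -> exists q, [/\ `|q - 0| <= M, f q <= z - r & escapes eta q].
  have [||q [badq near]] := bad_cluster (Q := fun _ q => f q <= z - r) (@ball_compact R n 0 M).
  - by [].
  - by move=> eta /main.
  exists q => //; suff : f q <= z - r by lra.
  apply/ler_addgt0Pr => e e0; have [r' r'0 rP] := fcont_eps fC q e0.
  have [q' [q'q fq']] := near 1 r' ltr01 r'0.
  by have /ltr_normlP[h1 _] := rP q' q'q; lra.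
move=> eta0.
have eg0 : 0 < eta * gamma / B by apply: divr_gt0 => //; exact: mulr_gt0.
have M'0 : 0 < M^-1 by rewrite invr_gt0.
have q40 : 0 < 4^-1 :> R by rewrite invr_gt0.
have [|e2 e20] := @min_pos _ [:: 4^-1; r1; m; eta; eta * gamma / B; M^-1; c / B].
  by rewrite /= q40 r10 m0 eta0 eg0 M'0 Bc0.
move=> /= /and5P[e4 er em ee /and4P[eg eM eB _]].
have [eps [x [v [/andP[eps0 epse] sol x0 v0 [t1 t10 xt1]]]]] := badp _ e20.
have [dx dv] := sol.
have E0 : energy eps x v 0 < z + m.
  by apply: energy0_lt => //; [apply: fr1; exact: lt_le_trans er|exact: lt_le_trans em].
have e21 : e2 <= 1 by rewrite (le_trans e4)// invf_le1// ler1n.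
have eps1 : eps <= 1 by rewrite (le_trans (ltW epse)).
have kin t : 0 <= t -> eps * ip (v t) (v t) <= B.
  move=> t0; apply: le_trans (kinetic_le g0 fC fb eps0 sol t0) _.
  by rewrite /B; lra.
have Me : M < `|x t1|.
  by apply: le_lt_trans xt1; rewrite -[leLHS]invrK lef_pV2// posrE.
have x0p : `|x 0 - p| < 1 by rewrite (lt_le_trans x0).
have far : 1 <= `|x t1 - p|.
  by have := ler_normD (x t1 - p) p; rewrite subrK; rewrite /M in Me; lra.
have [t tt e e0|T [/andP[T0 Tt1] xT below]] := first_hit t10 (u := fun t => `|x t - p|) x0p far.
  have /andP[t0 _] := tt.
  have [r' r'0 rP] := vder_cont (dx t t0) e0; exists r' => // s ss st.
  apply: le_lt_trans (ler_dist_dist _ _) _.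
  by rewrite opprB addrA subrK; apply: rP => //; case/andP: ss.
have xk t : 0 <= t <= T -> `|x t| <= `|p| + 1.
  move=> /andP[t0 tT]; have := ler_normD (x t - p) p; rewrite subrK => /le_trans; apply.
  rewrite addrC lerD2l.
  move: tT; rewrite le_eqVlt => /predU1P[->|tT]; first by rewrite xT.
  by apply/ltW/below; rewrite t0.
(* N complete windows fit before the exit time T: [path_length] applies up to a, and [short_step]
   from a to T. *)
pose N := Num.truncn (T / eps); pose a := N%:R * eps.
have Te0 : 0 <= T / eps by rewrite divr_ge0 ?ltW.
have aT : a <= T by rewrite /a -ler_pdivlMr// truncn_le.
have Ta : T < a + eps.
  rewrite /a -[X in _ + X]mul1r -mulrDl natr1 -ltr_pdivrMr//; exact: truncnS_gt.
have a0 : 0 <= a by rewrite /a mulr_ge0// ltW.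
have Ea : energy eps x v a <= z - r.
  rewrite leNgt; apply/negP => Ea.
  have Ea0 := energy_nincr g0 fC eps0 sol (lexx 0) a0.
  have := len eps x v N eps0 eps1 sol; rewrite -/a => h.
  have {}h : `|x a - x 0| <= C * (psi (energy eps x v 0) - psi (energy eps x v a)).
    apply: h.
    - move=> s /andP[s0 sa]; apply: le_trans (xk s _) pk; rewrite s0.
      exact: le_trans sa aT.
    - by move=> s /andP[s0 sa]; apply: le_trans (kin s s0) k2.
    - by rewrite (lt_trans _ Ea)// ltrD2l ltrN2.
    - by rewrite (lt_trans E0)// ltrD2l (le_lt_trans mr).
  have h3 : C * (psi (energy eps x v 0) - psi (energy eps x v a)) < 4^-1.
    apply: (@le_lt_trans _ _ (C * (psi (z + r) - psi (z - r)))).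
      have Emr : energy eps x v 0 <= z + r by rewrite (le_trans (ltW E0))// lerD2l.
      exact: variation_le mono rd (ltW C0) Ea Ea0 Emr.
    rewrite mulrC -ltr_pdivlMr//; apply: lt_le_trans psir _.
    by rewrite invfM.
  have h4 : `|x T - x a| < 4^-1.
    by apply: (step eps x v a T B) => //; [exact: ltW|exact: lt_le_trans eB].
  have : `|x T - p| <= `|x T - x a| + (`|x a - x 0| + `|x 0 - p|).
    have -> : x T - p = (x T - x a) + ((x a - x 0) + (x 0 - p)) by rewrite !addrA !subrK.
    by apply: le_trans (ler_normD _ _) _; rewrite lerD2l ler_normD.
  by rewrite xT; exact: three_quarters h4 (le_lt_trans h h3) (lt_le_trans x0 e4).
have a1 : a <= a + 1 by rewrite lerDl.
have [|s sa slow] := @slow_time _ _ ip gamma f fC eps x v a (a + 1) B eps0 sol a0 a1.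
  have -> : B * (a + 1 - a) = B by ring.
  apply: le_lt_trans (lerB Ea (energy_ge ip fb x v (a + 1) eps0)) (lt_le_trans _ zB).
  by rewrite ltrD2r.
have s0 : 0 <= s by rewrite (le_trans a0) ?(andP sa).1.
have xM t : 0 <= t <= s -> `|x t| <= M.
  move=> /andP[t0 ts]; have [ta|/ltW at'] := leP t a.
    by apply: le_trans (xk t _) pM; rewrite t0 (le_trans ta).
  have h := disp eps x v a t eps0 sol a0 at'.
  have h1 : Cd * (energy eps x v a - energy eps x v t) <= Cd * B.
    apply: ler_wpM2l; first exact: ltW.
    apply: le_trans (lerB Ea (energy_ge ip fb x v t eps0)) (le_trans _ zB).
    by rewrite lerD2r ltW.
  have ta1 : t - a <= 1 by rewrite lerBlDl (le_trans ts)// (andP sa).2.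
  have := ler_normD (x t - x a) (x a); rewrite subrK => /le_trans; apply.
  rewrite addrC; apply: lerD; first by apply: xk; rewrite a0.
  exact: le_trans h (lerD ta1 h1).
exists (x s); split.
- by rewrite subr0; apply: xM; rewrite s0 lexx.
- have h1 := energy_nincr g0 fC eps0 sol a0 (andP sa).1.
  apply: le_trans (le_trans h1 Ea); rewrite /energy lerDl mulr_ge0 ?ip_ge0//.
  by rewrite divr_ge0// ltW.
apply: (restart (x := x) (v := v) (s := s) (r := M) (l := e2^-1) (eps := eps)) => //.
- by rewrite eps0 (lt_le_trans epse).
- by rewrite -[leLHS]invrK lef_pV2// posrE.
- by rewrite lef_pV2// posrE.
- by exists t1.
- by rewrite subrr normr0.
have h1 : eps < eta * gamma / B by exact: lt_le_trans eg.
rewrite ltr_pdivlMr // in h1.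
rewrite -(ltr_pM2r g0); apply: le_lt_trans h1.
by rewrite -mulrA; apply: ler_wpM2l; [exact: ltW|rewrite mulrC].
Qed.

(* The values at bad critical points have no minimum, whereas critical values
   cannot accumulate from above at their infimum. *)
Lemma no_bad : (forall y, sol1 y -> exists M, forall t, 0 <= t -> `|y t| <= M) ->
  forall p, ~ bad p.
Proof.
move=> bounded p badp.
have flow q : bad q -> exists q', [/\ bad q', gr q' = 0 & f q' <= f q].
  move=> badq; have [y [y0 dy]] := sol1_exists g0 fC fb q.
  have [M yM] := bounded y dy; rewrite -y0 in badq *.
  exact: bad_crit dy yM badq.
pose V := [set t | exists q, [/\ bad q, gr q = 0 & f q = t]].
have [q [badq gq _]] := flow p badp.
have V0 : V !=set0 by exists (f q), q.
have Vlb : has_lbound V by exists fmin => _ [q' [_ _ <-]]; exact: fb.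
have [d d0 iso] := crit_isolated HS Sf fC (inf V).
have [_ [q' [badq' gq' <-]] fq'] := inf_adherent d0 (conj V0 Vlb).
apply: (iso (f q')); last by exists q'.
rewrite fq' andbT.
have [q1 badq1 fq1] := bad_exit badq'.
have [q2 [badq2 gq2 fq2]] := flow q1 badq1.
have : inf V <= f q2 by apply: ge_inf => //; exists q2.
by move=> /le_lt_trans; apply; exact: le_lt_trans fq2 fq1.
Qed.

End escape.

(** * Uniform boundedness for small eps against boundedness of the gradient flow *)

Theorem theorem1 (R : realType) (n : nat) (ip : {dot 'rV[R]_n for idfun})
  (gamma : R) (f : 'rV[R]_n -> R) :
  0 < gamma ->
  C11loc ip f ->
  has_lbound (range f) ->
  definable_o_minimal f ->
  (forall x0 v0 : 'rV[R]_n,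
     exists ebar c : R, [/\ 0 < ebar, 0 < c &
       forall eps, 0 < eps <= ebar -> forall x : R -> 'rV[R]_n,
         second_order_solution ip f gamma eps x0 v0 x ->
         forall t, 0 <= t -> ip_norm ip (x t) <= c])
  <->
  (forall (x0 : 'rV[R]_n) (x : R -> 'rV[R]_n),
     first_order_solution ip f gamma x0 x ->
     exists c : R, forall t, 0 <= t -> ip_norm ip (x t) <= c).
Proof.
move=> g0 fC [fmin fmin_le] [S HS Sf].
have fb x : fmin <= f x by apply: fmin_le; exists x.
have [c1 [C1 [c10 C10 ipn]]] := ip_norm_le ip.
split=> [bnd x0 x /(@first_order_solutionP _ _ ip _ f g0) [xx0 dx]|bnd x0 v0].
  have [ebar [c [ebar0 c0 cP]]] := bnd x0 0.
  exists (C1 * (c / c1 + 1)) => t t0.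
  (* The threshold k depends on t but the bound c does not, so for each t one small eps is
     enough. *)
  have [k k0 conv] := converge g0 fC fb dx t0 (@ltr01 R).
  pose eps := Num.min ebar (k / 2).
  have eps0 : 0 < eps by rewrite lt_min ebar0 divr_gt0.
  have epsk : eps < k.
    by rewrite gt_min; apply/orP; right; rewrite ltr_pdivrMr// ltr_pMr// ltr1n.
  (* Statement (i) quantifies over all solutions; to be of use it needs one that exists. *)
  have [y [v [y0 v0 sol]]] := sol2_exists g0 fC fb x0 0 eps0.
  have yc : ip_norm ip (y t) <= c.
    apply: (cP eps) => //; first by rewrite eps0 ge_min lexx.
    by apply/(@second_order_solutionP _ _ ip gamma f eps _ _ _ eps0); exists v.
  have /andP[h1 _] := ipn (y t); have /andP[_ h2] := ipn (x t).
  have yt : `|y t| <= c / c1 by rewrite ler_pdivlMr// mulrC (le_trans h1).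
  have yx : `|y t - x t| < 1.
    apply: (conv eps y v) => //; last by rewrite t0 lexx.
      by rewrite y0 xx0 subrr normr0.
    by rewrite v0 linear0 mulr0.
  apply: le_trans h2 _; apply: ler_wpM2l; first exact: ltW.
  rewrite -(subrK (y t) (x t)) addrC; apply: le_trans (ler_normD _ _) _.
  by apply: lerD => //; rewrite distrC ltW.
apply: contrapT => nbnd.
apply: (@no_bad _ _ ip gamma f fmin g0 fC fb S HS Sf _ x0) => [y dy|eta eta0].
  have [|c cP] := bnd (y 0) y; first exact/(@first_order_solutionP _ _ ip _ f g0).
  exists (c / c1) => t t0; rewrite ler_pdivlMr// mulrC.
  by have /andP[h _] := ipn (y t); apply: le_trans h (cP t t0).
have v1 : 0 < ip v0 v0 + 1 by have := ip_ge0 ip v0; lra.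
have [ebar [ebar0 ebar1 ebar2]] : exists e : R,
    [/\ 0 < e, e < eta & e * ip v0 v0 < eta].
  exists (Num.min (eta / 2) (eta / 2 / (ip v0 v0 + 1))).
  have e2 : 0 < eta / 2 by lra.
  have e3 : 0 < eta / 2 / (ip v0 v0 + 1) by rewrite divr_gt0.
  split; first by rewrite lt_min e2.
    by rewrite gt_min; apply/orP; left; lra.
  apply: (@le_lt_trans _ _ (eta / 2)); last by lra.
  apply: (@le_trans _ _ (eta / 2 / (ip v0 v0 + 1) * (ip v0 v0 + 1))).
    apply: ler_pM; [by rewrite le_min !ltW|exact: ip_ge0|by rewrite ge_min lexx orbT|lra].
  by rewrite divfK// gt_eqF.
(* If no solution escaped, ebar and C1 * eta^-1 would be the constants required by (i) at (x0,
   v0). *)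
apply: contrapT => nesc; apply: nbnd; exists ebar, (C1 * eta^-1).
split=> // [|eps /andP[eps0 epse] x sol t t0]; first by rewrite mulr_gt0// invr_gt0.
have /(@second_order_solutionP _ _ ip gamma f eps _ _ _ eps0)[v [xx0 vv0 sol']] := sol.
have /andP[_ h] := ipn (x t); apply: le_trans h _; apply: ler_wpM2l; first exact: ltW.
rewrite leNgt; apply/negP => far; apply: nesc; exists eps, x, v; split=> //.
- by rewrite eps0 (le_lt_trans epse).
- by rewrite xx0 subrr normr0.
- by rewrite vv0; apply: le_lt_trans ebar2; apply: ler_wpM2r => //; exact: ip_ge0.
- by exists t.
Qed.
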